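(* Let $N$ be a nilpotent structure of nilpotence index $n$ on a manifold $\mathcal M$. Then $N$ is self-adjoint and parallel for a pseudo-Riemannian metric $g$ if and only if $g$ is the real metric associated with a (non degenerate, symmetric, $\mathbb R[\nu]$-bilinear) metric $h$ nilomorphic for $N$. In nilomorphic local coordinates $(z_i)_{i=1}^D:=(x_i+(\nu y_i))_{i=1}^D$, $h$ is an $\mathbb R[\nu]$-valued, $\mathbb R[\nu]$-bilinear metric of the form $$h=\sum_{i,j=1}^Dh_{i,j}\,\mathrm dz_i\otimes \mathrm dz_j=\sum_{i,j=1}^D\sum_\alpha\frac1{\alpha!}\,\frac{\partial^{|\alpha|}\check h_{i,j}}{\partial x^\alpha}\,(\nu y)^\alpha\,\mathrm dz_i\otimes \mathrm dz_j,$$ with nilomorphic functions $h_{i,j}=h_{j,i}$ with values in $\nu^{\,n-\min(n(i),n(j))}\mathbb R[\nu]$ and $(h_{i,j})_{i,j=1}^D$ non degenerate, $\alpha=(\alpha_i)_{i=1}^D$ a multi-index, and $\check h_{i,j}=\check h_{j,i}$ adapted functions of the $(x_i)_i$ giving these properties of $(h_{i,j})_{i,j=1}^D$. The characteristic signatures $(r_a,s_a)_{a=1}^n$ of $(N,g)$ are the signatures of $h$.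
   Context: Nilpotent structure: a field $N$ of endomorphisms of $T\mathcal M$, nilpotent of index $n$ ($N^{n-1}\neq N^n=0$), which is integrable, i.e. has constant matrix in suitable local coordinates. Parallel: for the Levi-Civita connection of $g$. Set $\mathbb R[\nu]:=\mathbb R[X]/(X^n)$ with $\nu$ the class of $X$; each $T_m\mathcal M$ is an $\mathbb R[\nu]$-module through $\nu\cdot V:=NV$. Foliations: $\mathcal I$ is tangent to $\operatorname{Im}N$, $\mathcal K^a$ is tangent to $\ker N^a$; one works on open sets $\mathcal U$ where they are trivial, $\pi:\mathcal U\to\mathcal U/\mathcal I$ is the projection and $\pi(\mathcal K^a)$ the image foliation. Coordinates: $N$-integral coordinates are local coordinates $(x_i,(y_{i,a})_{a=1}^{n(i)-1})_{i=1}^D$ with $\frac{\partial}{\partial y_{i,a}}=N^a\frac{\partial}{\partial x_i}$ for $1\le a\le n(i)-1$ and $N^{n(i)}\frac{\partial}{\partial x_i}=0$; $D$ is the number of Jordan blocks of $N$ and $n(1)\le\dots\le n(D)$ are their sizes. Set $(\nu y_i):=\sum_{a=1}^{n(i)-1}\nu^ay_{i,a}$ and $z_i:=x_i+(\nu y_i)$ (nilomorphic coordinates). The $(x_i)_i$ are coordinates on $\mathcal U/\mathcal I$. For $\alpha\in\mathbb N^D$: $|\alpha|=\sum\alpha_i$, $\alpha!=\prod\alpha_i!$, $(\nu y)^\alpha=\prod_i(\nu y_i)^{\alpha_i}$. Nilomorphic objects: a differentiable $\mathbb R[\nu]$-valued function $f$ is nilomorphic if $\mathrm df\circ N=\nu\,\mathrm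 df$. A vector field $V$ is nilomorphic if $\mathcal L_VN=0$. An $\mathbb R[\nu]$-valued bilinear form $h$ is nilomorphic if it is $\mathbb R[\nu]$-bilinear and $\mathcal L_{NV}h=\nu\mathcal L_Vh$ for every nilomorphic vector field $V$; it is non degenerate if $h(V,\cdot)=0$ implies $V=0$. Adapted function: a function $\check f:\mathcal U/\mathcal I\to\mathbb R[\nu]$ such that, for each $a\in\{0,\dots,n-1\}$, $\nu^a\check f$ is constant along the leaves of $\pi(\mathcal K^a)$. Real metric associated with $h=\sum_{a=0}^{n-1}\nu^ah_a$ ($h_a$ real): $g=h_{n-1}$; then $h=\sum_{a=0}^{n-1}\nu^ag(\,\cdot\,,N^{n-1-a}\,\cdot\,)$. Signatures: with $\bar\pi:T_m\mathcal M\to T_m\mathcal M/\operatorname{Im}N$, the characteristic signature $(r_a,s_a)$ of $(N,g)$ is the signature of the symmetric form $g(\,\cdot\,,N^{a-1}\,\cdot\,)$, well defined on $\bar\pi(\ker N^a)/\bar\pi(\ker N^{a-1})$. If $S\oplus\operatorname{Im}N=T_m\mathcal M$, the signatures of $h$ are the signatures, for $a=1,\dots,n$, of the (well defined) form $h_{n-a}$ on $(S\cap\ker N^a)/(S\cap\ker N^{a-1})$.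
   Formalization: The signatures of h are computed on complements S of Im N that also satisfy π(S∩ker N^a)=π(ker N^a) for all a (shown to exist); for an arbitrary complement S, as in the stated definition, they depend on S and equality with the characteristic signatures fails. *)

(* Defs.v *)
From HB Require Import structures.
From mathcomp Require Import all_boot all_order all_algebra qpoly.
From mathcomp Require Import all_classical all_reals all_analysis.

Set Implicit Arguments.
Unset Strict Implicit.
Unset Printing Implicit Defensive.

Import Order.TTheory GRing.Theory Num.Theory.
Import numFieldNormedType.Exports.
Local Open Scope classical_set_scope.
Local Open Scope ring_scope.

(* Vectors are row vectors: an endomorphism with matrix A maps v to v *m A, and
   the bilinear form with matrix H maps (v, w) to v *m H *m w^T. *)

(** * The algebra R[nu] = R[X]/(X^n) *)

Definition Rnu (R : realType) (n : nat) := {poly %/ ('X^n : {poly R})}.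

Definition nu (R : realType) (n : nat) : Rnu R n := in_qpoly 'X^n 'X.

Definition nucoef (R : realType) (n a : nat) (f : Rnu R n) : R :=
  (f : {poly R})`_a.

Definition toRnu (R : realType) (n : nat) (p q : nat) (A : 'M[R]_(p, q)) :
  'M[Rnu R n]_(p, q) := map_mx (fun t => t%:A) A.

Definition nucoef_mx (R : realType) (n a p q : nat) (H : 'M[Rnu R n]_(p, q)) :
  'M[R]_(p, q) := map_mx (nucoef a) H.

Definition form (A : pzRingType) (d : nat) (H : 'M[A]_d) (v w : 'rV[A]_d) : A :=
  (v *m H *m w^T) 0 0.

Definition nuform (R : realType) (n d : nat) (H : 'M[Rnu R n]_d)
  (v w : 'rV[R]_d) : Rnu R n := form H (toRnu n v) (toRnu n w).

(** * Differential calculus on R^d *)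

Definition partial (R : realType) (d : nat) (i : 'I_d) (f : 'rV[R]_d -> R) :
  'rV[R]_d -> R := fun p => 'D_(delta_mx 0 i) f p.

(* C^oo: all iterated partial derivatives exist and are differentiable. *)
Definition smooth_on (R : realType) (d : nat) (O : set 'rV[R]_d)
  (f : 'rV[R]_d -> R) : Prop :=
  forall (s : seq 'I_d) (p : 'rV[R]_d), O p ->
    differentiable (foldr (@partial R d) f s) p.

Definition smooth_mx_on (R : realType) (d p q : nat) (O : set 'rV[R]_d)
  (F : 'rV[R]_d -> 'M[R]_(p, q)) : Prop :=
  forall i j, smooth_on O (fun x => F x i j).

Definition smooth_nu_on (R : realType) (n d : nat) (O : set 'rV[R]_d)
  (f : 'rV[R]_d -> Rnu R n) : Prop :=
  forall a, (a < n)%N -> smooth_on O (fun x => nucoef a (f x)).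

Definition Dmx (R : realType) (d p q : nat) (v : 'rV[R]_d)
  (F : 'rV[R]_d -> 'M[R]_(p, q)) (x : 'rV[R]_d) : 'M[R]_(p, q) :=
  \matrix_(i, j) 'D_v (fun y => F y i j) x.

Definition Dnu (R : realType) (n d : nat) (v : 'rV[R]_d)
  (f : 'rV[R]_d -> Rnu R n) (x : 'rV[R]_d) : Rnu R n :=
  \sum_(a < n) ('D_v (fun y => nucoef a (f y)) x : R) *: nu R n ^+ a.

Definition partial_multi (R : realType) (n D : nat) (al : {ffun 'I_D -> nat})
  (f : 'rV[R]_D -> Rnu R n) : 'rV[R]_D -> Rnu R n :=
  foldr (fun i g => iter (al i) (Dnu (delta_mx 0 i)) g) f (enum 'I_D).

(** * Smooth manifolds *)

(* [cinv] is only meaningful on the image of the chart, and [cmap] on [cdom]. *)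
Record local_chart (T : topologicalType) (R : realType) (d : nat) := LocalChart {
  cdom : set T;
  cmap : T -> 'rV[R]_d;
  cinv : 'rV[R]_d -> T;
  cdom_open : open cdom;
  cimg_open : open (cmap @` cdom);
  cmapK : forall m, cdom m -> cinv (cmap m) = m;
  cmap_continuous : {within cdom, continuous cmap};
  cinv_continuous : {within cmap @` cdom, continuous cinv}
}.

Definition cimg (T : topologicalType) (R : realType) (d : nat)
  (c : local_chart T R d) : set 'rV[R]_d := cmap c @` cdom c.

Definition transition (T : topologicalType) (R : realType) (d : nat)
  (c c' : local_chart T R d) : 'rV[R]_d -> 'rV[R]_d :=
  fun p => cmap c' (cinv c p).

Definition smooth_transition (T : topologicalType) (R : realType) (d : nat)
  (c c' : local_chart T R d) : Prop :=
  smooth_mx_on (cmap c @` (cdom c `&` cdom c')) (transition c c').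

(* The atlas is maximal: its elements are all the local coordinate systems. *)
Record manifold (R : realType) (d : nat) := Manifold {
  carrier :> topologicalType;
  carrier_hausdorff : hausdorff_space carrier;
  carrier_second_countable : @second_countable carrier;
  atlas : set (local_chart carrier R d);
  atlas_cover : forall m : carrier, exists2 c, atlas c & cdom c m;
  atlas_smooth : forall c c', atlas c -> atlas c' -> smooth_transition c c';
  atlas_maximal : forall c,
    (forall c', atlas c' -> smooth_transition c c' /\ smooth_transition c' c) ->
    atlas c
}.

Definition mchart (R : realType) (d : nat) (M : manifold R d) :=
  local_chart M R d.

(** * Tensor fields *)

(* A tensor field on M is given by its components in every chart of the atlas;
   its values on charts outside the atlas, and in a chart c outside [cimg c],
   are irrelevant. *)

Definition chart_jacobian (R : realType) (d : nat) (M : manifold R d)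
  (c c' : mchart M) (m : M) : 'M[R]_d := 'J (transition c c') (cmap c m).

Definition endo_field (R : realType) (d : nat) (M : manifold R d)
  (N : mchart M -> 'rV[R]_d -> 'M[R]_d) : Prop :=
  (forall c, atlas c -> smooth_mx_on (cimg c) (N c)) /\
  (forall c c' m, atlas c -> atlas c' -> cdom c m -> cdom c' m ->
     N c (cmap c m) *m chart_jacobian c c' m
     = chart_jacobian c c' m *m N c' (cmap c' m)).

Definition bilinear_field (R : realType) (d : nat) (M : manifold R d)
  (g : mchart M -> 'rV[R]_d -> 'M[R]_d) : Prop :=
  (forall c, atlas c -> smooth_mx_on (cimg c) (g c)) /\
  (forall c c' m, atlas c -> atlas c' -> cdom c m -> cdom c' m ->
     g c (cmap c m) = chart_jacobian c c' m *m g c' (cmap c' m)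
                        *m (chart_jacobian c c' m)^T).

Definition nu_bilinear_field (R : realType) (n d : nat) (M : manifold R d)
  (h : mchart M -> 'rV[R]_d -> 'M[Rnu R n]_d) : Prop :=
  forall a, (a < n)%N -> bilinear_field (fun c p => nucoef_mx a (h c p)).

(** * Nilpotent structures, pseudo-Riemannian metrics *)

Definition nilpotent_structure (R : realType) (d : nat) (M : manifold R d)
  (n : nat) (N : mchart M -> 'rV[R]_d -> 'M[R]_d) : Prop :=
  [/\ endo_field N,
      forall c p, atlas c -> cimg c p -> N c p ^+ n = 0,
      exists c p, [/\ atlas c, cimg c p & N c p ^+ n.-1 != 0]
    & forall m : M, exists c, [/\ atlas c, cdom c m
        & forall p q, cimg c p -> cimg c q -> N c p = N c q]].

Definition pseudo_riemannian (R : realType) (d : nat) (M : manifold R d)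
  (g : mchart M -> 'rV[R]_d -> 'M[R]_d) : Prop :=
  bilinear_field g /\
  forall c p, atlas c -> cimg c p ->
    (forall v w, form (g c p) v w = form (g c p) w v) /\
    (forall v, (forall w, form (g c p) v w = 0) -> v = 0).

Definition self_adjoint (R : realType) (d : nat) (M : manifold R d)
  (N g : mchart M -> 'rV[R]_d -> 'M[R]_d) : Prop :=
  forall c p, atlas c -> cimg c p -> forall v w,
    form (g c p) (v *m N c p) w = form (g c p) v (w *m N c p).

(* The entry (j, k) of [christoffel G p i] is the Christoffel symbol
   Gamma_(ij)^k of the Levi-Civita connection of G. *)
Definition christoffel (R : realType) (d : nat) (G : 'rV[R]_d -> 'M[R]_d)
  (p : 'rV[R]_d) (i : 'I_d) : 'M[R]_d :=
  \matrix_(j, k) \sum_l 2^-1 * invmx (G p) l k *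
    (partial i (fun q => G q j l) p + partial j (fun q => G q i l) p
     - partial l (fun q => G q i j) p).

(* The covariant derivative of N along the i-th coordinate field:
   (nabla_i N)_j^k = d_i N_j^k + N_j^l Gamma_(il)^k - Gamma_(ij)^l N_l^k. *)
Definition nabla_endo (R : realType) (d : nat) (G N : 'rV[R]_d -> 'M[R]_d)
  (p : 'rV[R]_d) (i : 'I_d) : 'M[R]_d :=
  Dmx (delta_mx 0 i) N p + N p *m christoffel G p i - christoffel G p i *m N p.

Definition parallel (R : realType) (d : nat) (M : manifold R d)
  (g N : mchart M -> 'rV[R]_d -> 'M[R]_d) : Prop :=
  forall c p, atlas c -> cimg c p ->
    forall i, nabla_endo (g c) (N c) p i = 0.

(** * Nilomorphic objects *)

(* Components of the Lie derivatives, obtained from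
   (L_V N) X = [V, N X] - N [V, X] and
   (L_V h)(X, Y) = V (h(X, Y)) - h([V, X], Y) - h(X, [V, Y])
   for coordinate fields X and Y; the entry (i, k) of 'J V is d_i V_k. *)
Definition lie_endo (R : realType) (d : nat) (V : 'rV[R]_d -> 'rV[R]_d)
  (N : 'rV[R]_d -> 'M[R]_d) (p : 'rV[R]_d) : 'M[R]_d :=
  Dmx (V p) N p + 'J V p *m N p - N p *m 'J V p.

Definition lie_form (R : realType) (n d : nat) (V : 'rV[R]_d -> 'rV[R]_d)
  (h : 'rV[R]_d -> 'M[Rnu R n]_d) (p : 'rV[R]_d) : 'M[Rnu R n]_d :=
  (\matrix_(i, j) Dnu (V p) (fun q => h q i j) p)
  + toRnu n ('J V p) *m h p + h p *m (toRnu n ('J V p))^T.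

Definition nilomorphic_field (R : realType) (d : nat) (O : set 'rV[R]_d)
  (N : 'rV[R]_d -> 'M[R]_d) (V : 'rV[R]_d -> 'rV[R]_d) : Prop :=
  smooth_mx_on O V /\ forall p, O p -> lie_endo V N p = 0.

Definition nilomorphic_fun (R : realType) (n d : nat) (O : set 'rV[R]_d)
  (N : 'rV[R]_d -> 'M[R]_d) (f : 'rV[R]_d -> Rnu R n) : Prop :=
  smooth_nu_on O f /\
  forall p v, O p -> Dnu (v *m N p) f p = nu R n * Dnu v f p.

(* Nilomorphic vector fields are local: O ranges over the open subsets of the
   coordinate domains. *)
Definition nilomorphic_metric (R : realType) (n d : nat) (M : manifold R d)
  (N : mchart M -> 'rV[R]_d -> 'M[R]_d)
  (h : mchart M -> 'rV[R]_d -> 'M[Rnu R n]_d) : Prop :=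
  [/\ nu_bilinear_field h,
      forall c p, atlas c -> cimg c p -> forall v w,
        [/\ nuform (h c p) v w = nuform (h c p) w v,
            nuform (h c p) (v *m N c p) w = nu R n * nuform (h c p) v w
          & nuform (h c p) v (w *m N c p) = nu R n * nuform (h c p) v w],
      forall c p, atlas c -> cimg c p -> forall v,
        (forall w, nuform (h c p) v w = 0) -> v = 0
    & forall c O V, atlas c -> open O -> O `<=` cimg c ->
        nilomorphic_field O (N c) V -> forall p, O p ->
        lie_form (fun q => V q *m N c q) (h c) p
        = nu R n *: lie_form V (h c) p].

Definition real_metric (R : realType) (n d : nat) (M : manifold R d)
  (g : mchart M -> 'rV[R]_d -> 'M[R]_d)
  (h : mchart M -> 'rV[R]_d -> 'M[Rnu R n]_d) : Prop :=
  forall c p, atlas c -> cimg c p -> g c p = nucoef_mx n.-1 (h c p).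

(** * N-integral coordinates *)

(* The coordinate of index [k i a] is y_(i,a) if 0 < a < b i, and x_i if a = 0;
   b i is the size n(i) of the i-th Jordan block. *)
Definition N_integral (R : realType) (d : nat) (M : manifold R d)
  (N : mchart M -> 'rV[R]_d -> 'M[R]_d) (c : mchart M)
  (D : nat) (b : 'I_D -> nat) (k : 'I_D -> nat -> 'I_d) : Prop :=
  [/\ (forall i, 0 < b i)%N /\ (forall i j : 'I_D, i <= j -> b i <= b j)%N,
      forall i j a a', (a < b i)%N -> (a' < b j)%N -> k i a = k j a' ->
        i = j /\ a = a',
      forall l, exists i a, (a < b i)%N /\ k i a = l,
      atlas c
    & forall p, cimg c p -> forall i,
        (forall a, (1 <= a < b i)%N ->
          delta_mx 0 (k i a) = delta_mx 0 (k i 0%N) *m N c p ^+ a :> 'rV[R]_d)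
        /\ delta_mx 0 (k i 0%N) *m N c p ^+ b i = 0 :> 'rV[R]_d].

Definition xcoord (R : realType) (d D : nat) (k : 'I_D -> nat -> 'I_d)
  (p : 'rV[R]_d) : 'rV[R]_D := \row_i p 0 (k i 0%N).

Definition nuy (R : realType) (n d D : nat) (b : 'I_D -> nat)
  (k : 'I_D -> nat -> 'I_d) (i : 'I_D) (p : 'rV[R]_d) : Rnu R n :=
  \sum_(1 <= a < b i) p 0 (k i a) *: nu R n ^+ a.

Definition zcoord (R : realType) (n d D : nat) (b : 'I_D -> nat)
  (k : 'I_D -> nat -> 'I_d) (i : 'I_D) (p : 'rV[R]_d) : Rnu R n :=
  (xcoord k p 0 i)%:A + nuy n b k i p.

(* Im N is spanned by the d/dy_(i,a), so that the plaques of the foliation I in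
   the domain of c are the fibres of (x_i)_i. When they are connected they are
   the leaves, and (x_i)_i identifies U/I with the open set [leaf_space]. *)
Definition trivial_foliation (R : realType) (d : nat) (M : manifold R d)
  (c : mchart M) (D : nat) (k : 'I_D -> nat -> 'I_d) : Prop :=
  forall x : 'rV[R]_D, connected (cimg c `&` [set p | xcoord k p = x]).

Definition leaf_space (R : realType) (d : nat) (M : manifold R d)
  (c : mchart M) (D : nat) (k : 'I_D -> nat -> 'I_d) : set 'rV[R]_D :=
  xcoord k @` cimg c.

(* ker N^a is spanned by the N^e d/dx_i with e + a >= b i, so pi(K^a) is tangent
   to the d/dx_i with b i <= a. *)
Definition quotient_leaf (R : realType) (D : nat) (X : set 'rV[R]_D)
  (b : 'I_D -> nat) (a : nat) (x : 'rV[R]_D) : set 'rV[R]_D :=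
  connected_component
    (X `&` [set x' | forall i, (a < b i)%N -> x' 0 i = x 0 i]) x.

Definition adapted (R : realType) (n D : nat) (X : set 'rV[R]_D)
  (b : 'I_D -> nat) (f : 'rV[R]_D -> Rnu R n) : Prop :=
  smooth_nu_on X f /\
  forall a, (a < n)%N -> forall x x', X x -> quotient_leaf X b a x x' ->
    nu R n ^+ a * f x = nu R n ^+ a * f x'.

(* The sum ranges over all multi-indices; its terms vanish as soon as
   |alpha| >= n, because nu^n = 0. *)
Definition taylor_nu (R : realType) (n d D : nat) (b : 'I_D -> nat)
  (k : 'I_D -> nat -> 'I_d) (f : 'rV[R]_D -> Rnu R n) (p : 'rV[R]_d) :
  Rnu R n :=
  \sum_(al \in [set: {ffun 'I_D -> nat}])
    ((\prod_i (al i)`!)%N%:R^-1 : R) *: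
      (partial_multi al f (xcoord k p) * \prod_i nuy n b k i p ^+ al i).

(* Non-degeneracy of sum_(i,j) H i j dz_i (x) dz_j on the R[nu]-module T_mM,
   the direct sum of the R[nu] d/dx_i, where w d/dx_i = 0 iff
   w is in nu^(b i) R[nu]. *)
Definition nondegenerate_coefs (R : realType) (n D : nat) (b : 'I_D -> nat)
  (H : 'I_D -> 'I_D -> Rnu R n) : Prop :=
  forall w : 'I_D -> Rnu R n, (forall j, \sum_i w i * H i j = 0) ->
    forall i, exists u, w i = nu R n ^+ b i * u.

Definition normal_form (R : realType) (n d : nat) (M : manifold R d)
  (N : mchart M -> 'rV[R]_d -> 'M[R]_d)
  (h : mchart M -> 'rV[R]_d -> 'M[Rnu R n]_d) (c : mchart M)
  (D : nat) (b : 'I_D -> nat) (k : 'I_D -> nat -> 'I_d) : Prop :=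
  exists (H : 'I_D -> 'I_D -> 'rV[R]_d -> Rnu R n)
         (Hc : 'I_D -> 'I_D -> 'rV[R]_D -> Rnu R n),
  [/\ forall i j, nilomorphic_fun (cimg c) (N c) (H i j) /\
        adapted (leaf_space c k) b (Hc i j),
      forall i j p, cimg c p ->
        H i j p = H j i p /\ Hc i j (xcoord k p) = Hc j i (xcoord k p),
      forall i j p, cimg c p ->
        exists u, H i j p = nu R n ^+ (n - minn (b i) (b j)) * u,
      forall p, cimg c p -> nondegenerate_coefs b (fun i j => H i j p)
    & forall p, cimg c p ->
        (forall v w, nuform (h c p) v w =
          \sum_i \sum_j H i j p * Dnu v (zcoord n b k i) p
                                * Dnu w (zcoord n b k j) p) /\
        (forall i j, H i j p = taylor_nu b k (Hc i j) p)].

(** * Signatures *)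

(* The largest dimension of a subspace of W / W' on which the form induced by B
   is positive definite; W' is contained in W and in the radical of B on W. *)
Definition positive_index (R : realType) (d : nat) (B W W' : 'M[R]_d) : nat :=
  \max_(r < d.+1 | `[< exists E : 'M[R]_(r, d),
      [/\ row_free E, (E <= W)%MS, (E :&: W')%MS = 0
        & forall u : 'rV[R]_r, u != 0 -> 0 < form B (u *m E) (u *m E)] >]) r.

Definition signature (R : realType) (d : nat) (B W W' : 'M[R]_d) : nat * nat :=
  (positive_index B W W', positive_index (- B) W W').

(* pi(ker N^a) / pi(ker N^(a-1)), with pi the projection modulo Im N, is
   represented as ker N^a / (ker N^a :&: (ker N^(a-1) + Im N)). *)
Definition char_signature (R : realType) (d : nat) (N G : 'M[R]_d) (a : nat) :
  nat * nat :=
  signature (G *m (N ^+ a.-1)^T) (kermx (N ^+ a))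
    (kermx (N ^+ a) :&: (kermx (N ^+ a.-1) + N))%MS.

(* A complement S of Im N compatible with the flag of the ker N^a, for instance
   the span of the d/dx_i. For an arbitrary complement, S :&: ker N^a may have a
   smaller image modulo Im N than ker N^a. *)
Definition flag_complement (R : realType) (d : nat) (N S : 'M[R]_d) : Prop :=
  [/\ row_full (S + N)%MS, (S :&: N)%MS = 0
    & forall a, (kermx (N ^+ a) <= (S :&: kermx (N ^+ a))%MS + N)%MS].

Definition metric_signature (R : realType) (n d : nat) (N : 'M[R]_d)
  (H : 'M[Rnu R n]_d) (S : 'M[R]_d) (a : nat) : nat * nat :=
  signature (nucoef_mx (n - a) H) (S :&: kermx (N ^+ a))%MS
    (S :&: kermx (N ^+ a.-1))%MS.

(* Main.v *)
(** Write T = nabla N. For a field V with L_V N = 0 one has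
    L_(NV) g (X, Y) - (L_V g)(X, N Y)
      = g(T_X V, Y) + g(X, T_Y V) - g(X, T_V Y),
    pointwise and in any chart. If N is parallel, this vanishes, and
    h = sum_a nu^a g(., N^(n-1-a) .) is nilomorphic. Conversely, the fields that
    are constant in a chart where N is constant provide such a V through every
    tangent vector; as T_X is g-self-adjoint, the resulting cyclic identity
    forces T = 0.

    In N-integral coordinates, h_(i,j) = h(d/dx_i, d/dx_j) satisfies
    d f/dy_(i,a) = nu^a d f/dx_i. For such f, and with Y_i = (nu y_i), the operators
    E_i^- = exp(-Y_i d/dx_i), which are finite sums since Y_i^n = 0, turn f into a
    function that does not depend on y, hence descends to the leaf space (the
    plaques being connected); the operators E_i^+ = exp(Y_i d/dx_i) recover f, and
    their composition is the announced Taylor formula. Evaluating f at y = 0 would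
    not do, because the chart need not contain such points.

    For the signatures, the form g(., N^(a-1) .) on ker N^a has ker N^(a-1) and
    Im N /\ ker N^a in its radical, so that a definite subspace of ker N^a may be
    projected to S /\ ker N^a along Im N. *)

From HB Require Import structures.
From mathcomp Require Import all_boot all_order all_algebra qpoly.
From mathcomp Require Import all_classical all_reals all_analysis.
From mathcomp Require Import zify ring lra.
Require Import Defs.

Set Implicit Arguments.
Unset Strict Implicit.
Unset Printing Implicit Defensive.

Import Order.TTheory GRing.Theory Num.Theory.
Import numFieldNormedType.Exports.
Local Open Scope classical_set_scope.
Local Open Scope ring_scope.

(** * Differential calculus *)

Section Calculus.
Context {R : realType}.
Implicit Types V W : normedModType R.

(** Parallelism is required in every chart, while constant test fields live in charts where N is
    constant. They are transported by the Jacobian of the transition map, and L_V N = 0 then rests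
    on the symmetry of its second derivatives, hence on Schwarz's theorem. Why the cyclic identity
    forces T = 0: s(X; Y, Z) = g(T_X Y, Z) is symmetric in Y and Z, and the identity reads s(X; V,
    Y) + s(Y; V, X) = s(V; X, Y). Adding its copy with V and Y exchanged leaves 2 s(X; V, Y) = 0. In
    coordinates, the relation N^(b i) d/dx_i = 0 has two consequences. It gives nu^(b i) h_(i,j) =
    0, so that h_(i,j) lies in the annihilator of nu^(b i), which is nu^(n - b i) R[nu]. It also
    gives nu^(b l) dh_(i,j)/dx_l = 0; the operators E^- preserve this relation, and on the leaf
    space it becomes adaptedness. *)

Lemma near_eq_differentiable V W (f g : V -> W) x :
  {near x, f =1 g} -> differentiable f x -> differentiable g x.
Proof.
move=> fg df.
have e : g \o shift x = cst (g x) + 'd f x +o_ 0 id.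
  apply/eqaddoP => e e0; have /diff_locally/eqaddoP/(_ e e0) H := df.
  have fg0 : \forall y \near 0, f (y + x) = g (y + x).
    by move: fg; rewrite (near_shift 0) subr0.
  near=> y.
  have -> : (g \o shift x - (cst (g x) + 'd f x)) y
     = (f \o shift x - (cst (f x) + 'd f x)) y.
    rewrite !fctE /= (nbhs_singleton fg); congr (_ - (_ + _)); symmetry.
    by near: y.
  by near: y.
have dE : 'd g x = 'd f x :> (V -> W).
  exact: diff_unique (diff_continuous df) e.
apply/diff_locallyP; split; rewrite dE //; exact: diff_continuous.
Unshelve. all: by end_near. Qed.

Lemma differentiable_mx V p q (F : V -> 'M[R]_(p, q)) x :
  (forall i j, differentiable (fun y => F y i j) x) -> differentiable F x.
Proof.
move=> dF.
have -> : F = \sum_(k < p) \sum_(l < q) (fun y => F y k l *: delta_mx k l).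
  apply/funext => y; rewrite [LHS]matrix_sum_delta fct_sumE.
  by apply: eq_bigr => k _; rewrite fct_sumE.
do 2! apply: differentiable_sum => ?.
exact: differentiableZl.
Qed.

Lemma differentiable_mx_coord V p q (F : V -> 'M[R]_(p, q)) x i j :
  differentiable F x -> differentiable (fun y => F y i j) x.
Proof.
move=> dF; apply: (@differentiable_comp _ _ _ _ F (fun A : 'M[R]_(p, q) => A i j)) => //.
exact: differentiable_coord.
Qed.

Lemma diff_mx_coord V p q (F : V -> 'M[R]_(p, q)) x i j v :
  differentiable F x -> 'd F x v i j = 'D_v (fun y => F y i j) x.
Proof.
move=> dF; rewrite -deriveE // derive_mx ?mxE //.
exact: diff_derivable.
Qed.

Lemma diff_sum_delta d (f : 'rV[R]_d -> R) x v : differentiable f x ->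
  'D_v f x = \sum_i v 0 i * partial i f x.
Proof.
move=> df; rewrite deriveE // [in LHS](row_sum_delta v) linear_sum /=.
by apply: eq_bigr => i _; rewrite linearZ /= /partial deriveE.
Qed.

Lemma derive_comp_mx V d (phi : V -> 'rV[R]_d) (f : 'rV[R]_d -> R) x v :
  differentiable phi x -> differentiable f (phi x) ->
  'D_v (f \o phi) x = \sum_k 'D_v (fun y => phi y 0 k) x * partial k f (phi x).
Proof.
move=> dphi df; rewrite deriveE; last exact: differentiable_comp.
rewrite diff_comp //= -deriveE // diff_sum_delta //.
by apply: eq_bigr => k _; rewrite diff_mx_coord.
Qed.

Lemma jacobianE d e (f : 'rV[R]_d -> 'rV[R]_e) x i k : differentiable f x ->
  'J f x i k = partial i (fun y => f y 0 k) x.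
Proof. by move=> df; rewrite /jacobian !mxE diff_mx_coord. Qed.

End Calculus.

(** * Symmetry of second derivatives *)

Section Schwarz.
Context {R : realType}.
Implicit Types V : normedModType R.

Lemma is_derive_line V (f : V -> R) q v (t : R) : differentiable f (q + t *: v) ->
  is_derive t 1 (fun s : R => f (q + s *: v)) ('D_v f (q + t *: v)).
Proof.
move=> df.
have dl : is_diff t (fun s : R => q + s *: v) ( *:%R^~ v).
  have -> : (fun s : R => q + s *: v) = cst q + ( *:%R^~ v) by [].
  rewrite -[X in is_diff _ _ X]add0r.
  exact: (is_diffD (is_diff_cst q t) (is_diff_scalel t v)).
have [dl1 dl2] := dl.
have dc : differentiable (f \o (fun s : R => q + s *: v)) t.
  exact: differentiable_comp.
apply: DeriveDef; first exact: diff_derivable.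
by rewrite deriveE // diff_comp //= dl2 scale1r -deriveE.
Qed.

(** The mean value theorem in the direction v turns the second difference into h times a difference
    of two values of D_v f at points O(h)-close to p. Differentiability of D_v f at p then suffices;
    second derivatives need not be continuous. *)
Lemma second_difference V (f : V -> R) p v w :
  (\near p, differentiable f p) -> differentiable ('D_v f) p ->
  forall e : R, 0 < e -> \forall h \near 0^'+,
    `|f (p + h *: w + h *: v) - f (p + h *: w) - (f (p + h *: v) - f p)
      - h ^+ 2 * 'D_w ('D_v f) p| <= e * h ^+ 2.
Proof.
move=> /nbhs_ballP [r /= r0 df] dvf e e0.
(* For 0 <= a, b <= h, the norm of a v + b w is at most h c / 2, so a relative error e / c costs e h
   / 2 at each of the two points. The summand 1 keeps c positive. *)
pose c := 2 * (`|v| + `|w| + 1).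
have c0 : 0 < c by rewrite mulr_gt0 // ltr_wpDl // addr_ge0.
have ec0 : 0 < e / c by rewrite divr_gt0.
have /diff_locally/eqaddoP/(_ _ ec0)/nbhs_ballP [s /= s0 lin] := dvf.
have rs0 : 0 < Order.min r s / c by rewrite divr_gt0 // lt_min r0.
near=> h.
have h0 : 0 < h by [].
have hrs : h * c < Order.min r s.
  rewrite -ltr_pdivlMr //; near: h; exact: nbhs_right_lt.
have small a b : 0 <= a <= h -> 0 <= b <= h ->
    `|a *: v + b *: w| < Order.min r s /\ `|a *: v + b *: w| <= h * c / 2.
  move=> /andP[a0 ah] /andP[b0 bh].
  have le1 : `|a *: v + b *: w| <= h * c / 2.
    rewrite (le_trans (ler_normD _ _)) // !normrZ !ger0_norm // /c mulrCA.
    rewrite mulrAC divff // mul1r 2!mulrDr mulr1.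
    rewrite -[leLHS]addr0 lerD // ?(ltW h0) // lerD //; exact: ler_wpM2r.
  split=> //; apply: le_lt_trans le1 _; apply: le_lt_trans hrs.
  by rewrite ler_pdivrMr // ler_peMr ?mulr_ge0 ?ltW // ltr1n.
have dball a b : 0 <= a <= h -> 0 <= b <= h -> differentiable f (p + b *: w + a *: v).
  move=> ha hb; apply: df; rewrite -ball_normE /ball_ /=.
  rewrite -addrA opprD addrA subrr add0r normrN addrC.
  by case: (small a b ha hb) => + _; rewrite lt_min => /andP[].
have rem a b : 0 <= a <= h -> 0 <= b <= h ->
    `|'D_v f (p + b *: w + a *: v) - ('D_v f p + 'd ('D_v f) p (a *: v + b *: w))|
     <= e / 2 * h.
  move=> ha hb; case: (small a b ha hb); rewrite lt_min => /andP[_ lts] leh.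
  have Eq : p + b *: w + a *: v = a *: v + b *: w + p.
    by rewrite -addrA addrC [b *: w + _]addrC.
  have := lin (a *: v + b *: w); rewrite -ball_normE /ball_ /= sub0r normrN.
  move=> /(_ lts) le1; rewrite Eq; apply: (le_trans le1).
  apply: (le_trans (ler_wpM2l (ltW ec0) leh)).
  have -> // : e / c * (h * c / 2) = e / 2 * h by field; rewrite gt_eqF.
have hh : 0 <= h <= h by apply/andP; split => //; exact: ltW.
have h00 : 0 <= (0 : R) <= h by apply/andP; split => //; exact: ltW.
pose phi t := f (p + h *: w + t *: v) - f (p + t *: v).
have dphi t : 0 <= t <= h -> is_derive t 1 phi
    ('D_v f (p + h *: w + t *: v) - 'D_v f (p + t *: v)).
  move=> ht; apply: is_deriveB; apply: is_derive_line; first exact: dball.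
  by have := dball t 0 ht h00; rewrite scale0r addr0.
have dphi' t : t \in `]0, h[%R -> is_derive t 1 phi
    ('D_v f (p + h *: w + t *: v) - 'D_v f (p + t *: v)).
  by rewrite in_itv /= => /andP[/ltW t0 /ltW th]; apply: dphi; rewrite t0.
have cphi : {within `[0, h], continuous phi}.
  apply: derivable_within_continuous => t; rewrite in_itv /= => ht.
  by have := dphi t ht; case.
have [t] := MVT h0 dphi' cphi.
rewrite in_itv /= => /andP[/ltW t0 /ltW th]; rewrite subr0 => phiE.
have tt : 0 <= t <= h by rewrite t0.
have -> : f (p + h *: w + h *: v) - f (p + h *: w) - (f (p + h *: v) - f p)
   = phi h - phi 0.
  by rewrite /phi !scale0r !addr0 [in LHS]opprD [in RHS]opprD addrACA.
rewrite phiE.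
have := rem t h tt hh; have := rem t 0 tt h00; rewrite scale0r !addr0.
have -> : 'D_w ('D_v f) p = 'd ('D_v f) p w by rewrite deriveE.
have -> : 'd ('D_v f) p (t *: v + h *: w) = t * 'd ('D_v f) p v + h * 'd ('D_v f) p w.
  by rewrite linearD !linearZ.
have -> : 'd ('D_v f) p (t *: v) = t * 'd ('D_v f) p v by rewrite linearZ.
set A := 'D_v f (p + _ + _); set B := 'D_v f (p + t *: v).
set C := 'D_v f p; set X := 'd _ _ v; set Y := 'd _ _ w => rB rA.
have alg (a b z x y : R) : (a - b) * h - h ^+ 2 * y
    = ((a - (z + (t * x + h * y))) - (b - (z + t * x))) * h by ring.
rewrite (alg _ _ C X).
rewrite normrM (ger0_norm (ltW h0)) expr2 mulrA ler_wpM2r ?(ltW h0) //.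
rewrite (le_trans (ler_normB _ _)) // (le_trans (lerD rA rB)) //.
by rewrite -mulrDl -splitr.
Unshelve. all: by end_near. Qed.

(** The second difference is symmetric in v and w, so it approximates h^2 times either mixed
    derivative; an error of e / 2 on each side gives e for their difference. *)
Lemma schwarz V (f : V -> R) p v w : (\near p, differentiable f p) ->
  differentiable ('D_v f) p -> differentiable ('D_w f) p ->
  'D_w ('D_v f) p = 'D_v ('D_w f) p.
Proof.
move=> df dv dw; apply/eqP; rewrite -subr_eq0 -normr_eq0 eq_le normr_ge0 andbT.
apply/ler_addgt0Pl => e e0; rewrite addr0.
have e20 : 0 < e / 2 by rewrite divr_gt0.
have HA := second_difference w df dv e20.
have HB := second_difference v df dw e20.
have [h [/= h0 [/= A B]]] :=
  filter_ex (filterI (nbhs_right_gt (0 : R)) (filterI HA HB)).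
have h20 : 0 < h ^+ 2 by rewrite exprn_gt0.
rewrite -(ler_pM2r h20) -{1}(gtr0_norm h20) -normrM.
move: A B; rewrite [p + h *: v + h *: w]addrAC.
set D1 := 'D_w _ p; set D2 := 'D_v _ p; set a := f _; set b := f _; set c := f _.
set k := f p; move=> A B.
have alg (D1' D2' a' b' c' k' : R) : (D1' - D2') * h ^+ 2
    = (a' - c' - (b' - k') - h ^+ 2 * D2') - (a' - b' - (c' - k') - h ^+ 2 * D1').
  by ring.
rewrite (alg _ _ a b c k).
rewrite (le_trans (ler_normB _ _)) // (le_trans (lerD B A)) //.
by rewrite -mulrDl -splitr.
Qed.

End Schwarz.

(** * Smooth functions *)

Section Smooth.
Context {R : realType}.

Lemma partial_eq_on d (O : set 'rV[R]_d) (f g : 'rV[R]_d -> R) i : open O ->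
  {in O, f =1 g} -> {in O, partial i f =1 partial i g}.
Proof.
move=> oO fg p /set_mem Op; apply: near_eq_derive.
have : nbhs p O by exact: open_nbhs_nbhs.
by apply: filterS => q Oq; apply: fg; exact: mem_set.
Qed.

Lemma differentiable_eq_on d (O : set 'rV[R]_d) (f g : 'rV[R]_d -> R) p : open O ->
  {in O, f =1 g} -> O p -> differentiable f p -> differentiable g p.
Proof.
move=> oO fg Op; apply: near_eq_differentiable.
have : nbhs p O by exact: open_nbhs_nbhs.
by apply: filterS => q Oq; apply: fg; exact: mem_set.
Qed.

Lemma iter_partial_eq_on d (O : set 'rV[R]_d) (f g : 'rV[R]_d -> R) s : open O ->
  {in O, f =1 g} -> {in O, foldr (@partial R d) f s =1 foldr (@partial R d) g s}.
Proof. by move=> oO fg; elim: s => //= i s IH; exact: partial_eq_on. Qed.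

(** The Leibniz and chain rules express a derivative through functions with one derivative fewer, so
    closure properties are proved by induction on the order m, which [smooth_on] does not expose. *)
Definition ck_on d m (O : set 'rV[R]_d) (f : 'rV[R]_d -> R) : Prop :=
  forall s : seq 'I_d, (size s <= m)%N -> forall p, O p ->
    differentiable (foldr (@partial R d) f s) p.

Lemma smooth_onP d (O : set 'rV[R]_d) (f : 'rV[R]_d -> R) :
  smooth_on O f <-> forall m, ck_on m O f.
Proof. by split=> [sf m s _ p|cf s p]; [exact: sf|exact: (cf (size s))]. Qed.

(** The derivative applied innermost, at the end of the list, is the one split off: it acts on f
    itself, where the product and chain rules can be used. *)
Lemma ck_onS d m (O : set 'rV[R]_d) (f : 'rV[R]_d -> R) : ck_on m.+1 O f <->
  (forall p, O p -> differentiable f p) /\ forall i, ck_on m O (partial i f).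
Proof.
split=> [cf|[df cf] s].
  split=> [p|i s sm p]; first exact: (cf [::]).
  by rewrite -(foldr_rcons (@partial R d)); apply: cf; rewrite size_rcons.
elim/last_ind: s => [_ p|s i _]; first exact: df.
by rewrite size_rcons foldr_rcons; exact: cf.
Qed.

Lemma ck_on_le d m n (O : set 'rV[R]_d) (f : 'rV[R]_d -> R) : (m <= n)%N ->
  ck_on n O f -> ck_on m O f.
Proof. by move=> mn cf s sm; apply: cf; exact: leq_trans mn. Qed.

Lemma ck_on_eq d m (O : set 'rV[R]_d) (f g : 'rV[R]_d -> R) : open O ->
  {in O, f =1 g} -> ck_on m O f -> ck_on m O g.
Proof.
move=> oO fg cf s sm p Op; apply: (differentiable_eq_on oO _ Op (cf s sm p Op)).
exact: iter_partial_eq_on.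
Qed.

Lemma ck_on_diff d m (O : set 'rV[R]_d) (f : 'rV[R]_d -> R) p : ck_on m O f ->
  O p -> differentiable f p.
Proof. by move=> cf; exact: (cf [::]). Qed.

Lemma partial_cst d i (c : R) : partial i (fun _ : 'rV[R]_d => c) = fun=> 0.
Proof. by apply/funext => p; rewrite /partial; exact: derive_cst. Qed.

Lemma ck_on_cst d m (O : set 'rV[R]_d) (c : R) : ck_on m O (fun=> c).
Proof.
elim: m c => [|m IH] c.
  by case=> // _ p _ /=; exact: differentiable_cst.
apply/ck_onS; split=> [p _|i]; first exact: differentiable_cst.
by rewrite partial_cst.
Qed.

Lemma partialD d (f g : 'rV[R]_d -> R) i p : differentiable f p ->
  differentiable g p ->
  partial i (fun x => f x + g x) p = partial i f p + partial i g p.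
Proof. by move=> df dg; apply: deriveD; exact: diff_derivable. Qed.

Lemma partialM d (f g : 'rV[R]_d -> R) i p : differentiable f p ->
  differentiable g p ->
  partial i (fun x => f x * g x) p = f p * partial i g p + g p * partial i f p.
Proof. by move=> df dg; apply: deriveM; exact: diff_derivable. Qed.

Lemma ck_onD d m (O : set 'rV[R]_d) (f g : 'rV[R]_d -> R) : open O ->
  ck_on m O f -> ck_on m O g -> ck_on m O (fun x => f x + g x).
Proof.
move=> oO; elim: m f g => [|m IH] f g cf cg.
  case=> // _ p Op /=; exact: (differentiableD (ck_on_diff cf Op) (ck_on_diff cg Op)).
have [df cf'] := (ck_onS _ _ _).1 cf; have [dg cg'] := (ck_onS _ _ _).1 cg.
apply/ck_onS; split=> [p Op|i]; first exact: (differentiableD (df p Op) (dg p Op)).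
apply: ck_on_eq (IH _ _ (cf' i) (cg' i)) => // p /set_mem Op.
by rewrite partialD //; [exact: df|exact: dg].
Qed.

Lemma ck_onM d m (O : set 'rV[R]_d) (f g : 'rV[R]_d -> R) : open O ->
  ck_on m O f -> ck_on m O g -> ck_on m O (fun x => f x * g x).
Proof.
move=> oO; elim: m f g => [|m IH] f g cf cg.
  case=> // _ p Op /=; exact: (differentiableM (ck_on_diff cf Op) (ck_on_diff cg Op)).
have [df cf'] := (ck_onS _ _ _).1 cf; have [dg cg'] := (ck_onS _ _ _).1 cg.
have cf0 := ck_on_le (leqnSn m) cf; have cg0 := ck_on_le (leqnSn m) cg.
apply/ck_onS; split=> [p Op|i]; first exact: (differentiableM (df p Op) (dg p Op)).
apply: ck_on_eq (ck_onD oO (IH _ _ cf0 (cg' i)) (IH _ _ cg0 (cf' i))) => // p /set_mem Op.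
by rewrite partialM //; [exact: df|exact: dg].
Qed.

Lemma ck_on_sum d m (O : set 'rV[R]_d) I (r : seq I) (F : I -> 'rV[R]_d -> R) :
  open O -> (forall i, ck_on m O (F i)) -> ck_on m O (fun x => \sum_(i <- r) F i x).
Proof.
move=> oO cF; elim: r => [|i r IH].
  by under eq_fun do rewrite big_nil; exact: ck_on_cst.
by under eq_fun do rewrite big_cons; exact: ck_onD.
Qed.

Lemma partial_comp d e (phi : 'rV[R]_d -> 'rV[R]_e) (f : 'rV[R]_e -> R) x i :
  (forall k, differentiable (fun y => phi y 0 k) x) -> differentiable f (phi x) ->
  partial i (f \o phi) x =
    \sum_k partial i (fun y => phi y 0 k) x * partial k f (phi x).
Proof.
move=> dphi df; apply: derive_comp_mx => //.
by apply: differentiable_mx => j k; rewrite ord1.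
Qed.

Lemma ck_on_comp d e m (O : set 'rV[R]_d) (O' : set 'rV[R]_e)
    (phi : 'rV[R]_d -> 'rV[R]_e) (f : 'rV[R]_e -> R) : open O ->
  (forall p, O p -> O' (phi p)) -> (forall k, ck_on m O (fun y => phi y 0 k)) ->
  ck_on m O' f -> ck_on m O (f \o phi).
Proof.
move=> oO OO'; elim: m f => [|m IH] f cphi cf.
  case=> // _ p Op /=; apply: differentiable_comp.
    by apply: differentiable_mx => j k; rewrite ord1; exact: (ck_on_diff (cphi k)).
  by apply: (ck_on_diff cf); exact: OO'.
have [df cf'] := (ck_onS _ _ _).1 cf.
apply/ck_onS; split=> [p Op|i].
  apply: differentiable_comp; last by apply: df; exact: OO'.
  by apply: differentiable_mx => j k; rewrite ord1; exact: (ck_on_diff (cphi k)).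
pose G x := \sum_k partial i (fun y => phi y 0 k) x * (partial k f \o phi) x.
apply: (@ck_on_eq _ _ _ G) => // [p /set_mem Op|].
  rewrite partial_comp //; last by apply: df; exact: OO'.
  by move=> k; exact: (ck_on_diff (cphi k)).
apply: ck_on_sum => // k; apply: ck_onM => //.
  by have [_] := (ck_onS _ _ _).1 (cphi k); apply.
by apply: IH => // k'; exact: ck_on_le (cphi k').
Qed.

Lemma smooth_on_diff d (O : set 'rV[R]_d) (f : 'rV[R]_d -> R) p :
  smooth_on O f -> O p -> differentiable f p.
Proof. by move=> sf; exact: (sf [::]). Qed.

Lemma smooth_on_partial d (O : set 'rV[R]_d) (f : 'rV[R]_d -> R) i :
  smooth_on O f -> smooth_on O (partial i f).
Proof. by move=> sf s p; rewrite -(foldr_rcons (@partial R d)); exact: sf. Qed.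

Lemma smooth_on_eq d (O : set 'rV[R]_d) (f g : 'rV[R]_d -> R) : open O ->
  {in O, f =1 g} -> smooth_on O f -> smooth_on O g.
Proof.
by move=> oO fg /smooth_onP sf; apply/smooth_onP => m; exact: ck_on_eq (sf m).
Qed.

Lemma smooth_on_sub d (O O' : set 'rV[R]_d) (f : 'rV[R]_d -> R) : O `<=` O' ->
  smooth_on O' f -> smooth_on O f.
Proof. by move=> OO' sf s p /OO'; exact: sf. Qed.

Lemma smooth_on_cst d (O : set 'rV[R]_d) (c : R) : smooth_on O (fun=> c).
Proof. by apply/smooth_onP => m; exact: ck_on_cst. Qed.

Lemma smooth_onD d (O : set 'rV[R]_d) (f g : 'rV[R]_d -> R) : open O ->
  smooth_on O f -> smooth_on O g -> smooth_on O (fun x => f x + g x).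
Proof.
by move=> oO /smooth_onP sf /smooth_onP sg; apply/smooth_onP => m; exact: ck_onD.
Qed.

Lemma smooth_onM d (O : set 'rV[R]_d) (f g : 'rV[R]_d -> R) : open O ->
  smooth_on O f -> smooth_on O g -> smooth_on O (fun x => f x * g x).
Proof.
by move=> oO /smooth_onP sf /smooth_onP sg; apply/smooth_onP => m; exact: ck_onM.
Qed.

Lemma smooth_on_sum d (O : set 'rV[R]_d) I (r : seq I) (F : I -> 'rV[R]_d -> R) :
  open O -> (forall i, smooth_on O (F i)) -> smooth_on O (fun x => \sum_(i <- r) F i x).
Proof.
move=> oO sF; apply/smooth_onP => m; apply: ck_on_sum => // i.
by apply: (smooth_onP _ _).1.
Qed.

Lemma smooth_on_comp d e (O : set 'rV[R]_d) (O' : set 'rV[R]_e)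
    (phi : 'rV[R]_d -> 'rV[R]_e) (f : 'rV[R]_e -> R) : open O ->
  (forall p, O p -> O' (phi p)) -> smooth_mx_on O phi ->
  smooth_on O' f -> smooth_on O (f \o phi).
Proof.
move=> oO OO' sphi /smooth_onP sf; apply/smooth_onP => m.
apply: ck_on_comp (sf m) => // k; apply: (smooth_onP _ _).1; exact: sphi.
Qed.

Lemma partial_coord d i k : partial i (fun y : 'rV[R]_d => y 0 k) = fun=> (i == k)%:R.
Proof.
apply/funext => p; rewrite /partial deriveE; last exact: differentiable_coord.
have @f : {linear 'rV[R]_d -> R}.
  by exists (fun N : 'rV[R]_d => N 0 k); do 2![eexists]; do ?[constructor];
     rewrite ?mxE// => ? *; rewrite ?mxE//; move=> ?; rewrite !mxE.
rewrite -[X in 'd X p]/(f : _ -> _) diff_lin; last exact: coord_continuous.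
by rewrite /f /= mxE eq_sym.
Qed.

Lemma smooth_on_coord d (O : set 'rV[R]_d) k : smooth_on O (fun y : 'rV[R]_d => y 0 k).
Proof.
apply/smooth_onP; case=> [|m].
  by case=> // _ p _; exact: differentiable_coord.
apply/ck_onS; split=> [p _|i]; first exact: differentiable_coord.
rewrite partial_coord; exact: ck_on_cst.
Qed.

Lemma smooth_mx_on_diff d (O : set 'rV[R]_d) p q (F : 'rV[R]_d -> 'M[R]_(p, q)) x :
  smooth_mx_on O F -> O x -> differentiable F x.
Proof.
by move=> sF Ox; apply: differentiable_mx => i j; exact: smooth_on_diff (sF i j) Ox.
Qed.

Lemma smooth_mx_on_mul d (O : set 'rV[R]_d) p q r (F : 'rV[R]_d -> 'M[R]_(p, q))
    (G : 'rV[R]_d -> 'M[R]_(q, r)) : open O ->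
  smooth_mx_on O F -> smooth_mx_on O G -> smooth_mx_on O (fun x => F x *m G x).
Proof.
move=> oO sF sG i j; under eq_fun do rewrite mxE.
by apply: smooth_on_sum => // k; apply: smooth_onM => //.
Qed.

Lemma smooth_mx_on_tr d (O : set 'rV[R]_d) p q (F : 'rV[R]_d -> 'M[R]_(p, q)) :
  smooth_mx_on O F -> smooth_mx_on O (fun x => (F x)^T).
Proof. by move=> sF i j; under eq_fun do rewrite mxE; exact: sF. Qed.

Lemma smooth_mx_on_cst d (O : set 'rV[R]_d) p q (A : 'M[R]_(p, q)) :
  smooth_mx_on O (fun=> A).
Proof. by move=> i j; exact: smooth_on_cst. Qed.

Lemma smooth_mx_on_exp d (O : set 'rV[R]_d) (F : 'rV[R]_d -> 'M[R]_d) k : open O ->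
  smooth_mx_on O F -> smooth_mx_on O (fun x => F x ^+ k).
Proof.
move=> oO sF; elim: k => [|k IH].
  by under eq_fun do rewrite expr0; exact: smooth_mx_on_cst.
by under eq_fun do rewrite exprS; exact: smooth_mx_on_mul.
Qed.

Lemma partialC d (O : set 'rV[R]_d) (f : 'rV[R]_d -> R) i j p : open O ->
  smooth_on O f -> O p -> partial i (partial j f) p = partial j (partial i f) p.
Proof.
move=> oO sf Op; apply: schwarz.
- have : nbhs p O by exact: open_nbhs_nbhs.
  by apply: filterS => q Oq; exact: (smooth_on_diff sf Oq).
- exact: (smooth_on_diff (smooth_on_partial _ sf) Op).
- exact: (smooth_on_diff (smooth_on_partial _ sf) Op).
Qed.

End Smooth.

(** * The algebra R[nu] and R[nu]-valued forms *)

Section RnuAlgebra.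
Context {R : realType} {n : nat}.
Implicit Types f g : Rnu R n.

Fact nucoef_is_linear a : linear_for *%R (@nucoef R n a).
Proof. by move=> c f g; rewrite /nucoef coefD coefZ. Qed.

HB.instance Definition _ a :=
  GRing.isSemilinear.Build R (Rnu R n) R *%R (@nucoef R n a)
    (GRing.semilinear_linear (nucoef_is_linear a)).

Lemma nucoefZ a c f : nucoef a (c *: f) = c * nucoef a f.
Proof. by rewrite linearZ. Qed.

Hypothesis n_gt0 : (0 < n)%N.

(** The quotient is taken modulo [mk_monic], which replaces a constant modulus by X; for n > 0 it
    leaves X^n unchanged. *)
Lemma mk_monic_nu : mk_monic ('X^n : {poly R}) = 'X^n.
Proof. by rewrite mk_monic_Xn prednK. Qed.

Lemma nucoef_ge a f : (n <= a)%N -> nucoef a f = 0.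
Proof.
by move=> na; apply: big_coef_npoly; rewrite mk_monic_nu size_polyXn.
Qed.

Lemma Rnu_eqP f g : (forall a, (a < n)%N -> nucoef a f = nucoef a g) -> f = g.
Proof.
move=> fg; apply/val_inj/polyP => a.
by have [/fg//|na] := ltnP a n; rewrite -/(nucoef a f) -/(nucoef a g) !nucoef_ge.
Qed.

Lemma nucoef_in_qpoly a (p : {poly R}) : (a < n)%N ->
  nucoef a (in_qpoly 'X^n p : Rnu R n) = p`_a.
Proof.
move=> an; rewrite -{1}(poly_take_drop n p) linearD /= raddfD /=.
have -> : in_qpoly 'X^n (drop_poly n p * 'X^n) = 0 :> Rnu R n.
  apply/val_inj => /=; rewrite mk_monic_nu.
  by rewrite Pdiv.RingMonic.rmodp_mull // monicXn.
rewrite raddf0 addr0 /nucoef in_qpoly_small ?coef_take_poly ?an //.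
by rewrite mk_monic_nu size_polyXn ltnS size_take_poly.
Qed.

Lemma Rnu_in_qpoly f : f = in_qpoly 'X^n (f : {poly R}).
Proof. by apply: Rnu_eqP => a an; rewrite nucoef_in_qpoly. Qed.

Lemma nucoefM a f g : (a < n)%N ->
  nucoef a (f * g) = \sum_(i < a.+1) nucoef i f * nucoef (a - i) g.
Proof.
by move=> an; rewrite {1}(Rnu_in_qpoly f) {1}(Rnu_in_qpoly g) -in_qpolyM
  nucoef_in_qpoly // coefM.
Qed.

Lemma nucoef_nuM a k f : nucoef a (nu R n ^+ k * f) =
  if (k <= a < n)%N then nucoef (a - k) f else 0.
Proof.
have [an|na] := ltnP a n; last by rewrite andbF nucoef_ge.
rewrite {1}(Rnu_in_qpoly f) /nu -rmorphXn -in_qpolyM nucoef_in_qpoly // coefXnM.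
by rewrite andbT ltnNge; case: leqP.
Qed.

Lemma nucoef1 a : nucoef a (1 : Rnu R n) = (a == 0)%:R.
Proof.
have [an|na] := ltnP a n; last first.
  by rewrite nucoef_ge // (gtn_eqF (leq_trans n_gt0 na)).
by rewrite -in_qpoly1 nucoef_in_qpoly // coef1.
Qed.

Lemma nucoef_nuX a k : nucoef a (nu R n ^+ k) = ((a == k) && (k < n)%N)%:R.
Proof.
rewrite -[nu R n ^+ k]mulr1 nucoef_nuM nucoef1 subn_eq0.
case: ifPn => [/andP[ka an]|kan].
  by congr ((_ : bool)%:R); apply/idP/idP; lia.
by rewrite (_ : _ && _ = false) //; apply/negbTE; lia.
Qed.

Lemma nuX_ge k : (n <= k)%N -> nu R n ^+ k = 0.
Proof.
move=> nk; apply: Rnu_eqP => a an; rewrite nucoef_nuX raddf0.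
by rewrite [(k < n)%N]ltnNge nk andbF.
Qed.

(** The quotient is the shift of the coefficients by m. The exponent m may exceed n, in which case f
    = 0. *)
Lemma nuX_dvd m f : (forall a, (a < m)%N -> (a < n)%N -> nucoef a f = 0) ->
  exists u, f = nu R n ^+ m * u.
Proof.
move=> f0; exists (\sum_(a < n) nucoef (a + m) f *: nu R n ^+ a).
apply: Rnu_eqP => a an; rewrite nucoef_nuM an andbT.
have [ma|am] := leqP m a; last exact: f0.
rewrite raddf_sum /=; have a'n : (a - m < n)%N by rewrite (leq_ltn_trans (leq_subr _ _)).
rewrite (bigD1 (Ordinal a'n)) //= linearZ /= nucoef_nuX eqxx a'n mulr1 subnK //.
rewrite big1 ?addr0 // => i; rewrite -val_eqE /= => /negPf ia.
by rewrite linearZ /= nucoef_nuX eq_sym ia mulr0.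
Qed.

(** The annihilator of nu^m is the ideal generated by nu^(n - m); this yields the values of the
    coefficients h_(i,j). *)
Lemma nuX_ann_dvd m f : nu R n ^+ m * f = 0 -> (m <= n)%N ->
  exists u, f = nu R n ^+ (n - m) * u.
Proof.
move=> f0 mn; apply: nuX_dvd => a am an.
have := congr1 (nucoef (a + m)) f0; rewrite nucoef_nuM raddf0 leq_addl addnK.
by rewrite ifT //= addnC -ltn_subRL.
Qed.

End RnuAlgebra.

(** * Bilinear forms, real and R[nu]-valued *)

Section Forms.
Context {R : realType}.

Lemma formE (A : pzRingType) d (H : 'M[A]_d) v w :
  form H v w = \sum_i \sum_j v 0 i * H i j * w 0 j.
Proof.
rewrite /form mxE exchange_big /=; apply: eq_bigr => j _.
by rewrite !mxE big_distrl.
Qed.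

Lemma nucoef_nuform n d (H : 'M[Rnu R n]_d) v w a :
  nucoef a (nuform H v w) = form (nucoef_mx a H) v w.
Proof.
rewrite /nuform !formE raddf_sum; apply: eq_bigr => i _.
rewrite raddf_sum; apply: eq_bigr => j _; rewrite !mxE.
by rewrite mulr_algl mulr_algr /= !nucoefZ mulrC.
Qed.

Lemma form_mulmxl d (A : 'M[R]_d) H v w : form H (v *m A) w = form (A *m H) v w.
Proof. by rewrite /form !mulmxA. Qed.

Lemma form_mulmxr d (A : 'M[R]_d) H v w : form H v (w *m A) = form (H *m A^T) v w.
Proof. by rewrite /form trmx_mul !mulmxA. Qed.

Lemma form_tr d (H : 'M[R]_d) v w : form H v w = form H^T w v.
Proof.
rewrite /form; have -> : (v *m H *m w^T) 0 0 = (v *m H *m w^T)^T 0 0 by rewrite [RHS]mxE.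
by rewrite !trmx_mul trmxK mulmxA.
Qed.

Lemma form_eqP d (H K : 'M[R]_d) : (forall v w, form H v w = form K v w) -> H = K.
Proof.
move=> HK; apply/matrixP => i j; have := HK (delta_mx 0 i) (delta_mx 0 j).
by rewrite /form -!rowE trmx_delta -!colE !mxE.
Qed.

Lemma formDl d (H : 'M[R]_d) u v w : form H (u + v) w = form H u w + form H v w.
Proof. by rewrite /form !mulmxDl mxE. Qed.

Lemma formBr d (H : 'M[R]_d) u v w : form H w (u - v) = form H w u - form H w v.
Proof. by rewrite /form raddfB /= mulmxBr !mxE. Qed.

End Forms.

(** * Lie derivatives and the Levi-Civita connection *)

Lemma trmxD (U : zmodType) m n (A B : 'M[U]_(m, n)) : (A + B)^T = A^T + B^T.
Proof. exact: raddfD. Qed.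

Lemma trmxB (U : zmodType) m n (A B : 'M[U]_(m, n)) : (A - B)^T = A^T - B^T.
Proof. exact: raddfB. Qed.

Section MatrixDerivative.
Context {R : realType} {d : nat}.
Implicit Types (p q v : 'rV[R]_d).

Lemma derive_sum_fun (f : 'I_d -> 'rV[R]_d -> R) v p :
  (forall k, differentiable (f k) p) ->
  'D_v (fun y => \sum_k f k y) p = \sum_k 'D_v (f k) p.
Proof.
move=> df; rewrite -derive_sum; last by move=> k; exact: diff_derivable.
by congr ('D_v _ p); apply/funext => y; rewrite fct_sumE.
Qed.

Lemma derive_mul_fun (f g : 'rV[R]_d -> R) v p : differentiable f p ->
  differentiable g p ->
  'D_v (fun x => f x * g x) p = 'D_v f p * g p + f p * 'D_v g p.
Proof.
move=> df dg; rewrite addrC [_ * g p]mulrC.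
by apply: deriveM; exact: diff_derivable.
Qed.

Lemma Dmx_mul a b (F : 'rV[R]_d -> 'M[R]_(a, d)) (G : 'rV[R]_d -> 'M[R]_(d, b)) v p :
  differentiable F p -> differentiable G p ->
  Dmx v (fun q => F q *m G q) p = Dmx v F p *m G p + F p *m Dmx v G p.
Proof.
move=> dF dG; apply/matrixP => i j; rewrite !mxE.
under eq_fun do rewrite mxE.
rewrite derive_sum_fun; last first.
  by move=> k; apply: differentiableM; exact: differentiable_mx_coord.
rewrite -big_split /=; apply: eq_bigr => k _; rewrite !mxE.
by rewrite derive_mul_fun //; exact: differentiable_mx_coord.
Qed.

Lemma Dmx_tr a b (F : 'rV[R]_d -> 'M[R]_(a, b)) v p :
  Dmx v (fun q => (F q)^T) p = (Dmx v F p)^T.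
Proof. by apply/matrixP => i j; rewrite !mxE; under eq_fun do rewrite mxE. Qed.

Lemma Dmx_near_eq a b (F G : 'rV[R]_d -> 'M[R]_(a, b)) v p :
  (\near p, F p = G p) -> Dmx v F p = Dmx v G p.
Proof.
move=> FG; apply/matrixP => i j; rewrite !mxE; apply: near_eq_derive.
by apply: filterS FG => q ->.
Qed.

Lemma Dmx_cst a b (A : 'M[R]_(a, b)) v p : Dmx v (fun=> A) p = 0.
Proof. by apply/matrixP => i j; rewrite !mxE; exact: derive_cst. Qed.

Lemma Dmx_sum a b (F : 'rV[R]_d -> 'M[R]_(a, b)) v p : differentiable F p ->
  Dmx v F p = \sum_i v 0 i *: Dmx (delta_mx 0 i) F p.
Proof.
move=> dF; apply/matrixP => i j; rewrite summxE mxE diff_sum_delta.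
  by apply: eq_bigr => k _; rewrite !mxE.
exact: differentiable_mx_coord.
Qed.

Lemma differentiable_mulmx a b c (F : 'rV[R]_d -> 'M[R]_(a, b))
    (G : 'rV[R]_d -> 'M[R]_(b, c)) p :
  differentiable F p -> differentiable G p -> differentiable (fun q => F q *m G q) p.
Proof.
move=> dF dG; apply: differentiable_mx => i j.
have -> : (fun q => (F q *m G q) i j) = \sum_k (fun q => F q i k * G q k j).
  by apply/funext => q; rewrite mxE fct_sumE.
by apply: differentiable_sum => k; apply: differentiableM; exact: differentiable_mx_coord.
Qed.

Lemma differentiable_tr a b (F : 'rV[R]_d -> 'M[R]_(a, b)) p :
  differentiable F p -> differentiable (fun q => (F q)^T) p.
Proof.
move=> dF; apply: differentiable_mx => i j; under eq_fun do rewrite mxE.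
exact: differentiable_mx_coord.
Qed.

Lemma differentiable_expmx (F : 'rV[R]_d -> 'M[R]_d) p k :
  differentiable F p -> differentiable (fun q => F q ^+ k) p.
Proof.
move=> dF; elim: k => [|k IH].
  by under eq_fun do rewrite expr0; exact: differentiable_cst.
by under eq_fun do rewrite exprS; exact: differentiable_mulmx.
Qed.

Lemma row_jacobian_mul (V : 'rV[R]_d -> 'rV[R]_d) (A : 'rV[R]_d -> 'M[R]_d) p i :
  differentiable V p -> differentiable A p ->
  row i ('J (fun q => V q *m A q) p) =
    row i ('J V p) *m A p + V p *m Dmx (delta_mx 0 i) A p.
Proof.
move=> dV dA; have dVA := differentiable_mulmx dV dA.
have E W : differentiable W p -> row i ('J W p) = Dmx (delta_mx 0 i) W p.
  by move=> dW; apply/rowP => k; rewrite mxE jacobianE // mxE.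
transitivity (Dmx (delta_mx 0 i) (fun q => V q *m A q) p); first exact: E.
by rewrite (Dmx_mul _ dV dA) (E _ _ dV).
Qed.

End MatrixDerivative.

(** * Leibniz rules for Lie derivatives *)

Section LieDerivative.
Context {R : realType} {d : nat}.
Implicit Types (p q v : 'rV[R]_d) (V : 'rV[R]_d -> 'rV[R]_d).
Implicit Types (G N Q : 'rV[R]_d -> 'M[R]_d).

Definition lie_mx V G p : 'M[R]_d :=
  Dmx (V p) G p + 'J V p *m G p + G p *m ('J V p)^T.

(** In row-vector conventions G Q^T is the matrix of G(., Q .), so this is L_V (G(., Q .)) = (L_V
    G)(., Q .) + G(., (L_V Q) .). *)
Lemma lie_mx_mul V G Q p : differentiable G p -> differentiable Q p ->
  lie_mx V (fun q => G q *m (Q q)^T) p =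
    lie_mx V G p *m (Q p)^T + G p *m (lie_endo V Q p)^T.
Proof.
move=> dG dQ; rewrite /lie_mx /lie_endo (Dmx_mul _ dG (differentiable_tr dQ)) Dmx_tr.
move: (Dmx _ G p) (Dmx _ Q p) ('J V p) (G p) (Q p) => A B J g q.
rewrite trmxB trmxD !trmx_mul !mulmxDl mulmxBr mulmxDr !mulmxA.
have alg (a b c e f : 'M[R]_d) : a + b + c + e = a + c + f + (b + e - f).
  by apply/matrixP => k l; rewrite !mxE; ring.
exact: alg.
Qed.

Lemma lie_endo_mul V N Q p : differentiable N p -> differentiable Q p ->
  lie_endo V (fun q => N q *m Q q) p =
    lie_endo V N p *m Q p + N p *m lie_endo V Q p.
Proof.
move=> dN dQ; rewrite /lie_endo (Dmx_mul _ dN dQ).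
move: (Dmx _ N p) (Dmx _ Q p) ('J V p) (N p) (Q p) => A B J g q.
rewrite mulmxBl mulmxDl mulmxBr mulmxDr !mulmxA.
have alg (a b c e f : 'M[R]_d) : a + b + c - e = a + c - f + (b + f - e).
  by apply/matrixP => k l; rewrite !mxE; ring.
exact: alg.
Qed.

Lemma lie_endo_exp V N p k : differentiable N p -> lie_endo V N p = 0 ->
  lie_endo V (fun q => N q ^+ k) p = 0.
Proof.
move=> dN lN; elim: k => [|k IH].
  under [X in lie_endo _ X]eq_fun do rewrite expr0.
  by rewrite /lie_endo Dmx_cst mulmx1 mul1mx add0r subrr.
under [X in lie_endo _ X]eq_fun do rewrite exprS.
rewrite lie_endo_mul //; last exact: differentiable_expmx.
by rewrite lN IH mul0mx mulmx0 addr0.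
Qed.

End LieDerivative.

(** * Lie derivatives through the Levi-Civita connection, and the defect nabla N *)

Section LeviCivita.
Context {R : realType} {d : nat}.
Implicit Types (p q v : 'rV[R]_d) (V : 'rV[R]_d -> 'rV[R]_d).
Implicit Types (G N Q : 'rV[R]_d -> 'M[R]_d).

(* The matrix of the endomorphism [X |-> nabla_X V]. *)
Definition nabla_field G V p : 'M[R]_d :=
  'J V p + \sum_i V p 0 i *: christoffel G p i.

Section Point.
Context (G N : 'rV[R]_d -> 'M[R]_d) (p : 'rV[R]_d).
Hypothesis dG : differentiable G p.
Hypothesis dN : differentiable N p.
Hypothesis Gsym : \near p, (G p)^T = G p.
Hypothesis Gunit : G p \in unitmx.

Let Gam (u : 'rV[R]_d) : 'M[R]_d := \sum_i u 0 i *: christoffel G p i.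
Let T i := nabla_endo G N p i.
Let Tsum (u : 'rV[R]_d) : 'M[R]_d := \sum_i u 0 i *: T i.

Lemma partial_sym i j k : partial i (fun q => G q j k) p = partial i (fun q => G q k j) p.
Proof. by apply: near_eq_derive; apply: filterS Gsym => q {1}<-; rewrite mxE. Qed.

(** Koszul's formula: multiplying by G lowers the upper index and removes the inverse matrix. *)
Lemma christoffel_mul i : christoffel G p i *m G p =
  \matrix_(j, k) (2^-1 * (partial i (fun q => G q j k) p
    + partial j (fun q => G q i k) p - partial k (fun q => G q i j) p)).
Proof.
set S := (X in _ = X); suff -> : christoffel G p i = S *m invmx (G p) by rewrite mulmxKV.
apply/matrixP => j k; rewrite !mxE; apply: eq_bigr => l _.
by rewrite mxE -mulrA mulrCA mulrC -mulrA; congr (_ * _); rewrite mulrC.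
Qed.

(** Compatibility of the connection with the metric, nabla G = 0. *)
Lemma christoffel_metric i :
  Dmx (delta_mx 0 i) G p = christoffel G p i *m G p + G p *m (christoffel G p i)^T.
Proof.
have -> : G p *m (christoffel G p i)^T = (christoffel G p i *m G p)^T.
  by rewrite trmx_mul (nbhs_singleton Gsym).
rewrite christoffel_mul; apply/matrixP => j k; rewrite !mxE.
rewrite -mulrDr -/(partial i (fun q => G q j k) p) (partial_sym i k j).
by set a := partial i _ _; set b := partial j _ _; set c := partial k _ _; lra.
Qed.

Lemma christoffel_sym i j k : christoffel G p i j k = christoffel G p j i k.
Proof.
rewrite !mxE; apply: eq_bigr => l _; congr (_ * (_ - _)); last exact: partial_sym.
by rewrite addrC.
Qed.

(** Vanishing torsion, in the form used below to exchange the direction of derivation and the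
    field. *)
Lemma Gam_sym u v : u *m Gam v = v *m Gam u.
Proof.
rewrite !mulmx_sumr; apply/rowP => k; rewrite !summxE.
have E x y : \sum_i (x *m (y 0 i *: christoffel G p i)) 0 k
    = \sum_i \sum_j (y 0 i * x 0 j) * christoffel G p i j k.
  apply: eq_bigr => i _; rewrite -scalemxAr mxE mxE mulr_sumr.
  by apply: eq_bigr => j _; rewrite mulrA.
rewrite !E exchange_big /=; apply: eq_bigr => i _; apply: eq_bigr => j _.
by rewrite christoffel_sym mulrC [v 0 j * _]mulrC mulrC.
Qed.

Lemma row_Gam i u : row i (Gam u) = u *m christoffel G p i.
Proof.
rewrite rowE Gam_sym; congr (u *m _); rewrite /Gam (bigD1 i) //= big1 ?addr0.
  by rewrite mxE !eqxx scale1r.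
by move=> j ji; rewrite mxE (negPf ji) andbF scale0r.
Qed.

Lemma Dmx_Gam u : Dmx u G p = Gam u *m G p + G p *m (Gam u)^T.
Proof.
rewrite Dmx_sum // /Gam mulmx_suml linear_sum /= mulmx_sumr -big_split /=.
apply: eq_bigr => i _.
by rewrite christoffel_metric scalerDr linearZ /= -scalemxAl -scalemxAr.
Qed.

Lemma Tsum_def u : Tsum u = Dmx u N p + N p *m Gam u - Gam u *m N p.
Proof.
rewrite (Dmx_sum u dN) /Gam mulmx_suml mulmx_sumr -big_split -sumrB /=.
apply: eq_bigr => i _.
by rewrite /T /nabla_endo scalerBr scalerDr -scalemxAl -scalemxAr.
Qed.

(** Since nabla G = 0 and the torsion vanishes, (L_V g)(X, Y) = g(nabla_X V, Y) + g(X, nabla_Y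
    V). *)
Lemma lie_mx_nabla V : lie_mx V G p =
  nabla_field G V p *m G p + G p *m (nabla_field G V p)^T.
Proof.
rewrite /nabla_field -/(Gam _) /lie_mx Dmx_Gam trmxD mulmxDl mulmxDr.
by rewrite [X in _ = X + _]addrC -!addrA; congr (_ + _); rewrite addrCA;
  congr (_ + _); rewrite addrC.
Qed.

(** L_V N is nabla_V N plus a commutator of N with X |-> nabla_X V, the Christoffel terms
    cancelling. For parallel N, L_V N = 0 thus means that this endomorphism commutes with N. *)
Lemma lie_endo_nabla V : lie_endo V N p =
  Tsum (V p) + nabla_field G V p *m N p - N p *m nabla_field G V p.
Proof.
rewrite /nabla_field -/(Gam _) Tsum_def /lie_endo mulmxDl mulmxDr.
have alg (D X Y Z W : 'M[R]_d) : D + X - Z = D + W - Y + (X + Y) - (Z + W).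
  by apply/matrixP => i j; rewrite !mxE; ring.
exact: alg.
Qed.

(** The endomorphism X |-> T_X v with v fixed, as opposed to [T i], where the direction X is
    fixed. *)
Let tau (v : 'rV[R]_d) : 'M[R]_d := \matrix_i (v *m T i).

Lemma nabla_mul V : differentiable V p ->
  nabla_field G (fun q => V q *m N q) p = nabla_field G V p *m N p + tau (V p).
Proof.
rewrite /nabla_field -/(Gam _) -/(Gam _).
move=> dV; apply/row_matrixP => i; rewrite !raddfD /= (row_jacobian_mul _ dV dN).
rewrite row_Gam row_mul raddfD /= rowK row_Gam /T /nabla_endo mulmxBr mulmxDr.
rewrite mulmxDl !mulmxA.
have alg (a b c e : 'rV[R]_d) : a + b + c = a + e + (b + c - e).
  by apply/rowP => k; rewrite !mxE; ring.
exact: alg.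
Qed.

#[local] Opaque nabla_field.

Hypothesis selfadj : \near p, N p *m G p = G p *m (N p)^T.

(** Differentiate the self-adjointness of N, which holds on a neighbourhood, and replace the
    derivative of G by metric compatibility. *)
Lemma nabla_selfadjoint i : T i *m G p = G p *m (T i)^T.
Proof.
have E : Dmx (delta_mx 0 i) (fun q => N q *m G q) p
    = Dmx (delta_mx 0 i) (fun q => G q *m (N q)^T) p by exact: Dmx_near_eq.
move: E; rewrite (Dmx_mul _ dN dG) (Dmx_mul _ dG (differentiable_tr dN)) Dmx_tr.
rewrite christoffel_metric /T /nabla_endo mulmxBl !mulmxDl !mulmxDr trmxB trmxD.
rewrite !trmx_mul mulmxBr !mulmxDr !mulmxA (nbhs_singleton selfadj).
rewrite -[christoffel G p i *m G p *m _]mulmxA -(nbhs_singleton selfadj) !mulmxA.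
have alg (a b c e f g : 'M[R]_d) : a + (b + c) = e + f + g ->
  a + b - e = g + f - c.
  by move/matrixP => E; apply/matrixP => k l; have := E k l; rewrite !mxE; lra.
exact: alg.
Qed.

(** With K the endomorphism X |-> nabla_X V, K commutes with N, and that of NV is K followed by N;
    self-adjointness moves this N to the second argument of L_V g. The second conclusion makes NV
    nilomorphic in turn, as needed for the powers of N. *)
Lemma lie_mx_parallel V : differentiable V p -> (forall i, T i = 0) ->
  lie_endo V N p = 0 ->
  lie_mx (fun q => V q *m N q) G p = lie_mx V G p *m (N p)^T /\
  lie_endo (fun q => V q *m N q) N p = 0.
Proof.
move=> dV T0.
have Ts0 u : Tsum u = 0 by rewrite /Tsum big1 // => i _; rewrite T0 scaler0.
have tau0 v : tau v = 0 by apply/row_matrixP => i; rewrite rowK T0 mulmx0 row0.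
have nm := nabla_mul dV; rewrite tau0 addr0 in nm.
have lG : lie_mx (fun q => V q *m N q) G p =
    nabla_field G V p *m N p *m G p + G p *m (nabla_field G V p *m N p)^T.
  by rewrite lie_mx_nabla nm.
have lN : lie_endo (fun q => V q *m N q) N p =
    nabla_field G V p *m N p *m N p - N p *m (nabla_field G V p *m N p).
  by rewrite lie_endo_nabla nm Ts0 add0r.
rewrite lG lN lie_endo_nabla lie_mx_nabla Ts0 add0r.
move: (nabla_field G V p) => K /subr0_eq KN; split; last first.
  by rewrite KN -mulmxA KN mulmxA subrr.
have sa := nbhs_singleton selfadj.
by rewrite mulmxDl -!mulmxA sa -trmx_mul -KN.
Qed.

(** Without parallelism, the terms in nabla V still cancel; what remains is g(T_X V, Y) + g(X, T_Y
    V) = g(X, T_V Y) for the coordinate fields X and Y of indices i and j. *)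
Lemma lie_mx_nonparallel V : differentiable V p -> lie_endo V N p = 0 ->
  lie_mx (fun q => V q *m N q) G p = lie_mx V G p *m (N p)^T ->
  forall i j, (V p *m T i *m G p) 0 j + (V p *m T j *m G p) 0 i
    = (Tsum (V p) *m G p) j i.
Proof.
move=> dV lN lG i j; have nm := nabla_mul dV.
have lG' : lie_mx (fun q => V q *m N q) G p =
    (nabla_field G V p *m N p + tau (V p)) *m G p
    + G p *m (nabla_field G V p *m N p + tau (V p))^T.
  by rewrite lie_mx_nabla nm.
have Gs := nbhs_singleton Gsym; have sa := nbhs_singleton selfadj.
have tauG a b : (tau (V p) *m G p) a b = (V p *m T a *m G p) 0 b.
  rewrite mxE [RHS]mxE; apply: eq_bigr => k _; congr (_ * _).
  by rewrite mxE.
suff H : (tau (V p) *m G p) i j + (tau (V p) *m G p) j i = (Tsum (V p) *m G p) j i.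
  exact: etrans (congr2 +%R (esym (tauG i j)) (esym (tauG j i))) H.
move: lN lG; rewrite lG' lie_endo_nabla lie_mx_nabla.
move: (nabla_field G V p) => K KN E.
have {}KN : N p *m K = Tsum (V p) + K *m N p by apply/esym/subr0_eq.
suff /matrixP/(_ i j) : tau (V p) *m G p + (tau (V p) *m G p)^T = (Tsum (V p) *m G p)^T.
  move=> E2; apply: etrans (etrans E2 _); last by rewrite mxE.
  by rewrite [RHS]mxE; congr (_ + _); rewrite [RHS]mxE.
move: E; rewrite !mulmxDl trmxD mulmxDr -(mulmxA _ _ (N p)^T) -sa.
rewrite -[G p *m K^T *m _]mulmxA -[K^T *m _]trmx_mul KN trmxD mulmxDr !mulmxA.
rewrite [in X in _ -> X]trmx_mul [in X in _ -> X]trmx_mul Gs.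
have alg (a b c e f : 'M[R]_d) : a + b + (c + e) = a + (f + c) -> b + e = f.
  by move/matrixP => Eq; apply/matrixP => k l; have := Eq k l; rewrite !mxE; lra.
exact: alg.
Qed.

Lemma parallel_at : (forall v, exists V, [/\ differentiable V p, V p = v,
    lie_endo V N p = 0 & lie_mx (fun q => V q *m N q) G p = lie_mx V G p *m (N p)^T]) ->
  forall i, T i = 0.
Proof.
move=> test.
pose s' (A : 'M[R]_d) k j : R := (A *m G p) k j; pose s i k j := s' (T i) k j.
have ssym i k j : s i k j = s i j k.
  have E : (T i *m G p)^T = T i *m G p.
    by rewrite trmx_mul (nbhs_singleton Gsym) nabla_selfadjoint.
  by rewrite /s /s' -{1}E mxE.
have sE i k j : s i k j + s j k i = s k j i.
  have [V [dV Vk lN lG]] := test (delta_mx 0 k).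
  have er (A : 'M[R]_d) l : s' A k l = ((delta_mx 0 k : 'rV[R]_d) *m A *m G p) 0 l.
    by rewrite -mulmxA -rowE /s' [RHS]mxE.
  have Tk : Tsum (delta_mx 0 k) = T k.
    rewrite /Tsum (bigD1 k) //= big1 ?addr0 => [|l lk].
      by rewrite mxE !eqxx scale1r.
    by rewrite mxE (negPf lk) andbF scale0r.
  have H := lie_mx_nonparallel dV lN lG i j; rewrite Vk Tk in H.
  exact: etrans (congr2 +%R (er _ _) (er _ _)) H.
have s0 i k j : s i k j = 0.
  (* Let a, b, c be the values of s with first index i, j, k, the other two being symmetric. The
     instances read b + a = c and c + a = b, whence 2a = 0. *)
  have := sE j k i; have := sE k j i.
  rewrite (ssym k i j) (ssym i j k) (ssym j i k); lra.
move=> i; have TG : T i *m G p = 0 by apply/matrixP => k j; rewrite [RHS]mxE; exact: s0.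
by rewrite -[T i](mulmxK Gunit) TG mul0mx.
Qed.

End Point.
End LeviCivita.

(** * Nilomorphic test fields *)

Section Charts.
Context {R : realType} {d : nat}.

Lemma open_image_overlap (T : topologicalType) (c c' : local_chart T R d) :
  open (cmap c @` (cdom c `&` cdom c')).
Proof.
have -> : cmap c @` (cdom c `&` cdom c') = cimg c `&` cinv c @^-1` cdom c'.
  apply/seteqP; split => [_ [m [cm c'm] <-]|p [[m cm <-]]].
    by split; [exists m | rewrite /preimage /= cmapK].
  by rewrite /preimage /= cmapK // => c'm; exists m.
rewrite openE => p [cp c'p]; rewrite /interior; apply: filterI.
  by apply: open_nbhs_nbhs; split => //; exact: cimg_open.
have := @cinv_continuous _ _ _ c; rewrite (continuous_open_subspace _ (@cimg_open _ _ _ c)).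
move=> /(_ p (mem_set cp)); apply; apply: open_nbhs_nbhs; split => //.
exact: cdom_open.
Qed.

Context {M : manifold R d}.
Implicit Types (c : mchart M).

Lemma transition_diff c c' m : atlas c -> atlas c' -> cdom c m -> cdom c' m ->
  differentiable (transition c c') (cmap c m).
Proof.
move=> ac ac' cm c'm; apply: (smooth_mx_on_diff (atlas_smooth ac ac')).
by exists m.
Qed.

(** The Jacobian as a function on the chart, each entry being a partial derivative by definition:
    smoothness and the symmetry of second derivatives apply to it directly. *)
Definition dtransition c c' (q : 'rV[R]_d) : 'M[R]_d :=
  \matrix_(i, l) partial i (fun y => transition c c' y 0 l) q.

Lemma chart_jacobianE c c' m : atlas c -> atlas c' -> cdom c m -> cdom c' m ->
  chart_jacobian c c' m = dtransition c c' (cmap c m).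
Proof.
move=> ac ac' cm c'm; apply/matrixP => i k.
by rewrite jacobianE ?mxE //; exact: transition_diff.
Qed.

Lemma dtransitionK c c' m : atlas c -> atlas c' -> cdom c m -> cdom c' m ->
  dtransition c c' (cmap c m) *m dtransition c' c (cmap c' m) = 1%:M.
Proof.
move=> ac ac' cm c'm; apply/matrixP => i k; rewrite !mxE.
have E : partial i ((fun y => transition c' c y 0 k) \o transition c c') (cmap c m)
    = partial i (fun y => y 0 k) (cmap c m).
  apply: near_eq_derive.
  have : nbhs (cmap c m) (cmap c @` (cdom c `&` cdom c')).
    by apply: open_nbhs_nbhs; split; [exact: open_image_overlap | exists m].
  by apply: filterS => _ [m' [cm' c'm'] <-]; rewrite /= /transition !cmapK.
have tE : transition c c' (cmap c m) = cmap c' m by rewrite /transition cmapK.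
move: E; rewrite partial_comp ?tE.
- by rewrite partial_coord => <-; apply: eq_bigr => l _; rewrite !mxE.
- by move=> l; apply: differentiable_mx_coord; exact: transition_diff.
- by apply: differentiable_mx_coord; exact: transition_diff.
Qed.

(* The fields that are constant in a chart where N is constant are nilomorphic. *)
Lemma nilomorphic_test_field n (N : mchart M -> 'rV[R]_d -> 'M[R]_d) c p v :
  nilpotent_structure n N -> atlas c -> cimg c p ->
  exists O V, [/\ open O, O `<=` cimg c, O p, nilomorphic_field O (N c) V & V p = v].
Proof.
case=> [[sN tN] _ _ cstN] ac [m cm <-{p}].
have [c' [ac' c'm cst']] := cstN m.
pose O := cmap c @` (cdom c `&` cdom c').
have oO : open O by exact: open_image_overlap.
have Om : O (cmap c m) by exists m.
pose A := dtransition c c'.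
pose B q := dtransition c' c (transition c c' q).
pose C := N c' (cmap c' m).
have AB q : O q -> A q *m B q = 1%:M.
  by case=> m' [cm' c'm'] <-; rewrite /A /B /transition cmapK // dtransitionK.
have NA q : O q -> N c q *m A q = A q *m C.
  case=> m' [cm' c'm'] <-; rewrite /A -chart_jacobianE // tN //; congr (_ *m _).
  by apply: cst'; [exists m' | exists m].
have sA : smooth_mx_on O A.
  move=> i l; under eq_fun do rewrite mxE; apply: smooth_on_partial.
  exact: (atlas_smooth ac ac').
have sB : smooth_mx_on O B.
  move=> l k; under eq_fun do rewrite mxE.
  apply: (@smooth_on_comp _ _ _ O (cmap c' @` (cdom c' `&` cdom c))
    (transition c c') (partial l (fun y => transition c' c y 0 k))) => //.
  - by move=> _ [m' [cm' c'm'] <-]; exists m' => //; rewrite /transition cmapK.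
  - exact: atlas_smooth.
  - by apply: smooth_on_partial; exact: (atlas_smooth ac' ac).
have subO : O `<=` cimg c by move=> _ [m' [cm' _] <-]; exists m'.
(* u represents v in the chart c'; the field V is the constant field u read back in c. *)
pose u := v *m A (cmap c m).
have sNc : smooth_mx_on O (N c).
  by move=> i j; apply: smooth_on_sub subO _; exact: sN.
have sV : smooth_mx_on O (fun q => u *m B q).
  by apply: smooth_mx_on_mul => //; exact: smooth_mx_on_cst.
exists O, (fun q => u *m B q); split => //; last first.
  by rewrite /u -mulmxA AB // mulmx1.
split=> // q Oq; set V := fun q => u *m B q.
have nO : nbhs q O by exact: open_nbhs_nbhs.
have dA := smooth_mx_on_diff sA Oq; have dN := smooth_mx_on_diff sNc Oq.
have dV := smooth_mx_on_diff sV Oq.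
have dNA w : Dmx w (N c) q *m A q + N c q *m Dmx w A q = Dmx w A q *m C.
  have dC : differentiable (fun=> C) q by exact: differentiable_cst.
  have := @Dmx_near_eq _ _ _ _ (fun q => N c q *m A q) (fun q => A q *m C) w q.
  rewrite (Dmx_mul _ dN dA) (Dmx_mul _ dA dC) Dmx_cst mulmx0 addr0; apply.
  by apply: filterS nO => q' Oq'; exact: NA.
(* Differentiating V A = u gives this up to exchanging the direction of derivation with the row
   index of A; A being a Jacobian, Schwarz's theorem allows the exchange. *)
have JV : 'J V q *m A q = - Dmx (V q) A q.
  apply/row_matrixP => i; rewrite row_mul; apply/eqP; rewrite -subr_eq0 raddfN /= opprK.
  have -> : row i (Dmx (V q) A q) = V q *m Dmx (delta_mx 0 i) A q.
    apply/rowP => k; rewrite !mxE diff_sum_delta; last exact: differentiable_mx_coord.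
    apply: eq_bigr => l _; rewrite !mxE.
    have E a : (fun y => A y a k) = partial a (fun y => transition c c' y 0 k).
      by apply/funext => y; rewrite mxE.
    congr (_ * _); rewrite (E i) (E l); apply: (partialC _ _ oO) => //.
    exact: (atlas_smooth ac ac').
  rewrite -row_jacobian_mul //; apply/eqP.
  have dVA := differentiable_mulmx dV dA.
  apply/rowP => k; rewrite mxE jacobianE // [RHS]mxE.
  rewrite -[RHS](derive_cst (u 0 k) q (delta_mx 0 i)); apply: near_eq_derive.
  apply: filterS nO => q' Oq'.
  by rewrite /V -mulmxA (mulmx1C (AB _ Oq')) mulmx1.
(* After multiplication by the invertible A, every term can be expressed through the derivatives of
   N A = A C, with C constant. *)
suff E : lie_endo V (N c) q *m A q = 0.
  by rewrite -[LHS]mulmx1 -(AB _ Oq) mulmxA E mul0mx.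
rewrite /lie_endo mulmxBl mulmxDl -[_ *m N c q *m A q]mulmxA NA //.
rewrite mulmxA -[N c q *m _ *m A q]mulmxA JV.
by rewrite mulNmx mulmxN opprK -dNA addrAC subrr.
Qed.

End Charts.

(** * Nilomorphic metrics and parallel nilpotent structures *)

Section RnuMatrices.
Context {R : realType} {n : nat}.
Hypothesis n_gt0 : (0 < n)%N.

Lemma nucoef_Dnu d (v : 'rV[R]_d) (f : 'rV[R]_d -> Rnu R n) x a : (a < n)%N ->
  nucoef a (Dnu v f x) = 'D_v (fun y => nucoef a (f y)) x.
Proof.
move=> an; rewrite /Dnu raddf_sum /= (bigD1 (Ordinal an)) //=.
rewrite nucoefZ (nucoef_nuX n_gt0) eqxx an mulr1 big1 ?addr0 // => i.
by rewrite -val_eqE /= => /negPf ia; rewrite nucoefZ (nucoef_nuX n_gt0) eq_sym ia mulr0.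
Qed.

Lemma nucoef_mx_mull a p q r (A : 'M[R]_(p, q)) (H : 'M[Rnu R n]_(q, r)) :
  nucoef_mx a (toRnu n A *m H) = A *m nucoef_mx a H.
Proof.
apply/matrixP => i j; rewrite !mxE raddf_sum /=; apply: eq_bigr => k _.
by rewrite !mxE mulr_algl nucoefZ.
Qed.

Lemma nucoef_mx_mulr a p q r (A : 'M[R]_(q, r)) (H : 'M[Rnu R n]_(p, q)) :
  nucoef_mx a (H *m toRnu n A) = nucoef_mx a H *m A.
Proof.
apply/matrixP => i j; rewrite !mxE raddf_sum /=; apply: eq_bigr => k _.
by rewrite !mxE mulr_algr nucoefZ mulrC.
Qed.

Lemma nucoef_lie_form d (V : 'rV[R]_d -> 'rV[R]_d) (h : 'rV[R]_d -> 'M[Rnu R n]_d) p a :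
  (a < n)%N ->
  nucoef_mx a (lie_form V h p) = lie_mx V (fun q => nucoef_mx a (h q)) p.
Proof.
move=> an; rewrite /lie_form /lie_mx -nucoef_mx_mull -nucoef_mx_mulr.
apply/matrixP => i j; rewrite mxE [RHS]mxE mxE raddfD /=; congr (_ + _).
  rewrite mxE [RHS]mxE raddfD /=; congr (_ + _); last by rewrite [RHS]mxE.
  by rewrite !mxE nucoef_Dnu //; under [in RHS]eq_fun do rewrite mxE.
by rewrite [RHS]mxE; congr (nucoef a ((_ *m _) i j)); apply/matrixP => k l; rewrite !mxE.
Qed.

Lemma nucoef_mx_nu a p q (H : 'M[Rnu R n]_(p, q)) : (a < n)%N ->
  nucoef_mx a (nu R n *: H) = if a is b.+1 then nucoef_mx b H else 0.
Proof.
move=> an; apply/matrixP => i j; rewrite mxE mxE -[nu R n]expr1 nucoef_nuM //.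
by case: a an => [|a] an; rewrite !mxE // subn1 /= an.
Qed.

Lemma Rnu_mxP p q (A B : 'M[Rnu R n]_(p, q)) :
  (forall a, (a < n)%N -> nucoef_mx a A = nucoef_mx a B) -> A = B.
Proof.
move=> AB; apply/matrixP => i j; apply: (Rnu_eqP n_gt0) => a an.
by have /matrixP/(_ i j) := AB a an; rewrite !mxE.
Qed.

(** Coefficientwise, multiplication by nu lowers the index of h_a by one, with h_(-1) = 0:
    R[nu]-bilinearity becomes h_a(N ., .) = h_(a-1) = h_a(., N .). *)
Lemma nuform_components d (A : 'M[R]_d) (H : 'M[Rnu R n]_d) :
  (forall v w, [/\ nuform H v w = nuform H w v,
     nuform H (v *m A) w = nu R n * nuform H v w
   & nuform H v (w *m A) = nu R n * nuform H v w]) <->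
  forall a, (a < n)%N ->
   [/\ (nucoef_mx a H)^T = nucoef_mx a H,
       A *m nucoef_mx a H = (if a is b.+1 then nucoef_mx b H else 0)
     & nucoef_mx a H *m A^T = (if a is b.+1 then nucoef_mx b H else 0)].
Proof.
have nuE a v w : (a < n)%N -> nucoef a (nu R n * nuform H v w) =
    form (if a is b.+1 then nucoef_mx b H else 0) v w.
  move=> an; rewrite -[nu R n]expr1 nucoef_nuM //; case: a an => [|a] an /=.
    by rewrite /form mulmx0 mul0mx mxE.
  by rewrite an subn1 nucoef_nuform.
split=> [E a an|E v w].
  split; apply: form_eqP => v w; have [e1 e2 e3] := E v w.
  - by rewrite -form_tr -!nucoef_nuform e1.
  - by rewrite -form_mulmxl -nucoef_nuform e2 nuE.
  - by rewrite -form_mulmxr -nucoef_nuform e3 nuE.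
split; apply: (Rnu_eqP n_gt0) => a an; have [e1 e2 e3] := E a an.
- by rewrite !nucoef_nuform form_tr e1.
- by rewrite nucoef_nuform form_mulmxl e2 nuE.
- by rewrite nucoef_nuform form_mulmxr e3 nuE.
Qed.

(** Iterating the shift from the top coefficient shows that h is determined by its real metric and
    N. *)
Lemma nuform_component_real d (A : 'M[R]_d) (H : 'M[Rnu R n]_d) :
  (forall v w, [/\ nuform H v w = nuform H w v,
     nuform H (v *m A) w = nu R n * nuform H v w
   & nuform H v (w *m A) = nu R n * nuform H v w]) ->
  forall k, (k < n)%N ->
    nucoef_mx (n.-1 - k) H = nucoef_mx n.-1 H *m (A ^+ k)^T.
Proof.
move=> /nuform_components E; elim=> [|k IH] kn.
  by rewrite expr0 trmx1 mulmx1 subn0.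
rewrite exprS trmx_mul mulmxA -IH; last exact: ltnW.
have [|_ _ ->] := E (n.-1 - k)%N; first by rewrite (leq_ltn_trans (leq_subr _ _)) // prednK.
by rewrite subnS; case: (n.-1 - k)%N (subn_gt0 k n.-1) => //; lia.
Qed.

End RnuMatrices.

(** * From a parallel nilpotent structure to a nilomorphic metric *)

Section Metrics.
Context {R : realType} {d : nat} {M : manifold R d} {n : nat}.
Context {N : mchart M -> 'rV[R]_d -> 'M[R]_d}.
Hypothesis hN : nilpotent_structure n N.

(** For n = 0 the truncated predecessor makes the power required to vanish and the one required not
    to vanish coincide. *)
Lemma nilpotency_index_gt0 : (0 < n)%N.
Proof.
have [_ N0 [c [p [ac cp ne]]] _] := hN.
rewrite lt0n; apply: contraNneq ne => n0.
by rewrite -(N0 c p ac cp) n0.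
Qed.

Let n_gt0 := nilpotency_index_gt0.

Lemma nondegenerate_unitmx (G : 'M[R]_d) :
  (forall v, (forall w, form G v w = 0) -> v = 0) -> G \in unitmx.
Proof.
move=> nd; rewrite -row_free_unit -kermx_eq0; apply/eqP/row_matrixP => i.
rewrite row0; apply: nd => w.
by rewrite /form -row_mul mulmx_ker row0 mul0mx mxE.
Qed.

Lemma nilomorphic_metric_of_parallel (g : mchart M -> 'rV[R]_d -> 'M[R]_d) :
  pseudo_riemannian g -> self_adjoint N g -> parallel g N ->
  exists h : mchart M -> 'rV[R]_d -> 'M[Rnu R n]_d,
    nilomorphic_metric N h /\ real_metric g h.
Proof.
move=> [[sg tg] ndg] sa par.
have [[sN tN] N0 _ _] := hN.
pose H k c p := g c p *m (N c p ^+ k)^T.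
pose h c p : 'M[Rnu R n]_d :=
  \matrix_(i, j) \sum_(a < n) H (n.-1 - a)%N c p i j *: nu R n ^+ a.
have hE a c p : (a < n)%N -> nucoef_mx a (h c p) = H (n.-1 - a)%N c p.
  move=> an; apply/matrixP => i j; rewrite mxE mxE raddf_sum /= (bigD1 (Ordinal an)) //=.
  rewrite nucoefZ (nucoef_nuX n_gt0) eqxx an mulr1 big1 ?addr0 // => k.
  by rewrite -val_eqE /= => /negPf ka; rewrite nucoefZ (nucoef_nuX n_gt0) eq_sym ka mulr0.
have sa' c p : atlas c -> cimg c p -> N c p *m g c p = g c p *m (N c p)^T.
  move=> ac cp; apply: form_eqP => v w.
  by rewrite -form_mulmxl -form_mulmxr; exact: sa.
have gs c p : atlas c -> cimg c p -> (g c p)^T = g c p.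
  move=> ac cp; apply: form_eqP => v w; rewrite -form_tr.
  by have [+ _] := ndg c p ac cp; apply.
have saX k c p : atlas c -> cimg c p -> N c p ^+ k *m g c p = g c p *m (N c p ^+ k)^T.
  move=> ac cp; elim: k => [|k IH]; first by rewrite expr0 trmx1 mul1mx mulmx1.
  rewrite {1}exprSr -[_ * _]/(_ *m _) -mulmxA sa' // mulmxA IH -mulmxA -trmx_mul.
  by rewrite exprS.
have oc c : open (cimg c) by exact: cimg_open.
have sH k c : atlas c -> smooth_mx_on (cimg c) (H k c).
  move=> ac; apply: smooth_mx_on_mul => //; first exact: sg.
  by apply: smooth_mx_on_tr; apply: smooth_mx_on_exp => //; exact: sN.
exists h; split; last first.
  move=> c p ac cp; rewrite hE; last by rewrite prednK.
  by rewrite subnn /H expr0 trmx1 mulmx1.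
split.
- move=> a an; split=> [c ac i j|c c' m ac ac' cm c'm].
    by apply: smooth_on_eq (sH (n.-1 - a)%N c ac i j) => // p _; rewrite -hE.
  rewrite !hE // /H (tg c c' m) //.
  have tX k : chart_jacobian c c' m *m (N c' (cmap c' m) ^+ k)
      = N c (cmap c m) ^+ k *m chart_jacobian c c' m.
    elim: k => [|k IH]; first by rewrite !expr0 mulmx1 mul1mx.
    rewrite exprSr -[_ * _]/(_ *m _) mulmxA IH -mulmxA -(tN c c' m) // mulmxA.
    by rewrite [N c _ ^+ k.+1]exprSr.
  by rewrite -!mulmxA; congr (_ *m (_ *m _)); rewrite -!trmx_mul tX.
- move=> c p ac cp; apply/nuform_components => // a an.
  have Nn := N0 c p ac cp.
  rewrite !hE // /H trmx_mul trmxK gs // saX //; split=> //.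
    rewrite mulmxA sa' // -mulmxA -trmx_mul -[_ *m N c p]/(_ * _) -exprSr.
    case: a an => [|a] an; last first.
      by rewrite hE ?(ltnW an) // /H; congr (_ *m (_ ^+ _)^T); lia.
    by rewrite subn0 prednK // Nn trmx0 mulmx0.
  rewrite -mulmxA -trmx_mul -[N c p *m _]/(_ * _) -exprS.
  case: a an => [|a] an; last first.
    by rewrite hE ?(ltnW an) // /H; congr (_ *m (_ ^+ _)^T); lia.
  by rewrite subn0 prednK // Nn trmx0 mulmx0.
- move=> c p ac cp v v0; have [_ nd] := ndg c p ac cp; apply: nd => w.
  have := congr1 (nucoef n.-1) (v0 w).
  by rewrite nucoef_nuform hE ?prednK // subnn /H expr0 trmx1 mulmx1 raddf0.
- move=> c O V ac oO Oc [sV lV] p Op.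
  have cp := Oc p Op.
  have nc : nbhs p (cimg c) by apply: open_nbhs_nbhs.
  have dG := smooth_mx_on_diff (sg c ac) cp.
  have dN := smooth_mx_on_diff (sN c ac) cp.
  have dV := smooth_mx_on_diff sV Op.
  have Gs : \near p, (g c p)^T = g c p by apply: filterS nc => q; exact: gs.
  have Gsa : \near p, N c p *m g c p = g c p *m (N c p)^T.
    by apply: filterS nc => q; exact: sa'.
  have Gu : g c p \in unitmx by apply: nondegenerate_unitmx; have [] := ndg c p ac cp.
  have [lG lN] := lie_mx_parallel dG dN Gs Gu Gsa dV (par c p ac cp) (lV p Op).
  (* Both V and NV preserve the powers of N, so only g is differentiated and one factor N is
     gained. *)
  have lH k : lie_mx (fun q => V q *m N c q) (H k c) p = lie_mx V (H k.+1 c) p.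
    have dX j := differentiable_expmx j dN.
    rewrite (lie_mx_mul _ dG (dX k)) (lie_mx_mul _ dG (dX k.+1)).
    rewrite (lie_endo_exp _ dN lN) (lie_endo_exp _ dN (lV p Op)) trmx0 mulmx0 !addr0.
    by rewrite lG -mulmxA -trmx_mul exprSr.
  have hH a W : (a < n)%N -> nucoef_mx a (lie_form W (h c) p) = lie_mx W (H (n.-1 - a)%N c) p.
    move=> an; rewrite nucoef_lie_form //.
    by congr (lie_mx W _ p); apply/funext => q; exact: hE.
  apply: (Rnu_mxP n_gt0) => a an; rewrite nucoef_mx_nu // hH // lH.
  case: a an => [|a] an; last by rewrite hH ?(ltnW an) //; congr (lie_mx _ (H _ c) p); lia.
  (* For a = 0 the right-hand side has no coefficient below it; the left-hand side is the Lie
     derivative of g(., N^n .), which is zero. *)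
  rewrite subn0 prednK // /H (lie_mx_mul _ dG (differentiable_expmx n dN)).
  rewrite (lie_endo_exp _ dN (lV p Op)) N0 // trmx0 !mulmx0 addr0.
  by [].
Qed.

End Metrics.

(** * From a nilomorphic metric to a parallel nilpotent structure *)

Section Converse.
Context {R : realType} {d : nat}.

Lemma lie_mx_near_eq (V : 'rV[R]_d -> 'rV[R]_d) (G H : 'rV[R]_d -> 'M[R]_d) p :
  (\near p, G p = H p) -> lie_mx V G p = lie_mx V H p.
Proof.
by move=> GH; rewrite /lie_mx (Dmx_near_eq _ GH) (nbhs_singleton GH).
Qed.

Context {M : manifold R d} {n : nat} {N : mchart M -> 'rV[R]_d -> 'M[R]_d}.
Hypothesis hN : nilpotent_structure n N.
Context {g : mchart M -> 'rV[R]_d -> 'M[R]_d}.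
Context {h : mchart M -> 'rV[R]_d -> 'M[Rnu R n]_d}.
Hypotheses (hh : nilomorphic_metric N h) (rm : real_metric g h).

Let n_gt0 := nilpotency_index_gt0 hN.

Lemma nilomorphic_component c p k : atlas c -> cimg c p -> (k < n)%N ->
  nucoef_mx (n.-1 - k) (h c p) = g c p *m (N c p ^+ k)^T.
Proof.
move=> ac cp kn; have [_ halg _ _] := hh.
by rewrite (nuform_component_real n_gt0 (halg c p ac cp)) // -rm.
Qed.

Lemma real_metric_selfadjoint c p : atlas c -> cimg c p ->
  N c p *m g c p = g c p *m (N c p)^T.
Proof.
move=> ac cp; have [_ halg _ _] := hh; have n1 : (n.-1 < n)%N by rewrite prednK.
have [_ e2 e3] := (nuform_components n_gt0 _ _).1 (halg c p ac cp) _ n1.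
by rewrite rm // e2 e3.
Qed.

Lemma real_metric_sym c p : atlas c -> cimg c p -> (g c p)^T = g c p.
Proof.
move=> ac cp; have [_ halg _ _] := hh; have n1 : (n.-1 < n)%N by rewrite prednK.
have [e1 _ _] := (nuform_components n_gt0 _ _).1 (halg c p ac cp) _ n1.
by rewrite rm // e1.
Qed.

Lemma real_metric_pseudo_riemannian : pseudo_riemannian g.
Proof.
have [hb halg hnd _] := hh; have n1 : (n.-1 < n)%N by rewrite prednK.
have [sh th] := hb _ n1.
have oc (c : mchart M) : open (cimg c) by exact: cimg_open.
split; first split=> [c ac i j|c c' m ac ac' cm c'm].
- by apply: smooth_on_eq (sh c ac i j) => // p /set_mem cp; rewrite rm.
- rewrite !rm; first exact: th.
  + by [].
  + by exists m.
  + by [].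
  + by exists m.
move=> c p ac cp; split=> [v w|v v0]; first by rewrite form_tr real_metric_sym.
(* Every coefficient of h(v, w) has the form g(v, N^k w), so the radical of g is contained in that
   of h. *)
apply: (hnd c p ac cp) => w; apply: (Rnu_eqP n_gt0) => a an.
rewrite nucoef_nuform raddf0; have -> : a = (n.-1 - (n.-1 - a))%N by lia.
rewrite nilomorphic_component //; last by lia.
by rewrite -form_mulmxr v0.
Qed.

Lemma real_metric_parallel : parallel g N.
Proof.
move=> c p ac cp; have [[sg _] ndg] := real_metric_pseudo_riemannian.
have [[sN _] N0 _ _] := hN.
have oc : open (cimg c) by exact: cimg_open.
have nc : nbhs p (cimg c) by apply: open_nbhs_nbhs.
have dG := smooth_mx_on_diff (sg c ac) cp.
have dN := smooth_mx_on_diff (sN c ac) cp.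
have Gs : \near p, (g c p)^T = g c p.
  by apply: filterS nc => q; exact: real_metric_sym.
have Gsa : \near p, N c p *m g c p = g c p *m (N c p)^T.
  by apply: filterS nc => q; exact: real_metric_selfadjoint.
have Gu : g c p \in unitmx by apply: nondegenerate_unitmx; have [] := ndg c p ac cp.
apply: (parallel_at dG dN Gs Gu Gsa) => v.
have [U [V [oU Uc Up [sV lV] Vp]]] := nilomorphic_test_field v hN ac cp.
have lVp := lV p Up; have dV := smooth_mx_on_diff sV Up.
exists V; split=> //; have [_ _ _ hlie] := hh.
have n1 : (n.-1 < n)%N by rewrite prednK.
have := congr1 (@nucoef_mx R n n.-1 d d) (hlie c U V ac oU Uc (conj sV lV) p Up).
rewrite (nucoef_mx_nu n_gt0 _ n1) (nucoef_lie_form n_gt0 _ _ _ n1).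
have hg W : lie_mx W (fun q => nucoef_mx n.-1 (h c q)) p = lie_mx W (g c) p.
  by apply: lie_mx_near_eq; apply: filterS nc => q cq; rewrite rm.
(* If n = 1, both nu and N vanish. Otherwise the coefficient n - 1 of nu L_V h is L_V h_(n-2), where
   h_(n-2) = g(., N .). *)
rewrite hg => ->; case E : n.-1 => [|b].
  have := N0 c p ac cp; rewrite -(prednK n_gt0) E expr1 => ->.
  by rewrite trmx0 mulmx0.
rewrite (nucoef_lie_form n_gt0); last by rewrite -(prednK n_gt0) E.
have -> : lie_mx V (fun q => nucoef_mx b (h c q)) p
    = lie_mx V (fun q => g c q *m (N c q)^T) p.
  apply: lie_mx_near_eq; apply: filterS nc => q cq.
  have -> : b = (n.-1 - 1)%N by rewrite E subn1.
  by rewrite nilomorphic_component ?expr1 //; rewrite -(prednK n_gt0) E.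
by rewrite (lie_mx_mul _ dG dN) lVp trmx0 mulmx0 addr0.
Qed.

Lemma real_metric_self_adjoint : self_adjoint N g.
Proof.
move=> c p ac cp v w.
by rewrite form_mulmxl form_mulmxr real_metric_selfadjoint.
Qed.

End Converse.

(** * Signatures *)

Section Signature.
Context {R : realType} {d : nat}.
Implicit Types (B W V : 'M[R]_d).

(** Only the values of the quadratic form need to be transported: positivity on E', together with
    vanishing on V', already forces E' to be free and to meet V' trivially. *)
Lemma positive_index_le B W W' V V' :
  (forall r (E : 'M[R]_(r, d)), (E <= W)%MS ->
    exists2 E' : 'M[R]_(r, d), (E' <= V)%MS &
      forall u, form B (u *m E') (u *m E') = form B (u *m E) (u *m E)) ->
  (forall v : 'rV[R]_d, (v <= V')%MS -> form B v v = 0) ->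
  (positive_index B W W' <= positive_index B V V')%N.
Proof.
move=> WV rad; apply/bigmax_leqP => r /asboolP [E [_ EW _ pos]].
have [E' E'V formE] := WV r E EW.
have inj (u : 'rV[R]_r) : (u *m E' <= V')%MS -> u = 0.
  move=> uV; apply/eqP; apply: contraT => u0.
  by have := pos u u0; rewrite -formE rad ?ltxx.
apply: (@leq_bigmax_cond _ (fun r : 'I_d.+1 => _) (fun r : 'I_d.+1 => r : nat) r).
apply/asboolP; exists E'; split=> //.
- rewrite -kermx_eq0; apply/eqP/row_matrixP => i; rewrite row0; apply: inj.
  by rewrite -row_mul mulmx_ker row0 sub0mx.
- apply/eqP; rewrite -submx0; apply/row_subP => i.
  have := row_sub i (E' :&: V')%MS; rewrite sub_capmx => /andP[/submxP[u uE] iV].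
  by rewrite uE in iV *; rewrite (inj u iV) mul0mx sub0mx.
- by move=> u u0; rewrite formE; exact: pos.
Qed.

Lemma formN B v w : form (- B) v w = - form B v w.
Proof. by rewrite /form mulmxN mulNmx mxE. Qed.

Lemma signature_eq B W W' V V' :
  (forall r (E : 'M[R]_(r, d)), (E <= W)%MS ->
    exists2 E' : 'M[R]_(r, d), (E' <= V)%MS &
      forall u, form B (u *m E') (u *m E') = form B (u *m E) (u *m E)) ->
  (V <= W)%MS ->
  (forall v : 'rV[R]_d, (v <= V')%MS -> form B v v = 0) ->
  (forall v : 'rV[R]_d, (v <= W')%MS -> form B v v = 0) ->
  signature B W W' = signature B V V'.
Proof.
move=> WV VW rV rW; rewrite /signature.
have VW' r (E : 'M[R]_(r, d)) : (E <= V)%MS -> (E <= W)%MS by move/submx_trans; apply.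
congr pair; apply/eqP; rewrite eqn_leq; apply/andP; split; apply: positive_index_le => //.
- by move=> r E EV; exists E => //; exact: VW'.
- move=> r E /WV[E' E'V formE]; exists E' => // u; by rewrite !formN formE.
- by move=> v /rV; rewrite formN => ->; rewrite oppr0.
- by move=> r E EV; exists E => //; exact: VW'.
- by move=> v /rW; rewrite formN => ->; rewrite oppr0.
Qed.

(** For z and t N in ker N^a, g(z, t N N^(a-1)) = g(z N^a, t) = 0. The component along Im N is thus
    invisible to the form, and the flag condition permits removing it inside ker N^a. *)
Lemma char_signature_complement (N G S : 'M[R]_d) a : (0 < a)%N ->
  N *m G = G *m N^T -> flag_complement N S ->
  char_signature N G a =
  signature (G *m (N ^+ a.-1)^T) (S :&: kermx (N ^+ a))%MS
    (S :&: kermx (N ^+ a.-1))%MS.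
Proof.
move=> a0 sa [_ _ flag]; rewrite /char_signature; set B := G *m _.
have saX k : N ^+ k *m G = G *m (N ^+ k)^T.
  elim: k => [|k IH]; first by rewrite expr0 trmx1 mul1mx mulmx1.
  rewrite {1}exprSr -[_ * _]/(_ *m _) -mulmxA sa mulmxA IH -mulmxA -trmx_mul.
  by rewrite exprS.
have Na : N *m N ^+ a.-1 = N ^+ a by rewrite -[_ *m _]/(_ * _) -exprS prednK.
have formB v w : form B v w = form G v (w *m N ^+ a.-1) by rewrite form_mulmxr.
have formB' v w : form B v w = form G (v *m N ^+ a.-1) w by rewrite form_mulmxl saX.
have form0l v : form G 0 v = 0 by rewrite /form !mul0mx mxE.
have form0r v : form G v 0 = 0 by rewrite /form trmx0 mulmx0 mxE.
have form_Na z t : z *m N ^+ a = 0 -> form G z (t *m N ^+ a) = 0.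
  by move=> z0; rewrite form_mulmxr -saX -form_mulmxl z0 form0l.
have form_Na' z t : z *m N ^+ a = 0 -> form G (t *m N ^+ a) z = 0.
  by move=> z0; rewrite form_mulmxl saX -form_mulmxr z0 form0r.
apply: signature_eq.
(* The rows of E are split along S /\ ker N^a and Im N; E' keeps the first component. *)
- move=> r E EW; have /sub_addsmxP[[x y] /= Exy] := submx_trans EW (flag a).
  exists (x *m (S :&: kermx (N ^+ a))%MS); first exact: submxMl.
  move=> u; set E' := x *m _ in Exy *; set EN := y *m _ in Exy.
  have kE : u *m E *m N ^+ a = 0.
    by rewrite -mulmxA; have /sub_kermxP-> := EW; rewrite mulmx0.
  have kE' : u *m E' *m N ^+ a = 0.
    have /sub_kermxP E'0 : (E' <= kermx (N ^+ a))%MS.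
      by rewrite (submx_trans (submxMl _ _)) // capmxSr.
    by rewrite -mulmxA E'0 mulmx0.
  have uE : u *m E = u *m E' + u *m y *m N by rewrite Exy mulmxDr -(mulmxA u y N).
  have r1 z : z *m N ^+ a = 0 -> form B z (u *m y *m N) = 0.
    by move=> z0; rewrite formB -(mulmxA (u *m y)) Na form_Na.
  have r2 z : z *m N ^+ a = 0 -> form B (u *m y *m N) z = 0.
    by move=> z0; rewrite formB' -(mulmxA (u *m y)) Na form_Na'.
  rewrite {1}uE formDl r2 // addr0 uE -[u *m y *m N]opprK formBr.
  have -> v : form B v (- (u *m y *m N)) = - form B v (u *m y *m N).
    by rewrite -[- _]sub0r formBr /form trmx0 mulmx0 mxE sub0r.
  by rewrite r1 // oppr0 subr0.
- exact: capmxSr.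
- move=> v; rewrite sub_capmx => /andP[_ /sub_kermxP v0].
  by rewrite formB v0 form0r.
(* Modulo ker N^(a-1), v is some y N, so v N^(a-1) = y N^a is g-orthogonal to v, which lies in ker
   N^a. *)
- move=> v; rewrite sub_capmx => /andP[/sub_kermxP va /sub_addsmxP[[x y] /= vE]].
  have k0 : x *m kermx (N ^+ a.-1) *m N ^+ a.-1 = 0 by apply/sub_kermxP; exact: submxMl.
  have : v *m N ^+ a.-1 = y *m N ^+ a by rewrite vE mulmxDl k0 add0r -mulmxA Na.
  by rewrite formB => ->; exact: form_Na.
Qed.

(** S is enlarged along the flag of kernels, staying transverse to Im N at each stage; at stage n
    the kernel is the whole space, so S + Im N is everything. *)
Lemma flag_complement_exists (N : 'M[R]_d) n : N ^+ n = 0 ->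
  exists S, flag_complement N S.
Proof.
move=> Nn.
have kle k : (kermx (N ^+ k) <= kermx (N ^+ k.+1))%MS.
  by apply/sub_kermxP; rewrite exprSr -[_ * N]/(_ *m N) mulmxA mulmx_ker mul0mx.
have step k : exists S : 'M[R]_d, [/\ (S <= kermx (N ^+ k))%MS, (S :&: N)%MS = 0
    & forall a, (a <= k)%N -> (kermx (N ^+ a) <= (S :&: kermx (N ^+ a))%MS + N)%MS].
  elim: k => [|k [S [Sk SN flag]]].
    exists 0; split; [exact: sub0mx | exact: cap0mx |] => a; rewrite leqn0 => /eqP ->.
    rewrite expr0; have /eqP -> : kermx (1 : 'M[R]_d) == 0.
      by rewrite kermx_eq0 row_free_unit unitmx1.
    exact: sub0mx.
  (* T supplies the directions of ker N^(k+1) missing from S + Im N; as it meets that sum trivially,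
     adding it to S creates no intersection with Im N. *)
  pose T := (kermx (N ^+ k.+1) :\: (S + N))%MS.
  have Tk : (T <= kermx (N ^+ k.+1))%MS by exact: diffmxSl.
  have Sk' := submx_trans Sk (kle k).
  exists (S + T)%MS; split.
  - by rewrite addsmx_sub Sk'.
  - apply/eqP; rewrite -submx0; apply/row_subP => i.
    have := row_sub i ((S + T) :&: N)%MS; set x := row i _.
    rewrite sub_capmx => /andP[/sub_addsmxP[[s t] /= xE] xN].
    have tT : (t *m T <= T :&: (S + N))%MS.
      rewrite sub_capmx submxMl /=.
      have -> : t *m T = x - s *m S by rewrite xE addrAC subrr add0r.
      rewrite addmx_sub ?eqmx_opp //; first exact: submx_trans (addsmxSr _ _).
      exact: submx_trans (submxMl _ _) (addsmxSl _ _).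
    have t0 : t *m T = 0.
      by move: tT; rewrite capmx_diff submx0 => /eqP.
    rewrite -SN sub_capmx xN andbT xE t0 addr0; exact: submxMl.
  - move=> a; rewrite leq_eqVlt => /orP[/eqP ->|]; last first.
      rewrite ltnS => ak; apply: submx_trans (flag a ak) _.
      by apply: addsmxS => //; apply: capmxS => //; exact: addsmxSl.
    have ST : (S + T <= (S + T) :&: kermx (N ^+ k.+1))%MS.
      by rewrite sub_capmx submx_refl addsmx_sub Sk'.
    apply: submx_trans (addsmxS ST (submx_refl N)).
    rewrite -(addsmx_diff_cap_eq (kermx (N ^+ k.+1)) (S + N)%MS) addsmx_sub.
    apply/andP; split; first exact: submx_trans (addsmxSr _ _) (addsmxSl _ _).
    apply: submx_trans (capmxSr _ _) _; apply: addsmxS => //; exact: addsmxSl.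
have [S [Sn SN flag]] := step n; exists S; split=> //; last first.
  move=> a; have [/flag//|/ltnW na] := leqP a n.
  have -> : N ^+ a = N ^+ n by rewrite -(subnK na) exprD Nn mulr0.
  exact: flag.
rewrite -sub1mx; apply: submx_trans (submx_trans (flag n (leqnn n)) _).
  by apply/sub_kermxP; rewrite Nn mulmx0.
by apply: addsmxS => //; exact: capmxSl.
Qed.

End Signature.

(** * R[nu]-valued functions *)

Section RnuCalculus.
Context {R : realType} {n d : nat}.
Hypothesis n_gt0 : (0 < n)%N.
Context {O : set 'rV[R]_d}.
Hypothesis oO : open O.
Implicit Types (f g : 'rV[R]_d -> Rnu R n) (i j l : 'I_d) (p : 'rV[R]_d).

Definition nupartial l f : 'rV[R]_d -> Rnu R n := Dnu (delta_mx 0 l) f.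

Lemma nupartialE l f p : nupartial l f p = Dnu (delta_mx 0 l) f p.
Proof. by []. Qed.

Lemma nucoef_nupartial l f p a : (a < n)%N ->
  nucoef a (nupartial l f p) = partial l (fun y => nucoef a (f y)) p.
Proof. exact: nucoef_Dnu. Qed.

Lemma nupartial_eq_on f g l : (forall p, O p -> f p = g p) ->
  forall p, O p -> nupartial l f p = nupartial l g p.
Proof.
move=> fg p Op; apply: (Rnu_eqP n_gt0) => a an; rewrite !nucoef_nupartial //.
apply: (partial_eq_on _ oO _ (mem_set Op)) => q /set_mem Oq /=.
by rewrite fg.
Qed.

Lemma iter_nupartial_eq_on m f g l : (forall p, O p -> f p = g p) ->
  forall p, O p -> iter m (nupartial l) f p = iter m (nupartial l) g p.
Proof. by move=> fg; elim: m => //= m IH; exact: nupartial_eq_on. Qed.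

Lemma smooth_nu_on_cst (c : Rnu R n) : smooth_nu_on O (fun=> c).
Proof. by move=> a _; exact: smooth_on_cst. Qed.

Lemma smooth_nu_onD f g : smooth_nu_on O f -> smooth_nu_on O g ->
  smooth_nu_on O (fun p => f p + g p).
Proof.
move=> sf sg a an; under eq_fun do rewrite raddfD.
by apply: smooth_onD => //; [exact: sf|exact: sg].
Qed.

Lemma smooth_nu_onM f g : smooth_nu_on O f -> smooth_nu_on O g ->
  smooth_nu_on O (fun p => f p * g p).
Proof.
move=> sf sg a an; under eq_fun do rewrite (nucoefM n_gt0 _ _ an).
apply: smooth_on_sum => // -[i ia] /=; apply: smooth_onM => //.
  by apply: sf; lia.
by apply: sg; lia.
Qed.

Lemma smooth_nu_onZ (c : R) f : smooth_nu_on O f -> smooth_nu_on O (fun p => c *: f p).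
Proof.
move=> sf a an; under eq_fun do rewrite nucoefZ.
by apply: smooth_onM => //; [exact: smooth_on_cst|exact: sf].
Qed.

Lemma smooth_nu_onX f m : smooth_nu_on O f -> smooth_nu_on O (fun p => f p ^+ m).
Proof.
move=> sf; elim: m => [|m IH].
  by under eq_fun do rewrite expr0; exact: smooth_nu_on_cst.
by under eq_fun do rewrite exprS; exact: smooth_nu_onM.
Qed.

Lemma smooth_nu_on_sum I (r : seq I) (F : I -> 'rV[R]_d -> Rnu R n) :
  (forall x, smooth_nu_on O (F x)) -> smooth_nu_on O (fun p => \sum_(x <- r) F x p).
Proof.
move=> sF; elim: r => [|x r IH].
  by under eq_fun do rewrite big_nil; exact: smooth_nu_on_cst.
by under eq_fun do rewrite big_cons; exact: smooth_nu_onD.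
Qed.

Lemma smooth_nu_on_partial l f : smooth_nu_on O f -> smooth_nu_on O (nupartial l f).
Proof.
move=> sf a an; apply: (@smooth_on_eq _ _ _ (partial l (fun y => nucoef a (f y)))) => //.
  by move=> p _; rewrite nucoef_nupartial.
by apply: smooth_on_partial; exact: sf.
Qed.

Lemma smooth_nu_on_iter l m f : smooth_nu_on O f ->
  smooth_nu_on O (iter m (nupartial l) f).
Proof. by move=> sf; elim: m => //= m; exact: smooth_nu_on_partial. Qed.

Lemma nupartialD l f g p : smooth_nu_on O f -> smooth_nu_on O g -> O p ->
  nupartial l (fun q => f q + g q) p = nupartial l f p + nupartial l g p.
Proof.
move=> sf sg Op; apply: (Rnu_eqP n_gt0) => a an.
rewrite raddfD /= !nucoef_nupartial //; under eq_fun do rewrite raddfD.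
by apply: partialD; [exact: (smooth_on_diff (sf a an) Op)|exact: (smooth_on_diff (sg a an) Op)].
Qed.

Lemma nupartialM l f g p : smooth_nu_on O f -> smooth_nu_on O g -> O p ->
  nupartial l (fun q => f q * g q) p = nupartial l f p * g p + f p * nupartial l g p.
Proof.
move=> sf sg Op; apply: (Rnu_eqP n_gt0) => a an.
rewrite raddfD /= nucoef_nupartial // !(nucoefM n_gt0 _ _ an).
under eq_fun do rewrite (nucoefM n_gt0 _ _ an).
rewrite -big_split /=.
have df e : (e <= a)%N -> differentiable (fun q => nucoef e (f q)) p.
  by move=> ea; apply: (smooth_on_diff (sf e _) Op); lia.
have dg e : (e <= a)%N -> differentiable (fun q => nucoef e (g q)) p.
  by move=> ea; apply: (smooth_on_diff (sg e _) Op); lia.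
transitivity (\sum_(i < a.+1)
    partial l (fun q => nucoef i (f q) * nucoef (a - i) (g q)) p).
  rewrite /partial -derive_sum.
    by congr ('D_ _ _ p); apply/funext => y; rewrite fct_sumE.
  move=> i; apply: diff_derivable; apply: differentiableM.
    by apply: df; rewrite -ltnS.
  by apply: dg; exact: leq_subr.
apply: eq_bigr => i _.
have ia : (i <= a)%N by rewrite -ltnS.
rewrite partialM; [|exact: df|by apply: dg; exact: leq_subr].
rewrite !nucoef_nupartial; [|by lia|by lia].
by rewrite addrC; congr (_ + _); rewrite mulrC.
Qed.

Lemma nupartial_cst l (c : Rnu R n) p : nupartial l (fun=> c) p = 0.
Proof.
apply: (Rnu_eqP n_gt0) => a an; rewrite nucoef_nupartial // raddf0.
by rewrite partial_cst.
Qed.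

Lemma nupartialMl l (c : Rnu R n) f p : smooth_nu_on O f -> O p ->
  nupartial l (fun q => c * f q) p = c * nupartial l f p.
Proof.
move=> sf Op; rewrite (nupartialM _ (smooth_nu_on_cst c) sf Op).
by rewrite nupartial_cst mul0r add0r.
Qed.

Lemma nupartialZ l (c : R) f p : smooth_nu_on O f -> O p ->
  nupartial l (fun q => c *: f q) p = c *: nupartial l f p.
Proof.
move=> sf Op; rewrite -[RHS]mulr_algl -(nupartialMl _ _ sf Op).
by apply: nupartial_eq_on Op => q _; rewrite mulr_algl.
Qed.

Lemma iter_nupartialMl m l (c : Rnu R n) f p : smooth_nu_on O f -> O p ->
  iter m (nupartial l) (fun q => c * f q) p = c * iter m (nupartial l) f p.
Proof.
move=> sf; elim: m p => //= m IH p Op.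
rewrite -(nupartialMl _ _ (smooth_nu_on_iter l m sf) Op).
by apply: nupartial_eq_on Op => q; exact: IH.
Qed.

Lemma nupartial_sum l I (r : seq I) (F : I -> 'rV[R]_d -> Rnu R n) p :
  (forall x, smooth_nu_on O (F x)) -> O p ->
  nupartial l (fun q => \sum_(x <- r) F x q) p = \sum_(x <- r) nupartial l (F x) p.
Proof.
move=> sF Op; elim: r => [|x r IH].
  rewrite big_nil; under [X in nupartial _ X]eq_fun do rewrite big_nil.
  exact: nupartial_cst.
under [X in nupartial _ X]eq_fun do rewrite big_cons.
by rewrite big_cons -IH nupartialD //; exact: smooth_nu_on_sum.
Qed.

Lemma nupartialX l f m p : smooth_nu_on O f -> O p ->
  nupartial l (fun q => f q ^+ m) p = (f p ^+ m.-1 * nupartial l f p) *+ m.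
Proof.
move=> sf Op; elim: m => [|m IH].
  by rewrite mulr0n; under [X in nupartial _ X]eq_fun do rewrite expr0; exact: nupartial_cst.
under [X in nupartial _ X]eq_fun do rewrite exprS.
rewrite (nupartialM _ sf (smooth_nu_onX m sf) Op) IH /=.
rewrite mulrS [_ * f p ^+ m]mulrC mulrnAr; congr (_ + _).
by case: m {IH} => [|m] //=; rewrite mulrA -exprS.
Qed.

Lemma nupartialC i j f p : smooth_nu_on O f -> O p ->
  nupartial i (nupartial j f) p = nupartial j (nupartial i f) p.
Proof.
move=> sf Op; apply: (Rnu_eqP n_gt0) => a an.
have E l : (fun y => nucoef a (nupartial l f y)) = partial l (fun y => nucoef a (f y)).
  by apply/funext => y; exact: nucoef_nupartial.
have E2 l l' : nucoef a (nupartial l (nupartial l' f) p)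
    = partial l (partial l' (fun y => nucoef a (f y))) p.
  exact: etrans (nucoef_nupartial l _ p an) (congr1 (fun F => partial l F p) (E l')).
exact: etrans (E2 i j) (etrans (partialC i j oO (sf a an) Op) (esym (E2 j i))).
Qed.

Lemma iter_nupartialC i j m f p : smooth_nu_on O f -> O p ->
  nupartial i (iter m (nupartial j) f) p = iter m (nupartial j) (nupartial i f) p.
Proof.
move=> sf; elim: m p => //= m IH p Op.
rewrite (nupartialC _ _ (smooth_nu_on_iter j m sf) Op).
exact: nupartial_eq_on Op.
Qed.

End RnuCalculus.

(** * Nilpotent Taylor expansions *)

Section TaylorOperator.
#[local] Opaque nupartial.
Context {R : realType} {n d D : nat}.
Hypothesis n_gt0 : (0 < n)%N.
Context {O : set 'rV[R]_d}.
Hypothesis oO : open O.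
Context {b : 'I_D -> nat} {k : 'I_D -> nat -> 'I_d}.
Hypothesis b_gt0 : forall i, (0 < b i)%N.
Hypothesis kinj : forall i j a a', (a < b i)%N -> (a' < b j)%N ->
  k i a = k j a' -> i = j /\ a = a'.
Implicit Types (f g : 'rV[R]_d -> Rnu R n) (i j : 'I_D) (l : 'I_d) (p : 'rV[R]_d).

Local Notation Y := (nuy n b k).
Local Notation pd := (@nupartial R n d).
Local Notation smooth := (smooth_nu_on O).

Lemma nupartial_coordZ l x (u : Rnu R n) p :
  pd l (fun q => q 0 x *: u) p = (l == x)%:R *: u.
Proof.
apply: (Rnu_eqP n_gt0) => a an; rewrite nucoef_nupartial // nucoefZ.
under eq_fun do rewrite nucoefZ.
rewrite partialM; [|exact: differentiable_coord|exact: differentiable_cst].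
by rewrite partial_cst mulr0 add0r partial_coord mulrC.
Qed.

Lemma smooth_coordZ x (u : Rnu R n) : smooth (fun q => q 0 x *: u).
Proof.
move=> a an; under eq_fun do rewrite nucoefZ.
by apply: smooth_onM => //; [exact: smooth_on_coord|exact: smooth_on_cst].
Qed.

Lemma smooth_nuy i : smooth (Y i).
Proof. by apply: smooth_nu_on_sum => // a; exact: smooth_coordZ. Qed.

Lemma nupartial_nuy l i p : O p ->
  pd l (Y i) p = \sum_(1 <= a < b i) (l == k i a)%:R *: nu R n ^+ a.
Proof.
move=> Op; rewrite /nuy (nupartial_sum n_gt0 oO) //; last first.
  by move=> a; exact: smooth_coordZ.
by apply: eq_bigr => a _; exact: nupartial_coordZ.
Qed.

(** Y_i does not depend on the coordinate l. This includes x_i itself, so Y_i and d/dx_i commute as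
    operators. *)
Definition off_block i l := forall a, (1 <= a < b i)%N -> k i a != l.

Lemma nupartial_nuy_off i l p : O p -> off_block i l -> pd l (Y i) p = 0.
Proof.
move=> Op il; rewrite nupartial_nuy // big_nat big1 // => a ab.
by rewrite eq_sym (negPf (il a ab)) scale0r.
Qed.

Lemma nupartial_nuy_on i a p : O p -> (1 <= a < b i)%N ->
  pd (k i a) (Y i) p = nu R n ^+ a.
Proof.
move=> Op /andP[a0 ab]; rewrite nupartial_nuy //.
rewrite (bigD1_seq a) ?iota_uniq ?mem_index_iota ?a0 //= eqxx scale1r.
rewrite big_seq_cond big1 ?addr0 // => a' /andP[]; rewrite mem_index_iota => /andP[_ a'b].
move=> a'a; case: eqP => [/(kinj ab a'b)[_ E]|_]; last by rewrite scale0r.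
by rewrite E eqxx in a'a.
Qed.

Lemma off_block_x i j : off_block i (k j 0%N).
Proof.
move=> a /andP[a0 ab]; apply/eqP => /(kinj ab (b_gt0 j)) [_ a00].
by rewrite a00 in a0.
Qed.

Lemma off_block_y i j a : i != j -> (a < b j)%N -> off_block i (k j a).
Proof.
move=> ij ab a' /andP[_ a'b]; apply/eqP => /(kinj a'b ab) [E _].
by rewrite E eqxx in ij.
Qed.

Lemma nuyX_ge i p m : (n <= m)%N -> Y i p ^+ m = 0.
Proof.
have [u ->] : exists u, Y i p = nu R n * u.
  exists (\sum_(1 <= a < b i) p 0 (k i a) *: nu R n ^+ a.-1).
  rewrite mulr_sumr /nuy !big_nat; apply: eq_bigr => -[|a] // _.
  by rewrite -scalerAr -exprS.
by move=> nm; rewrite exprMn (nuX_ge n_gt0) ?mul0r.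
Qed.

(* exp(e Y_i d/dx_i); the sum is complete because Y_i^n = 0. *)
Definition taylor_op (e : R) i f p : Rnu R n :=
  \sum_(m < n.+1) (e ^+ m / m`!%:R) *: (Y i p ^+ m * iter m (pd (k i 0%N)) f p).

Lemma smooth_taylor_op e i f : smooth f -> smooth (taylor_op e i f).
Proof.
move=> sf; apply: smooth_nu_on_sum => // m; apply: smooth_nu_onZ => //.
apply: smooth_nu_onM => //; first by apply: smooth_nu_onX => //; exact: smooth_nuy.
exact: smooth_nu_on_iter.
Qed.

Lemma taylor_op_eq_on e i f g : (forall p, O p -> f p = g p) ->
  forall p, O p -> taylor_op e i f p = taylor_op e i g p.
Proof.
move=> fg p Op; apply: eq_bigr => m _; congr (_ *: (_ * _)).
exact: (iter_nupartial_eq_on n_gt0 oO).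
Qed.

Lemma nupartial_taylor_op l e i f p : smooth f -> O p ->
  pd l (taylor_op e i f) p = taylor_op e i (pd l f) p +
    \sum_(m < n.+1) (e ^+ m / m`!%:R) *:
      ((Y i p ^+ m.-1 * pd l (Y i) p) *+ m * iter m (pd (k i 0%N)) f p).
Proof.
move=> sf Op; have sY m := smooth_nu_onX n_gt0 oO m (smooth_nuy i).
have sI m := smooth_nu_on_iter n_gt0 oO (k i 0%N) m sf.
rewrite /taylor_op (nupartial_sum n_gt0 oO _ _ _ Op); last first.
  by move=> m; apply: smooth_nu_onZ => //; exact: smooth_nu_onM.
rewrite addrC -big_split /=; apply: eq_bigr => m _.
rewrite (nupartialZ n_gt0 oO _ _ (smooth_nu_onM n_gt0 oO (sY m) (sI m)) Op).
rewrite -scalerDr (nupartialM n_gt0 _ (sY m) (sI m) Op).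
rewrite (nupartialX n_gt0 oO _ _ (smooth_nuy i) Op).
by rewrite (iter_nupartialC n_gt0 oO).
Qed.

Lemma nupartial_taylor_op_off l e i f p : smooth f -> O p -> off_block i l ->
  pd l (taylor_op e i f) p = taylor_op e i (pd l f) p.
Proof.
move=> sf Op il; rewrite nupartial_taylor_op // big1 ?addr0 // => m _.
by rewrite nupartial_nuy_off // mulr0 mul0rn mul0r scaler0.
Qed.

Lemma taylor_opMl e i (c : Rnu R n) f p : smooth f -> O p ->
  taylor_op e i (fun q => c * f q) p = c * taylor_op e i f p.
Proof.
move=> sf Op; rewrite mulr_sumr; apply: eq_bigr => m _.
by rewrite (iter_nupartialMl n_gt0 oO) // -scalerAr mulrCA.
Qed.

(** The operator commutes with derivatives off its block and with constants of R[nu], hence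
    preserves linear relations between such derivatives. Taking c' = 0 covers vanishing. *)
Lemma taylor_op_rel e i (c c' : Rnu R n) l l' f : smooth f ->
  off_block i l -> off_block i l' ->
  (forall p, O p -> c * pd l f p = c' * pd l' f p) ->
  forall p, O p -> c * pd l (taylor_op e i f) p = c' * pd l' (taylor_op e i f) p.
Proof.
move=> sf il il' rel p Op.
rewrite (nupartial_taylor_op_off e sf Op il) (nupartial_taylor_op_off e sf Op il').
have sl := smooth_nu_on_partial n_gt0 oO l sf.
have sl' := smooth_nu_on_partial n_gt0 oO l' sf.
rewrite -(taylor_opMl e i c sl Op) -(taylor_opMl e i c' sl' Op).
exact: taylor_op_eq_on.
Qed.

(** Since dY_i/dy_(i,a) = nu^a, differentiating Y_i^(m+1) / (m+1)! produces the opposite of the term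
    of degree m coming from df/dy_(i,a) = nu^a df/dx_i. The sum telescopes, its last term dying with
    Y_i^n. *)
Lemma nupartial_taylor_opN i a f p : smooth f -> O p -> (1 <= a < b i)%N ->
  (forall q, O q -> pd (k i a) f q = nu R n ^+ a * pd (k i 0%N) f q) ->
  pd (k i a) (taylor_op (-1) i f) p = 0.
Proof.
move=> sf Op ab rel; rewrite nupartial_taylor_op //.
have sx := smooth_nu_on_partial n_gt0 oO (k i 0%N) sf.
rewrite (taylor_op_eq_on _ _ rel) // taylor_opMl // nupartial_nuy_on //.
rewrite mulr_sumr [X in _ + X]big_ord_recl mulr0n mul0r scaler0 add0r.
rewrite big_ord_recr /= nuyX_ge // mul0r scaler0 mulr0 addr0 -big_split big1 //= => m _.
rewrite /bump /= add1n add0n -iterSr iterS.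
set t := pd _ _ _; rewrite mulrnAl -(@scaler_nat R _ m.+1) scalerA.
have -> : (-1) ^+ m.+1 / (m.+1)`!%:R * m.+1%:R = - ((-1) ^+ m / m`!%:R) :> R.
  rewrite exprS factS natrM mulN1r !mulNr invfM [_^-1 * _]mulrC [_ * (_ * _)]mulrA.
  by rewrite mulfVK // pnatr_eq0.
by rewrite scaleNr -scalerAr mulrCA -mulrA subrr.
Qed.

(** The coefficients of exp(-t) exp(t) = 1, obtained from the binomial expansion of (1 - 1)^s. *)
Lemma exp_convolution s : \sum_(l < s.+1) ((-1) ^+ l / l`!%:R) * (1 / (s - l)`!%:R)
  = (s == 0)%:R :> R.
Proof.
have s0 : s`!%:R != 0 :> R by rewrite pnatr_eq0 -lt0n fact_gt0.
apply: (mulfI s0); transitivity ((1 - 1 : R) ^+ s).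
  rewrite exprDn mulr_sumr; apply: eq_bigr => -[l /= ls] _.
  rewrite -mulr_natr expr1n mul1r -(bin_fact (ltnSE ls)) !natrM mul1r.
  have l0 : l`!%:R != 0 :> R by rewrite pnatr_eq0 -lt0n fact_gt0.
  have sl0 : (s - l)`!%:R != 0 :> R by rewrite pnatr_eq0 -lt0n fact_gt0.
  by field; rewrite l0 sl0.
by rewrite subrr expr0n; case: (s) => [|s']; rewrite ?mulr1 ?mulr0.
Qed.

(** Cauchy product by total degree s = m + l: the square of indices contains more than the triangle
    s <= n, but T vanishes on the excess. *)
Lemma double_sum_convolution (T : nat -> Rnu R n) (c c' : nat -> R) :
  (forall s, (n < s)%N -> T s = 0) ->
  \sum_(m < n.+1) c' m *: (\sum_(l < n.+1) c l *: T (m + l)%N) =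
  \sum_(s < n.+1) (\sum_(l < s.+1) c l * c' (s - l)%N) *: T s.
Proof.
move=> T0.
transitivity (\sum_(l < n.+1) \sum_(s < n.+1 | (l <= s)%N) (c l * c' (s - l)%N) *: T s).
  under eq_bigr do rewrite scaler_sumr.
  rewrite exchange_big /=; apply: eq_bigr => -[l /= ln] _.
  rewrite -(big_mkord xpredT (fun m => c' m *: (c l *: T (m + l)%N))).
  rewrite -(big_mkord (fun s => (l <= s)%N) (fun s => (c l * c' (s - l)%N) *: T s)).
  rewrite (@big_cat_nat _ _ _ (n.+1 - l)) //=; last exact: leq_subr.
  rewrite [X in _ + X]big_nat_cond [X in _ + X]big1 ?addr0; last first.
    by move=> m /andP[/andP[nm _] _]; rewrite T0 ?scaler0 //; lia.
  rewrite [RHS](@big_cat_nat _ _ _ l) //=; last exact: ltnW.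
  rewrite [X in _ = X + _]big_nat_cond [X in _ = X + _]big1 ?add0r; last first.
    by move=> s /andP[/andP[_ sl]]; rewrite leqNgt sl.
  transitivity (\sum_(0 + l <= s < n.+1) (c l * c' (s - l)%N) *: T s).
    by rewrite big_addn; apply: eq_bigr => m _; rewrite addnK scalerA mulrC.
  rewrite add0n [LHS]big_nat_cond [RHS]big_nat_cond; apply: eq_bigl => s.
  by apply/idP/idP => /andP[/andP[ls sn] _]; rewrite ls sn.
rewrite (exchange_big_dep xpredT) //=; apply: eq_bigr => s _.
rewrite scaler_suml.
by rewrite (big_ord_widen_cond n.+1 xpredT (fun l : nat => (c l * c' (s - l)%N) *: T s)).
Qed.

(** Y_i being independent of x_i, the two truncated exponentials multiply as series, and nilpotency
    of Y_i makes the truncation harmless. *)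
Lemma taylor_opK i f p : smooth f -> O p ->
  taylor_op 1 i (taylor_op (-1) i f) p = f p.
Proof.
move=> sf Op.
pose T s := Y i p ^+ s * iter s (pd (k i 0%N)) f p.
have iterE m q : O q -> iter m (pd (k i 0%N)) (taylor_op (-1) i f) q
    = taylor_op (-1) i (iter m (pd (k i 0%N)) f) q.
  elim: m q => //= m IH q Oq.
  rewrite (nupartial_eq_on n_gt0 oO _ IH Oq) nupartial_taylor_op_off //.
    exact: smooth_nu_on_iter.
  exact: off_block_x.
transitivity (\sum_(m < n.+1) (1 / m`!%:R : R) *:
   \sum_(l < n.+1) ((-1) ^+ l / l`!%:R : R) *: T (m + l)%N).
  apply: eq_bigr => m _; rewrite expr1n iterE // mulr_sumr; congr (_ *: _).
  apply: eq_bigr => l _; rewrite -scalerAr mulrA -exprD -iterD.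
  by rewrite [X in iter X](addnC l).
rewrite (double_sum_convolution (fun u => (-1) ^+ u / u`!%:R) (fun m => 1 / m`!%:R)).
  rewrite big_ord_recl [X in _ + X]big1 ?addr0 => [|s _]; last first.
    by rewrite /= exp_convolution scale0r.
  by rewrite /= exp_convolution scale1r /T expr0 mul1r.
by move=> s ns; rewrite /T nuyX_ge ?mul0r //; exact: ltnW.
Qed.

Lemma iter_nupartial_sum m l I (r : seq I) (F : I -> 'rV[R]_d -> Rnu R n) p :
  (forall x, smooth (F x)) -> O p ->
  iter m (pd l) (fun q => \sum_(x <- r) F x q) p = \sum_(x <- r) iter m (pd l) (F x) p.
Proof.
move=> sF; elim: m p => //= m IH p Op.
rewrite -(nupartial_sum n_gt0 oO l r (fun x => smooth_nu_on_iter n_gt0 oO l m (sF x)) Op).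
exact: (nupartial_eq_on n_gt0 oO).
Qed.

Lemma iter_nupartialZ m l (c : R) f p : smooth f -> O p ->
  iter m (pd l) (fun q => c *: f q) p = c *: iter m (pd l) f p.
Proof.
move=> sf; elim: m p => //= m IH p Op.
rewrite -(nupartialZ n_gt0 oO _ _ (smooth_nu_on_iter n_gt0 oO l m sf) Op).
exact: (nupartial_eq_on n_gt0 oO).
Qed.

Lemma iter_nupartialMr m l f g p : smooth f -> smooth g ->
  (forall q, O q -> pd l g q = 0) -> O p ->
  iter m (pd l) (fun q => f q * g q) p = iter m (pd l) f p * g p.
Proof.
move=> sf sg g0; elim: m p => //= m IH p Op.
rewrite (nupartial_eq_on n_gt0 oO _ IH Op).
rewrite (nupartialM n_gt0 _ (smooth_nu_on_iter n_gt0 oO l m sf) sg Op).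
by rewrite g0 // mulr0 addr0.
Qed.

(** Counterpart on the chart of [partial_multi], folded in the same order so that the two match
    under descent. *)
Definition mixed_partial (al : 'I_D -> nat) f (s : seq 'I_D) :=
  foldr (fun i g => iter (al i) (pd (k i 0%N)) g) f s.

Lemma smooth_mixed_partial al f s : smooth f -> smooth (mixed_partial al f s).
Proof. by move=> sf; elim: s => //= i s IH; exact: smooth_nu_on_iter. Qed.

Lemma mixed_partial_eq (al al' : 'I_D -> nat) f s : {in s, al =1 al'} ->
  mixed_partial al f s = mixed_partial al' f s.
Proof.
elim: s => //= i s IH E; rewrite E ?mem_head // IH // => j js.
by apply: E; rewrite in_cons js orbT.
Qed.

Lemma smooth_nuy_prod (al : 'I_D -> nat) s : smooth (fun p => \prod_(i <- s) Y i p ^+ al i).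
Proof.
elim: s => [|i s IH].
  by under eq_fun do rewrite big_nil; exact: smooth_nu_on_cst.
under eq_fun do rewrite big_cons; apply: smooth_nu_onM => //.
by apply: smooth_nu_onX => //; exact: smooth_nuy.
Qed.

Lemma nupartial_nuy_prod (al : 'I_D -> nat) i s p : O p ->
  pd (k i 0%N) (fun p => \prod_(j <- s) Y j p ^+ al j) p = 0.
Proof.
move=> Op; elim: s => [|j s IH].
  under [X in pd _ X]eq_fun do rewrite big_nil.
  exact: nupartial_cst.
under [X in pd _ X]eq_fun do rewrite big_cons.
have sX := smooth_nu_onX n_gt0 oO (al j) (smooth_nuy j).
rewrite (nupartialM n_gt0 _ sX (smooth_nuy_prod al s) Op) IH mulr0 addr0.
rewrite (nupartialX n_gt0 oO _ _ (smooth_nuy j) Op).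
rewrite (nupartial_nuy_off Op (@off_block_x j i)).
by rewrite mulr0 mul0rn mul0r.
Qed.

(** The monomials in the Y_j have no x_i-derivative, so they pass through the outer operators, and
    the nested sums merge into one over the multi-indices supported in s. *)
Lemma taylor_op_expand (s : seq 'I_D) f p : uniq s -> smooth f -> O p ->
  foldr (taylor_op 1) f s p =
  \sum_(al : {ffun 'I_D -> 'I_n.+1} | [forall i, (i \notin s) ==> (al i == ord0)])
    (\prod_(i <- s) (al i)`!%:R^-1 : R) *:
      (mixed_partial (fun i => al i : nat) f s p * \prod_(i <- s) Y i p ^+ al i).
Proof.
move=> + sf; elim: s p => [|i s IH] p us Op.
  rewrite (big_pred1 [ffun=> ord0]) => [|al].
    by rewrite !big_nil scale1r mulr1.
  apply/forallP/eqP => [E|-> i]; last by rewrite ffunE eqxx.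
  by apply/ffunP => i; rewrite ffunE; have := E i; rewrite in_nil => /eqP.
have [nis us'] : i \notin s /\ uniq s by move: us => /= /andP.
pose X (al : 'I_D -> nat) q : Rnu R n := (\prod_(j <- s) (al j)`!%:R^-1 : R) *:
  (mixed_partial al f s q * \prod_(j <- s) Y j q ^+ al j).
pose P (t : seq 'I_D) (al : {ffun 'I_D -> 'I_n.+1}) :=
  [forall j, (j \notin t) ==> (al j == ord0)].
have sX al : smooth (X al).
  apply: smooth_nu_onZ => //; apply: smooth_nu_onM => //; last exact: smooth_nuy_prod.
  exact: smooth_mixed_partial.
have iterX (al : 'I_D -> nat) m : iter m (pd (k i 0%N)) (X al) p =
    (\prod_(j <- s) (al j)`!%:R^-1 : R) *: (iter m (pd (k i 0%N)) (mixed_partial al f s) p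
      * \prod_(j <- s) Y j p ^+ al j).
  have sm := smooth_mixed_partial al s sf.
  rewrite (iter_nupartialZ _ _ _ (smooth_nu_onM n_gt0 oO sm (smooth_nuy_prod al s)) Op).
  rewrite (iter_nupartialMr _ sm (smooth_nuy_prod al s) _ Op) // => q Oq.
  exact: nupartial_nuy_prod.
transitivity (\sum_(m < n.+1) \sum_(al | P s al)
   (m`!%:R^-1 : R) *: (Y i p ^+ m * iter m (pd (k i 0%N)) (X (fun j => al j : nat)) p)).
  apply: eq_bigr => m _; rewrite expr1n mul1r -scaler_sumr -mulr_sumr; congr (_ *: (_ * _)).
  rewrite -big_filter -(iter_nupartial_sum _ _ _ _ Op) //.
  apply: (iter_nupartial_eq_on n_gt0 oO) => // q Oq.
  by rewrite -[LHS]/(foldr (taylor_op 1) f s q) IH // big_filter.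
rewrite [RHS](partition_big (fun al : {ffun 'I_D -> 'I_n.+1} => al i) xpredT) //=.
apply: eq_bigr => m _.
(* Setting the exponent of i to m, and back to 0, is the bijection between multi-indices supported
   in s and those on i :: s with exponent m at i. *)
pose upd (e : 'I_n.+1) (al : {ffun 'I_D -> 'I_n.+1}) :=
  [ffun j => if j == i then e else al j].
rewrite [RHS](reindex_onto (upd m) (upd ord0)) /=; last first.
  move=> al /andP[_ /eqP alm]; apply/ffunP => j; rewrite !ffunE.
  by case: eqP => // ->.
apply: eq_big => [al|al /forallP Pal].
  apply/idP/idP => [/forallP Pal|/andP[/andP[/forallP Pal _] /eqP E]].
    apply/andP; split; first (apply/andP; split).
    - apply/forallP => j; rewrite in_cons negb_or ffunE; apply/implyP => /andP[/negPf -> js].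
      by have := Pal j; rewrite js.
    - by rewrite ffunE eqxx.
    apply/eqP/ffunP => j; rewrite !ffunE; case: eqP => // ->.
    by have := Pal i; rewrite nis => /eqP ->.
  apply/forallP => j; apply/implyP => js; rewrite -E !ffunE.
  have [//|ji] := eqVneq j i.
  by have := Pal j; rewrite in_cons negb_or ji js /= ffunE (negPf ji).
have sal : {in s, (fun j => upd m al j : nat) =1 (fun j => al j : nat)}.
  by move=> j js; rewrite ffunE; case: eqP => // ji; rewrite -ji js in nis.
rewrite iterX !big_cons ffunE eqxx (mixed_partial_eq f sal).
have -> : \prod_(j <- s) (upd m al j)`!%:R^-1 = \prod_(j <- s) (al j)`!%:R^-1 :> R.
  by rewrite big_seq [RHS]big_seq; apply: eq_bigr => j js; rewrite (sal j js).
have -> : \prod_(j <- s) Y j p ^+ upd m al j = \prod_(j <- s) Y j p ^+ al j.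
  by rewrite big_seq [RHS]big_seq; apply: eq_bigr => j js; rewrite (sal j js).
by rewrite -scalerAr scalerA mulrCA.
Qed.

End TaylorOperator.

(** * Descent to the leaf space *)

(** Constancy is asked only along A near each of its points: functions on the chart vary
    transversally to the plaques. The level set through x is open and closed relative to A. *)
Lemma locally_constant_connected (T : topologicalType) (U : Type) (f : T -> U)
    (A : set T) x y : connected A ->
  (forall z, A z -> \forall w \near z, A w -> f w = f z) -> A x -> A y -> f x = f y.
Proof.
move=> cA loc Ax Ay.
pose good z := [set w | A w -> f w = f z]°.
have ginE z w : A w -> good z w -> f w = f z.
  by move=> Aw gw; exact: (nbhs_singleton gw).
have gz z : A z -> good z z by move=> Az; exact: loc.
pose B := A `&` [set z | f z = f x].
suff BA : B = A by move: Ay; rewrite -BA => -[_ ->].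
apply: cA.
- by exists x.
- exists (\bigcup_(z in B) good z).
    by apply: bigcup_open => z _; exact: open_interior.
  apply/seteqP; split=> [z Bz|w [Aw [z [Az fz] gw]]].
    by split; [case: Bz | exists z => //; apply: gz; case: Bz].
  by split=> //=; rewrite (ginE z).
- exists (~` \bigcup_(z in A `\` B) good z).
    by apply: open_closedC; apply: bigcup_open => z _; exact: open_interior.
  apply/seteqP; split=> [w [Aw fw]|w [Aw nw]].
    split=> // -[z [Az nBz] gw]; apply: nBz; split=> //=.
    by rewrite -(ginE z w).
  split=> //; apply: contrapT => nfw; apply: nw; exists w; last exact: gz.
  by split=> // -[].
Qed.

Section Slices.
Context {R : realType}.

(** On a segment inside a ball contained in O, the direction w - z involves only coordinates along
    which the derivative vanishes; conclude by the mean value theorem. Slices of O need not be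
    convex, so the statement is local. *)
Lemma slice_locally_constant d (O : set 'rV[R]_d) (J : 'I_d -> Prop)
    (f : 'rV[R]_d -> R) z : open O -> (forall p, O p -> differentiable f p) ->
  (forall l, ~ J l -> forall p, O p -> partial l f p = 0) -> O z ->
  \forall w \near z,
    (forall l, J l -> (w : 'rV[R]_d) 0 l = z 0 l) -> f w = f z.
Proof.
move=> oO df f0 Oz.
have /nbhs_ballP [r /= r0 rO] : nbhs z O by exact: open_nbhs_nbhs.
apply/nbhs_ballP; exists r => //= w zw Jw.
have seg (t : R) : 0 <= t <= 1 -> O (z + t *: (w - z)).
  move=> /andP[t0 t1]; apply: rO; move: zw; rewrite -ball_normE /ball_ /=.
  rewrite opprD addrA subrr add0r normrN normrZ ger0_norm // -normrN opprB => zw.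
  by apply: le_lt_trans zw; rewrite ler_piMl.
pose phi (t : R) := f (z + t *: (w - z)).
have dphi (t : R) : 0 <= t <= 1 -> is_derive t 1 phi 0.
  move=> ht; have := is_derive_line (df _ (seg t ht)).
  rewrite diff_sum_delta; last exact: (df _ (seg t ht)).
  rewrite big1 // => l _; have [Jl|nJl] := pselect (J l).
    by rewrite !mxE Jw // subrr mul0r.
  by rewrite f0 ?mulr0 //; exact: seg.
have h1 (t : R) : t \in `]0, 1[%R -> is_derive t 1 phi 0.
  by rewrite in_itv /= => /andP[/ltW t0 /ltW t1]; apply: dphi; rewrite t0.
have h2 : {within `[0, 1], continuous phi}.
  apply: derivable_within_continuous => t; rewrite in_itv /= => ht.
  by have := dphi t ht; case.
have [t _] := MVT ltr01 h1 h2.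
by rewrite mul0r /phi scale1r scale0r addr0 [z + _]addrC subrK => /subr0_eq.
Qed.

Lemma nu_constant_on_slice n d (n_gt0 : (0 < n)%N) (O : set 'rV[R]_d)
    (J : 'I_d -> Prop) (f : 'rV[R]_d -> Rnu R n) (A : set 'rV[R]_d) x y :
  open O -> smooth_nu_on O f ->
  (forall l, ~ J l -> forall p, O p -> nupartial l f p = 0) ->
  A `<=` O -> connected A -> A x -> A y ->
  (forall z w l, A z -> A w -> J l -> w 0 l = z 0 l) -> f x = f y.
Proof.
move=> oO sf f0 AO cA Ax Ay Jx; apply: (Rnu_eqP n_gt0) => a an.
apply: (@locally_constant_connected _ _ (fun p => nucoef a (f p)) A) => // z Az.
have dfa p : O p -> differentiable (fun p => nucoef a (f p)) p.
  by move=> Op; exact: (smooth_on_diff (sf a an) Op).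
have f0a l : ~ J l -> forall p, O p -> partial l (fun p => nucoef a (f p)) p = 0.
  by move=> nJ p Op; rewrite -(nucoef_nupartial n_gt0) // f0 // raddf0.
apply: filterS (slice_locally_constant oO dfa f0a (AO z Az)) => w E Aw.
by apply: E => l; exact: Jx.
Qed.

(** * Local sections of the projection to the leaf space, and descent *)

Context {d D : nat} {k : 'I_D -> nat -> 'I_d}.
Hypothesis k0inj : injective (fun i => k i 0%N).

(** The section of the projection through p: the y-coordinates of p are kept. It depends on p
    because no fixed value of y need be available throughout the chart. *)
Definition lift_xcoord (p : 'rV[R]_d) (x : 'rV[R]_D) : 'rV[R]_d :=
  \row_l if [pick i | k i 0%N == l] is Some i then x 0 i else p 0 l.

Lemma lift_xcoordE p x i : lift_xcoord p x 0 (k i 0%N) = x 0 i.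
Proof.
rewrite mxE; case: pickP => [j /eqP /k0inj -> //|/(_ i)].
by rewrite eqxx.
Qed.

Lemma lift_xcoordK p x : xcoord k (lift_xcoord p x) = x.
Proof. by apply/rowP => i; rewrite mxE lift_xcoordE. Qed.

Lemma lift_xcoord_id p : lift_xcoord p (xcoord k p) = p.
Proof. by apply/rowP => l; rewrite mxE; case: pickP => // i /eqP <-; rewrite mxE. Qed.

Lemma differentiable_lift_xcoord p x l : differentiable (fun y => lift_xcoord p y 0 l) x.
Proof.
under eq_fun do rewrite mxE.
by case: pickP => [i _|_]; [exact: differentiable_coord|exact: differentiable_cst].
Qed.

Lemma partial_lift_xcoord p x l i :
  partial i (fun y => lift_xcoord p y 0 l) x = (l == k i 0%N)%:R.
Proof.
under eq_fun do rewrite mxE.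
case: pickP => [j /eqP <-|/(_ i)].
  by rewrite partial_coord eq_sym (inj_eq k0inj).
by rewrite eq_sym => ->; rewrite partial_cst.
Qed.

Lemma lift_xcoord_near (O : set 'rV[R]_d) p : open O -> O p ->
  \forall x \near xcoord k p, O (lift_xcoord p x).
Proof.
move=> oO Op.
have cl : {for xcoord k p, continuous (lift_xcoord p)}.
  apply: differentiable_continuous; apply: differentiable_mx => i l.
  by rewrite ord1; exact: differentiable_lift_xcoord.
by apply: cl; rewrite lift_xcoord_id; exact: open_nbhs_nbhs.
Qed.

Lemma open_xcoord_image (O : set 'rV[R]_d) : open O -> open (xcoord k @` O).
Proof.
move=> oO; rewrite openE => _ [p Op <-].
by apply: filterS (lift_xcoord_near oO Op) => x Ox; exists (lift_xcoord p x) => //;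
  exact: lift_xcoordK.
Qed.

Section Descent.
Context {O : set 'rV[R]_d}.
Hypothesis oO : open O.

(** Near the projection of p, Phi is F composed with the local section through p, and the chain rule
    applies. *)
Lemma descent_partial (Phi : 'rV[R]_D -> R) (F : 'rV[R]_d -> R) p :
  (forall q, O q -> Phi (xcoord k q) = F q) -> O p -> differentiable F p ->
  differentiable Phi (xcoord k p) /\
  forall i, partial i Phi (xcoord k p) = partial (k i 0%N) F p.
Proof.
move=> PF Op dF.
have near : {near xcoord k p, F \o lift_xcoord p =1 Phi}.
  apply: filterS (lift_xcoord_near oO Op) => x Ox /=.
  by rewrite -PF // lift_xcoordK.
have dl l := differentiable_lift_xcoord p (xcoord k p) l.
split.
  apply: near_eq_differentiable near _; apply: differentiable_comp.
    by apply: differentiable_mx => i l; rewrite ord1.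
  by rewrite lift_xcoord_id.
move=> i; rewrite -[LHS](near_eq_derive _ near).
rewrite [LHS](partial_comp _ dl) lift_xcoord_id //.
rewrite (bigD1 (k i 0%N)) //= partial_lift_xcoord eqxx mul1r big1 ?addr0 // => l.
by move=> /negPf li; rewrite partial_lift_xcoord li mul0r.
Qed.

Lemma descent_iter (Phi : 'rV[R]_D -> R) (F : 'rV[R]_d -> R) s :
  (forall q, O q -> Phi (xcoord k q) = F q) -> smooth_on O F ->
  forall q, O q -> foldr (@partial R D) Phi s (xcoord k q)
    = foldr (@partial R d) F [seq k i 0%N | i <- s] q.
Proof.
move=> PF sF; elim: s => //= i s IH q Oq.
by have [_ ->] := descent_partial IH Oq (sF [seq k i 0%N | i <- s] q Oq).
Qed.

Lemma descent_smooth (Phi : 'rV[R]_D -> R) (F : 'rV[R]_d -> R) :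
  (forall q, O q -> Phi (xcoord k q) = F q) -> smooth_on O F ->
  smooth_on (xcoord k @` O) Phi.
Proof.
move=> PF sF s _ [p Op <-].
by have [] := descent_partial (descent_iter s PF sF) Op (sF [seq k i 0%N | i <- s] p Op).
Qed.

Context {n : nat}.
Hypothesis n_gt0 : (0 < n)%N.

Lemma descent_nu_smooth (Phi : 'rV[R]_D -> Rnu R n) (F : 'rV[R]_d -> Rnu R n) :
  (forall q, O q -> Phi (xcoord k q) = F q) -> smooth_nu_on O F ->
  smooth_nu_on (xcoord k @` O) Phi.
Proof.
move=> PF sF a an; apply: (@descent_smooth _ (fun q => nucoef a (F q))).
  by move=> q Oq; rewrite PF.
exact: sF.
Qed.

Lemma descent_nupartial (Phi : 'rV[R]_D -> Rnu R n) (F : 'rV[R]_d -> Rnu R n) i :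
  (forall q, O q -> Phi (xcoord k q) = F q) -> smooth_nu_on O F ->
  forall q, O q -> nupartial i Phi (xcoord k q) = nupartial (k i 0%N) F q.
Proof.
move=> PF sF q Oq; apply: (Rnu_eqP n_gt0) => a an; rewrite !nucoef_nupartial //.
have PFa q' : O q' -> nucoef a (Phi (xcoord k q')) = nucoef a (F q').
  by move=> Oq'; rewrite PF.
by have [_ ->] := descent_partial (Phi := fun x => nucoef a (Phi x)) PFa Oq
  (smooth_on_diff (sF a an) Oq).
Qed.

Lemma descent_partial_multi (al : {ffun 'I_D -> nat}) (Phi : 'rV[R]_D -> Rnu R n)
    (F : 'rV[R]_d -> Rnu R n) :
  (forall q, O q -> Phi (xcoord k q) = F q) -> smooth_nu_on O F ->
  forall q, O q -> partial_multi al Phi (xcoord k q) =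
    @mixed_partial R n d D k (fun i => al i) F (enum 'I_D) q.
Proof.
move=> PF sF; rewrite /partial_multi.
elim: (enum 'I_D) => //= i s IH.
have sm := @smooth_mixed_partial R n d D n_gt0 O oO k (fun i => al i) F s sF.
elim: (al i) => //= m IHm q Oq.
exact: (descent_nupartial i IHm (smooth_nu_on_iter n_gt0 oO (k i 0%N) m sm)).
Qed.

End Descent.
End Slices.

(** * Metrics in N-integral coordinates *)

(** Truncates the sum over all multi-indices in [taylor_nu] to exponents at most n. *)
Lemma fsum_bounded_multi (V : nmodType) (D n : nat) (F : {ffun 'I_D -> nat} -> V) :
  (forall (al : {ffun 'I_D -> nat}) i, (n < al i)%N -> F al = 0) ->
  \sum_(al \in [set: {ffun 'I_D -> nat}]) F al =
  \sum_(al : {ffun 'I_D -> 'I_n.+1}) F [ffun i => al i : nat].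
Proof.
move=> F0; pose e (al : {ffun 'I_D -> 'I_n.+1}) : {ffun 'I_D -> nat} := [ffun i => al i : nat].
have einj : injective e.
  move=> al al' /ffunP E; apply/ffunP => i; apply: val_inj.
  by have := E i; rewrite !ffunE.
rewrite (@fsbigE _ _ _ _ _ [seq e al | al <- index_enum _]) //.
- by rewrite big_mkcond big_map /=; apply: eq_bigr => al _; rewrite in_setT.
- by rewrite map_inj_uniq // index_enum_uniq.
move=> al _ nal; case: (pselect (exists i, (n < al i)%N)) => [[i /F0 //]|small].
have le i : (al i < n.+1)%N by rewrite ltnS leqNgt; apply/negP => ni; apply: small; exists i.
case/negP: nal; apply/mapP; exists [ffun i => Ordinal (le i)]; first exact: mem_index_enum.
by apply/ffunP => i; rewrite !ffunE.
Qed.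

Section NuForm.
Context {R : realType} {n d : nat}.
Implicit Types (H : 'M[Rnu R n]_d) (v w : 'rV[R]_d).

Lemma nuform_sum H v w :
  nuform H v w = \sum_l \sum_l' (v 0 l)%:A * H l l' * (w 0 l')%:A.
Proof.
by rewrite /nuform formE; apply: eq_bigr => i _; apply: eq_bigr => j _; rewrite !mxE.
Qed.

Lemma nuform_delta H l l' : nuform H (delta_mx 0 l) (delta_mx 0 l') = H l l'.
Proof.
rewrite nuform_sum (bigD1 l) //= (bigD1 l') //= big1 ?addr0 => [|j jl]; last first.
  by rewrite [X in _ * X%:A]mxE (negPf jl) andbF scale0r mulr0.
rewrite big1 ?addr0 => [|i il]; last first.
  by rewrite big1 // => j _; rewrite mxE (negPf il) andbF scale0r !mul0r.
by rewrite !mxE !eqxx !scale1r mul1r mulr1.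
Qed.

Lemma nuform0l H w : nuform H 0 w = 0.
Proof.
by rewrite nuform_sum big1 // => l _; rewrite big1 // => l' _; rewrite mxE scale0r !mul0r.
Qed.

Lemma nuform0r H v : nuform H v 0 = 0.
Proof.
by rewrite nuform_sum big1 // => l _; rewrite big1 // => l' _; rewrite mxE scale0r mulr0.
Qed.

Hypothesis n_gt0 : (0 < n)%N.

Lemma Dnu_nupartial (O : set 'rV[R]_d) v (f : 'rV[R]_d -> Rnu R n) p :
  smooth_nu_on O f -> O p ->
  Dnu v f p = \sum_l (v 0 l) *: nupartial l f p.
Proof.
move=> sf Op; apply: (Rnu_eqP n_gt0) => a an; rewrite nucoef_Dnu // raddf_sum /=.
rewrite diff_sum_delta; last exact: (smooth_on_diff (sf a an) Op).
by apply: eq_bigr => l _; rewrite nucoefZ nucoef_nupartial.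
Qed.

Lemma Dnu0 (f : 'rV[R]_d -> Rnu R n) p : Dnu 0 f p = 0.
Proof. by rewrite /Dnu big1 // => a _; rewrite derive0 scale0r. Qed.

End NuForm.

(** * Components of a nilomorphic metric in N-integral coordinates *)

Section JordanCoordinates.
#[local] Opaque nuform Dnu jacobian nupartial.
Context {R : realType} {d : nat} {M : manifold R d} {n : nat}.
Context {N : mchart M -> 'rV[R]_d -> 'M[R]_d}.
Hypothesis hN : nilpotent_structure n N.
Context {c : mchart M} {D : nat} {b : 'I_D -> nat} {k : 'I_D -> nat -> 'I_d}.
Hypothesis NI : N_integral N c b k.

Let n_gt0 := nilpotency_index_gt0 hN.
Let oO : open (cimg c) := @cimg_open _ _ _ c.

Lemma chart_in_atlas : atlas c. Proof. by have [] := NI. Qed.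
Lemma block_size_gt0 i : (0 < b i)%N. Proof. by have [[+ _] _ _ _ _] := NI; apply. Qed.

Lemma coord_inj i j a a' : (a < b i)%N -> (a' < b j)%N -> k i a = k j a' ->
  i = j /\ a = a'.
Proof. by have [_ + _ _ _] := NI; apply. Qed.

Lemma coord_surj l : exists i a, (a < b i)%N /\ k i a = l.
Proof. by have [_ _ + _ _] := NI; apply. Qed.

Lemma xcoord_inj : injective (fun i => k i 0%N).
Proof. by move=> i j /(coord_inj (block_size_gt0 i) (block_size_gt0 j)) []. Qed.

Lemma delta_coord p i a : cimg c p -> (a < b i)%N ->
  delta_mx 0 (k i a) = delta_mx 0 (k i 0%N) *m N c p ^+ a :> 'rV[R]_d.
Proof.
move=> cp ab; have [_ _ _ _ /(_ p cp i) [+ _]] := NI.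
by case: a ab => [|a] ab E; [rewrite expr0 mulmx1 | exact: E].
Qed.

Lemma delta_block p i : cimg c p ->
  delta_mx 0 (k i 0%N) *m N c p ^+ b i = 0 :> 'rV[R]_d.
Proof. by move=> cp; have [_ _ _ _ /(_ p cp i) []] := NI. Qed.

(** A longer block would contain a coordinate vector in the image of N^n = 0. *)
Lemma block_size_le p i : cimg c p -> (b i <= n)%N.
Proof.
move=> cp; have b0 := block_size_gt0 i; rewrite leqNgt; apply/negP => nb.
have [_ N0 _ _] := hN.
have Nb : N c p ^+ (b i).-1 = 0.
  have -> : (b i).-1 = (n + ((b i).-1 - n))%N by lia.
  by rewrite exprD N0 ?mul0r //; exact: chart_in_atlas.
have := @delta_coord p i (b i).-1 cp; rewrite prednK // leqnn => /(_ isT).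
rewrite Nb mulmx0 => /rowP/(_ (k i (b i).-1)) /eqP.
by rewrite !mxE !eqxx oner_eq0.
Qed.

(** N shifts each coordinate vector to the next one in its block and kills the last: its matrix does
    not involve the point. *)
Lemma N_constant p q : cimg c p -> cimg c q -> N c p = N c q.
Proof.
move=> cp cq; apply/row_matrixP => l; have [i [a [ab <-]]] := coord_surj l.
have E r : cimg c r -> row (k i a) (N c r) =
    if (a.+1 < b i)%N then delta_mx 0 (k i a.+1) else 0.
  move=> cr; rewrite rowE (delta_coord cr ab) -mulmxA -[_ *m N c r]/(_ * _) -exprSr.
  case: ifPn => [ab1|]; first by rewrite (delta_coord cr ab1).
  rewrite -leqNgt => ba; have -> : a.+1 = b i by lia.
  exact: delta_block.
by rewrite !E.
Qed.

Lemma block_sum (V : nmodType) (X : 'I_d -> V) :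
  \sum_l X l = \sum_i \sum_(0 <= a < b i) X (k i a).
Proof.
pose s := [seq k i a | i <- index_enum 'I_D, a <- index_iota 0 (b i)].
have mem l : l \in s.
  have [i [a [ab <-]]] := coord_surj l; apply: allpairs_f_dep.
    exact: mem_index_enum.
  by rewrite mem_index_iota.
have us : uniq s.
  apply: allpairs_uniq_dep; first exact: index_enum_uniq.
    by move=> i _; exact: iota_uniq.
  move=> _ _ /allpairsPdep [i [a [_ ab ->]]] /allpairsPdep [j [a' [_ ab' ->]]] /= E.
  rewrite !mem_index_iota in ab ab'.
  by have [-> ->] := coord_inj ab ab' E.
transitivity (\sum_(l <- s) X l); last by rewrite big_allpairs_dep.
apply: perm_big; apply: uniq_perm => //; first exact: index_enum_uniq.
by move=> l; rewrite mem mem_index_enum.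
Qed.

Lemma Dnu_zcoord v i p : cimg c p ->
  Dnu v (zcoord n b k i) p = \sum_(0 <= a < b i) v 0 (k i a) *: nu R n ^+ a.
Proof.
move=> cp.
have -> : zcoord n b k i = fun q => \sum_(0 <= a < b i) q 0 (k i a) *: nu R n ^+ a.
  apply/funext => q; rewrite /zcoord /nuy mxE [RHS]big_ltn ?expr0 //.
  exact: block_size_gt0.
have sc a := @smooth_coordZ R n d _ oO (k i a) (nu R n ^+ a).
rewrite (Dnu_nupartial n_gt0 _ (smooth_nu_on_sum oO _ sc) cp).
under eq_bigr do rewrite (nupartial_sum n_gt0 oO _ _ sc cp) scaler_sumr.
rewrite exchange_big /=; apply: eq_bigr => a _.
rewrite (bigD1 (k i a)) //= nupartial_coordZ // eqxx scale1r big1 ?addr0 // => l.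
by move=> /negPf la; rewrite nupartial_coordZ // la scale0r scaler0.
Qed.

Section Metric.
Context {h : mchart M -> 'rV[R]_d -> 'M[Rnu R n]_d}.
Hypothesis hh : nilomorphic_metric N h.

Definition metric_coef i j q : Rnu R n := h c q (k i 0%N) (k j 0%N).

Lemma smooth_metric_entry l l' : smooth_nu_on (cimg c) (fun q => h c q l l').
Proof.
move=> a an; have [hb _ _ _] := hh; have [sh _] := hb a an.
have := sh c chart_in_atlas l l'.
by under eq_fun do rewrite mxE.
Qed.

Lemma jacobian_near_cst (V : 'rV[R]_d -> 'rV[R]_d) v p : differentiable V p ->
  (\near p, V p = v) -> 'J V p = 0.
Proof.
move=> dV nV; apply/matrixP => i l; rewrite jacobianE // [RHS]mxE.
rewrite -[RHS](derive_cst (v 0 l) p (delta_mx 0 i)); apply: near_eq_derive.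
by apply: filterS nV => q ->.
Qed.

Lemma lie_form_cst (V : 'rV[R]_d -> 'rV[R]_d) (H : 'rV[R]_d -> 'M[Rnu R n]_d) p :
  'J V p = 0 -> lie_form V H p = \matrix_(i, j) Dnu (V p) (fun q => H q i j) p.
Proof.
move=> JV; rewrite /lie_form JV.
have -> : toRnu n (0 : 'M[R]_d) = 0.
  by apply/matrixP => i j; rewrite !mxE scale0r.
by rewrite trmx0 mul0mx mulmx0 !addr0.
Qed.

(** As N is constant in this chart, constant fields are nilomorphic, and for them the Lie derivative
    of h merely differentiates the entries. *)
Lemma nilomorphic_metric_entry p v l l' : cimg c p ->
  Dnu (v *m N c p) (fun q => h c q l l') p
    = nu R n * Dnu v (fun q => h c q l l') p.
Proof.
move=> cp; have [_ _ _ hlie] := hh; have [[sN _] _ _ _] := hN.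
have nc : nbhs p (cimg c) by apply: open_nbhs_nbhs.
have ncst q : cimg c q -> \forall q' \near q, N c q' = N c q.
  move=> cq; have : nbhs q (cimg c) by apply: open_nbhs_nbhs.
  by apply: filterS => q' cq'; exact: N_constant.
have Jv (q : 'rV[R]_d) : 'J (fun=> v) q = 0.
  apply: (@jacobian_near_cst _ v); first exact: differentiable_cst.
  by apply: filterS (@filterT _ (nbhs q) _) => q' _.
have JvN : 'J (fun q => v *m N c q) p = 0.
  apply: (@jacobian_near_cst _ (v *m N c p)); last by apply: filterS (ncst p cp) => q ->.
  apply: differentiable_mulmx; first exact: differentiable_cst.
  exact: (smooth_mx_on_diff (sN c chart_in_atlas) cp).
have nv : nilomorphic_field (cimg c) (N c) (fun=> v).
  split=> [|q cq]; first exact: smooth_mx_on_cst.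
  rewrite /lie_endo (Dmx_near_eq _ (ncst q cq)) Dmx_cst Jv.
  by rewrite mul0mx mulmx0 addr0 subr0.
have E := hlie c (cimg c) _ chart_in_atlas oO (@subset_refl _ _) nv p cp.
have {}E := etrans (esym (lie_form_cst _ JvN)) (etrans E (congr1 _ (lie_form_cst _ (Jv p)))).
by have := congr1 (fun A : 'M[Rnu R n]_d => A l l') E; rewrite !mxE.
Qed.

Lemma Dnu_expmx p v l l' m : cimg c p ->
  Dnu (v *m N c p ^+ m) (fun q => h c q l l') p
    = nu R n ^+ m * Dnu v (fun q => h c q l l') p.
Proof.
move=> cp; elim: m => [|m IH]; first by rewrite !expr0 mulmx1 mul1r.
have -> : v *m N c p ^+ m.+1 = v *m N c p ^+ m *m N c p by rewrite exprSr mulmxA.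
rewrite (nilomorphic_metric_entry _ _ _ cp) IH.
by rewrite mulrA -(exprS (nu R n) m).
Qed.

Lemma nuform_expmxl p v w m : cimg c p ->
  nuform (h c p) (v *m N c p ^+ m) w = nu R n ^+ m * nuform (h c p) v w.
Proof.
move=> cp; have [_ halg _ _] := hh; elim: m => [|m IH].
  by rewrite !expr0 mulmx1 mul1r.
have [_ E _] := halg c p chart_in_atlas cp (v *m N c p ^+ m) w.
have -> : v *m N c p ^+ m.+1 = v *m N c p ^+ m *m N c p by rewrite exprSr mulmxA.
have alg (x : Rnu R n) : nu R n * (nu R n ^+ m * x) = nu R n ^+ m.+1 * x.
  by rewrite mulrA -exprS.
rewrite E IH; exact: alg.
Qed.

Lemma nuform_expmxr p v w m : cimg c p ->
  nuform (h c p) v (w *m N c p ^+ m) = nu R n ^+ m * nuform (h c p) v w.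
Proof.
move=> cp; have [_ halg _ _] := hh.
have sym v' w' : nuform (h c p) v' w' = nuform (h c p) w' v'.
  by have [] := halg c p chart_in_atlas cp v' w'.
by rewrite sym (nuform_expmxl _ _ _ cp) sym.
Qed.

Lemma metric_coef_sym i j p : cimg c p -> metric_coef i j p = metric_coef j i p.
Proof.
move=> cp; have [_ halg _ _] := hh; rewrite /metric_coef -[LHS]nuform_delta -[RHS]nuform_delta.
by have [] := halg c p chart_in_atlas cp (delta_mx 0 (k i 0%N)) (delta_mx 0 (k j 0%N)).
Qed.

Lemma metric_entry i j a a' p : cimg c p -> (a < b i)%N -> (a' < b j)%N ->
  h c p (k i a) (k j a') = nu R n ^+ a * nu R n ^+ a' * metric_coef i j p.
Proof.
move=> cp ab ab'; rewrite /metric_coef -[LHS]nuform_delta.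
rewrite (delta_coord cp ab) (delta_coord cp ab').
rewrite (nuform_expmxl _ _ _ cp) (nuform_expmxr _ _ _ cp) nuform_delta.
exact: mulrA.
Qed.

(** nu^(b i) passes into the form as N^(b i), which kills d/dx_i; likewise for j. *)
Lemma metric_coef_ann i j p : cimg c p ->
  nu R n ^+ b i * metric_coef i j p = 0 /\ nu R n ^+ b j * metric_coef i j p = 0.
Proof.
move=> cp; rewrite /metric_coef -(nuform_delta (h c p)); split.
  by rewrite -(nuform_expmxl _ _ _ cp) (delta_block i cp) nuform0l.
by rewrite -(nuform_expmxr _ _ _ cp) (delta_block j cp) nuform0r.
Qed.

Lemma nuform_zcoord p v w : cimg c p ->
  nuform (h c p) v w = \sum_i \sum_j metric_coef i j p
    * Dnu v (zcoord n b k i) p * Dnu w (zcoord n b k j) p.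
Proof.
move=> cp; rewrite nuform_sum block_sum; apply: eq_bigr => i _.
transitivity (\sum_(0 <= a < b i) \sum_j \sum_(0 <= a' < b j)
    (v 0 (k i a))%:A * h c p (k i a) (k j a') * (w 0 (k j a'))%:A).
  by apply: eq_bigr => a _; rewrite block_sum.
rewrite exchange_big /=; apply: eq_bigr => j _.
rewrite (Dnu_zcoord _ _ cp) (Dnu_zcoord _ _ cp).
rewrite -mulrA big_distrl mulr_sumr /= !big_nat; apply: eq_bigr => a ab.
rewrite big_distrr mulr_sumr /= !big_nat; apply: eq_bigr => a' ab'.
rewrite metric_entry // mulr_algl mulr_algr.
set x := v 0 _; set y := w 0 _; set m := metric_coef i j p.
by rewrite -!scalerAl -!scalerAr !scalerA [y * x]mulrC [_ * m]mulrC.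
Qed.

End Metric.
End JordanCoordinates.

(** * Composition of the exponentials over all blocks *)

Section TaylorFold.
#[local] Opaque nuform Dnu nupartial.
Context {R : realType} {n d D : nat}.
Hypothesis n_gt0 : (0 < n)%N.
Context {O : set 'rV[R]_d}.
Hypothesis oO : open O.
Context {b : 'I_D -> nat} {k : 'I_D -> nat -> 'I_d}.
Hypothesis b_gt0 : forall i, (0 < b i)%N.
Hypothesis kinj : forall i j a a', (a < b i)%N -> (a' < b j)%N ->
  k i a = k j a' -> i = j /\ a = a'.

Local Notation T e := (@taylor_op R n d D b k e).
Local Notation pd := (@nupartial R n d).

Lemma smooth_taylor_fold e f s : smooth_nu_on O f -> smooth_nu_on O (foldr (T e) f s).
Proof. by move=> sf; elim: s => //= i s; exact: smooth_taylor_op. Qed.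

Lemma taylor_fold_eq_on e f g s : (forall p, O p -> f p = g p) ->
  forall p, O p -> foldr (T e) f s p = foldr (T e) g s p.
Proof. by move=> fg; elim: s => //= i s IH; exact: taylor_op_eq_on. Qed.

(** With the list reversed, inverse operators meet in adjacent pairs, so their commutation is not
    involved. *)
Lemma taylor_foldK f s : smooth_nu_on O f -> forall p, O p ->
  foldr (T 1) (foldr (T (-1)) f (rev s)) s p = f p.
Proof.
elim: s f => //= i s IH f sf p Op; rewrite rev_cons foldr_rcons.
have sT : smooth_nu_on O (T (-1) i f) by exact: smooth_taylor_op.
rewrite (taylor_op_eq_on n_gt0 oO 1 i (IH _ sT) Op).
exact: (taylor_opK n_gt0 oO b_gt0 kinj).
Qed.

(** Each operator removes the y-dependence of its own block and preserves the relations of the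
    others. As s has no repetition, the relation of a block still holds when its operator is
    applied. *)
Lemma taylor_fold_nilomorphic f s i a : smooth_nu_on O f -> uniq s ->
  (forall i a p, (1 <= a < b i)%N -> O p ->
    pd (k i a) f p = nu R n ^+ a * pd (k i 0%N) f p) ->
  (1 <= a < b i)%N -> forall p, O p ->
  pd (k i a) (foldr (T (-1)) f s) p =
    if i \in s then 0 else nu R n ^+ a * pd (k i 0%N) (foldr (T (-1)) f s) p.
Proof.
move=> sf + nf; elim: s i a => [|j s IH] i a us ab p Op; first exact: nf.
move: us => /= /andP[js us].
have sF := smooth_taylor_fold (-1) s sf.
have rel (c' : Rnu R n) (q : 'rV[R]_d) : i != j ->
    (forall q, O q -> pd (k i a) (foldr (T (-1)) f s) q
       = c' * pd (k i 0%N) (foldr (T (-1)) f s) q) -> O q ->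
    pd (k i a) (T (-1) j (foldr (T (-1)) f s)) q
      = c' * pd (k i 0%N) (T (-1) j (foldr (T (-1)) f s)) q.
  move=> ij E Oq.
  have o1 : @off_block d D b k j (k i a).
    by apply: (off_block_y kinj); [rewrite eq_sym | case/andP: ab].
  have o2 : @off_block d D b k j (k i 0%N) by exact: (off_block_x b_gt0 kinj).
  have E1 q' : O q' -> 1 * pd (k i a) (foldr (T (-1)) f s) q'
      = c' * pd (k i 0%N) (foldr (T (-1)) f s) q'.
    by move=> Oq'; rewrite mul1r; exact: E.
  exact: etrans (esym (mul1r _)) (taylor_op_rel n_gt0 oO (-1) sF o1 o2 E1 Oq).
rewrite in_cons; have [ij|ij] /= := eqVneq i j.
  subst j; apply: (nupartial_taylor_opN n_gt0 oO kinj sF Op ab) => q Oq.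
  by rewrite (IH i a us ab q Oq) (negPf js).
case: ifPn => is_; last first.
  by apply: rel => // q Oq; rewrite (IH i a us ab q Oq) (negPf is_).
rewrite (rel 0) ?mul0r // => q Oq.
by rewrite (IH i a us ab q Oq) is_ mul0r.
Qed.

(** Applied with c = nu^(b i), this carries to the descended function the relation that makes it
    adapted. *)
Lemma taylor_fold_ann f s i (c : Rnu R n) : smooth_nu_on O f ->
  (forall p, O p -> c * pd (k i 0%N) f p = 0) ->
  forall p, O p -> c * pd (k i 0%N) (foldr (T (-1)) f s) p = 0.
Proof.
move=> sf f0; elim: s => //= j s IH p Op.
have off : @off_block d D b k j (k i 0%N) by exact: (off_block_x b_gt0 kinj).
have sF := smooth_taylor_fold (-1) s sf.
have E q : O q -> c * pd (k i 0%N) (foldr (T (-1)) f s) q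
    = 0 * pd (k i 0%N) (foldr (T (-1)) f s) q.
  by move=> Oq; rewrite mul0r; exact: IH.
exact: etrans (taylor_op_rel n_gt0 oO (-1) sF off off E Op) (mul0r _).
Qed.

Lemma taylor_nu_fold (F : 'rV[R]_d -> Rnu R n) (Phi : 'rV[R]_D -> Rnu R n) p :
  injective (fun i => k i 0%N) -> smooth_nu_on O F ->
  (forall q, O q -> Phi (xcoord k q) = F q) -> O p ->
  taylor_nu b k Phi p = foldr (T 1) F (enum 'I_D) p.
Proof.
move=> k0 sF PF Op.
rewrite (taylor_op_expand n_gt0 oO b_gt0 kinj (enum_uniq _) sF Op) /taylor_nu.
rewrite (@fsum_bounded_multi _ _ n); last first.
  move=> al i ni; rewrite [X in _ *: (_ * X)](bigD1 i) //=.
  rewrite (nuyX_ge n_gt0) ?mul0r ?mulr0 ?scaler0 //.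
  exact: ltnW.
apply: eq_big => [al|al _].
  by apply/esym/forallP => i; rewrite mem_enum.
rewrite (descent_partial_multi k0 oO n_gt0 _ PF sF Op) !big_enum /=; congr (_ *: (_ * _)).
- rewrite natr_prod -prodfV; apply: eq_bigr => i _.
  by rewrite ffunE.
- by congr (_ p); apply: mixed_partial_eq => i _; rewrite ffunE.
- by apply: eq_bigr => i _; rewrite ffunE.
Qed.

End TaylorFold.

(** * The normal form in nilomorphic coordinates *)

Section NormalForm.
#[local] Opaque nuform Dnu nupartial.
Context {R : realType} {d : nat} {M : manifold R d} {n : nat}.
Context {N : mchart M -> 'rV[R]_d -> 'M[R]_d}.
Hypothesis hN : nilpotent_structure n N.
Context {h : mchart M -> 'rV[R]_d -> 'M[Rnu R n]_d}.
Hypothesis hh : nilomorphic_metric N h.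

Lemma normal_form_metric c D (b : 'I_D -> nat) (k : 'I_D -> nat -> 'I_d) :
  N_integral N c b k -> trivial_foliation c k -> normal_form N h c b k.
Proof.
move=> NI tf; have n_gt0 := nilpotency_index_gt0 hN.
have oO : open (cimg c) by exact: cimg_open.
have b0 := block_size_gt0 NI; have kinj := coord_inj NI; have k0 := xcoord_inj NI.
pose H := @metric_coef R d M n c D k h.
have sH i j : smooth_nu_on (cimg c) (H i j) by exact: (smooth_metric_entry NI hh).
have niloH i j p v m : cimg c p ->
    Dnu (v *m N c p ^+ m) (H i j) p = nu R n ^+ m * Dnu v (H i j) p.
  by move=> cp; exact: (Dnu_expmx hN NI hh).
pose F i j := foldr (@taylor_op R n d D b k (-1)) (H i j) (rev (enum 'I_D)).
have sF i j : smooth_nu_on (cimg c) (F i j) by exact: smooth_taylor_fold.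
have Fy i j l a p : (1 <= a < b l)%N -> cimg c p -> nupartial (k l a) (F i j) p = 0.
  move=> ab cp; rewrite /F (taylor_fold_nilomorphic n_gt0 oO b0 kinj) //.
  - by rewrite mem_rev mem_enum.
  - by rewrite rev_uniq enum_uniq.
  move=> l' a' q /andP[_ ab'] cq; rewrite !nupartialE.
  have E := niloH i j q (delta_mx 0 (k l' 0%N)) a' cq.
  have E2 := delta_coord NI cq ab'.
  rewrite -E2 in E.
  exact: E.
(* The source is N^(b l) d/dx_l = 0, read through the nilomorphy of H. *)
have Fx i j l p : cimg c p -> nu R n ^+ b l * nupartial (k l 0%N) (F i j) p = 0.
  move=> cp; apply: (taylor_fold_ann n_gt0 oO b0 kinj) => // q cq.
  rewrite nupartialE -(niloH _ _ _ _ _ cq) (delta_block NI _ cq).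
  exact: Dnu0.
(* An arbitrary point of the plaque over x; the default 0 is reached only outside the leaf space. No
   regularity of this choice is used, since F is constant on plaques. *)
pose lft (x : 'rV[R]_D) : 'rV[R]_d := xget 0 [set p | cimg c p /\ xcoord k p = x].
pose Hc i j x := F i j (lft x).
have HcF i j q : cimg c q -> Hc i j (xcoord k q) = F i j q.
  move=> cq; rewrite /Hc; set q' := lft _.
  have [cq' xq'] : cimg c q' /\ xcoord k q' = xcoord k q.
    by apply: (@xgetPex _ _ [set p | cimg c p /\ xcoord k p = xcoord k q]); exists q.
  apply: (@nu_constant_on_slice _ _ _ n_gt0 (cimg c) (fun l => exists i, l = k i 0%N)
    _ (cimg c `&` [set p | xcoord k p = xcoord k q])) => //.
  - move=> l nl p cp; have [l' [a [ab E]]] := coord_surj NI l; subst l.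
    case: a ab nl => [|a] ab nl; first by case: nl; exists l'.
    by apply: Fy.
  - by move=> z w _ [_ xz] [_ xw] [l ->]; have := congr1 (fun x : 'rV_D => x 0 l)
      (etrans xw (esym xz)); rewrite !mxE.
have oX : open (leaf_space c k) by exact: open_xcoord_image.
have sHc i j : smooth_nu_on (leaf_space c k) (Hc i j).
  exact: (descent_nu_smooth k0 oO (HcF i j) (sF i j)).
have HcH i j p : cimg c p -> H i j p = taylor_nu b k (Hc i j) p.
  move=> cp; rewrite (taylor_nu_fold n_gt0 oO b0 kinj k0 (sF i j) (HcF i j) cp).
  by rewrite (taylor_foldK n_gt0 oO b0 kinj).
have Hsym i j p : cimg c p -> H i j p = H j i p by exact: (metric_coef_sym NI hh).
exists H, Hc; split.
- move=> i j; split.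
    split=> // p v cp.
    by rewrite -[N c p]expr1 niloH // expr1.
  split=> // a an x x' Xx xx'.
  pose J l := (a < b l)%N.
  pose A := quotient_leaf (leaf_space c k) b a x.
  have sf : smooth_nu_on (leaf_space c k) (fun x => nu R n ^+ a * Hc i j x).
    by apply: smooth_nu_onM => //; exact: smooth_nu_on_cst.
  have AX : A `<=` leaf_space c k `&` [set y | forall i, (a < b i)%N -> y 0 i = x 0 i].
    exact: connected_component_sub.
  apply: (@nu_constant_on_slice _ _ _ n_gt0 (leaf_space c k) J
    (fun x => nu R n ^+ a * Hc i j x) A) => //.
  + move=> l nJ _ [p cp <-]; rewrite (nupartialMl n_gt0 _ _ (sHc i j)); last by exists p.
    rewrite (descent_nupartial k0 oO n_gt0 _ (HcF i j) (sF i j) cp).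
    (* Along a leaf of pi(K^a) only coordinates with b l <= a vary, and for these nu^a contains the
       annihilating factor nu^(b l). *)
    have -> : a = (a - b l + b l)%N by rewrite subnK // leqNgt; apply/negP.
    by rewrite exprD -mulrA Fx // mulr0.
  + by move=> y /AX [].
  + exact: component_connected.
  + by apply: connected_component_refl; split.
  + by move=> z w l /AX[_ zE] /AX[_ wE] Jl; rewrite zE // wE.
- move=> i j p cp; split; first exact: Hsym.
  rewrite !HcF //; apply: (taylor_fold_eq_on n_gt0 oO) cp => q cq; exact: Hsym.
- move=> i j p cp; have [e1 e2] := metric_coef_ann NI hh i j cp.
  have bi := block_size_le hN NI i cp; have bj := block_size_le hN NI j cp.
  by rewrite minnE; apply: (nuX_ann_dvd n_gt0); rewrite -minnE; case: (leqP (b i) (b j)).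
- move=> p cp w w0 i.
  have ex l : exists ia : 'I_D * nat, (ia.2 < b ia.1)%N /\ k ia.1 ia.2 = l.
    by have [i' [a [ab E]]] := coord_surj NI l; exists (i', a).
  have [idx idxE] := choice ex.
  (* v is built so that dz_i(v) agrees with w i modulo nu^(b i), an ambiguity that H i j kills; the
     hypothesis on w thus says h(v, .) = 0. *)
  pose v : 'rV[R]_d := \row_l nucoef (idx l).2 (w (idx l).1).
  have vE i' a : (a < b i')%N -> v 0 (k i' a) = nucoef a (w i').
    move=> ab; rewrite mxE; have [ab' E] := idxE (k i' a).
    by have [-> ->] := kinj _ _ _ _ ab' ab E.
  have zE i' : exists u, w i' - Dnu v (zcoord n b k i') p = nu R n ^+ b i' * u.
    apply: (nuX_dvd n_gt0) => a ab an; rewrite raddfB /= (Dnu_zcoord hN NI) // raddf_sum /=.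
    rewrite (bigD1_seq a) ?iota_uniq ?mem_index_iota //= vE // nucoefZ.
    rewrite (nucoef_nuX n_gt0) eqxx an mulr1 big1 ?addr0 ?subrr // => a' /negPf a'a.
    by rewrite nucoefZ (nucoef_nuX n_gt0) eq_sym a'a mulr0.
  have v0 : v = 0.
    have [_ _ nd _] := hh; apply: (nd c p (chart_in_atlas NI) cp) => u.
    rewrite (nuform_zcoord hN NI hh _ _ cp) exchange_big /= big1 // => j _.
    rewrite -mulr_suml.
    rewrite [X in X * _](_ : _ = 0) ?mul0r //.
    rewrite -[RHS](w0 j); apply: eq_bigr => i' _; have [t tE] := zE i'.
    rewrite mulrC; apply/esym/subr0_eq; rewrite -mulrBl tE mulrAC.
    by have [-> _] := metric_coef_ann NI hh i' j cp; rewrite mul0r.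
  by apply: (nuX_dvd n_gt0) => a ab _; rewrite -vE // v0 mxE.
- move=> p cp; split=> [v w|i j]; last exact: HcH.
  exact: (nuform_zcoord hN NI hh).
Qed.

End NormalForm.

Theorem theorem3p3 (R : realType) (d : nat) (M : manifold R d) (n : nat)
  (N : mchart M -> 'rV[R]_d -> 'M[R]_d) (hN : nilpotent_structure n N)
  (g : mchart M -> 'rV[R]_d -> 'M[R]_d) :
  ([/\ pseudo_riemannian g, self_adjoint N g & parallel g N] <->
   exists h : mchart M -> 'rV[R]_d -> 'M[Rnu R n]_d,
     nilomorphic_metric N h /\ real_metric g h) /\
  (forall h : mchart M -> 'rV[R]_d -> 'M[Rnu R n]_d,
     nilomorphic_metric N h -> real_metric g h ->
     (forall (c : mchart M) (D : nat) (b : 'I_D -> nat)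
        (k : 'I_D -> nat -> 'I_d),
        N_integral N c b k -> trivial_foliation c k ->
        normal_form N h c b k) /\
     (forall (c : mchart M) (p : 'rV[R]_d), atlas c -> cimg c p ->
        (exists S, flag_complement (N c p) S) /\
        (forall S, flag_complement (N c p) S ->
           forall a, (1 <= a <= n)%N ->
             char_signature (N c p) (g c p) a
             = metric_signature (N c p) (h c p) S a))).
Proof.
split.
  split=> [[pg sa par]|[h [hh rm]]]; first exact: nilomorphic_metric_of_parallel.
  split; [exact: (real_metric_pseudo_riemannian hN hh rm)
        | exact: (real_metric_self_adjoint hN hh rm)
        | exact: (real_metric_parallel hN hh rm)].
move=> h hh rm; split=> [c D b k|c p ac cp]; first exact: normal_form_metric.
have [_ N0 _ _] := hN.
split=> [|S fS a /andP[a0 an]]; first exact: flag_complement_exists (N0 c p ac cp).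
rewrite (char_signature_complement a0 _ fS); last first.
  exact: (real_metric_selfadjoint hN hh rm).
(* The form g(., N^(a-1) .) is the component of index (n - 1) - (a - 1) = n - a of h. *)
rewrite /metric_signature -(nilomorphic_component hN hh rm ac cp); last by lia.
by congr (signature (nucoef_mx _ _)); lia.
Qed.
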